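(* Let $[\mathcal{K}]$ be a germ of hedgehog, and let $\mathrm{Aut}([\mathcal{K}]) = \{ g\in\mathrm{Diff}(\mathbb{C},0) : g([\mathcal{K}]) = [\mathcal{K}]\}$. Then the map $\lambda:\mathrm{Aut}([\mathcal{K}])\to\mathbb{C}^*$, $\lambda(g) = g'(0)$, is an injective group homomorphism with image contained in the unit circle $S^1\subset\mathbb{C}^*$. Consequently $\mathrm{Aut}([\mathcal{K}])$ is abelian and each element of $\mathrm{Aut}([\mathcal{K}])$ is uniquely determined by its rotation number.
   Context: $\mathrm{Diff}(\mathbb{C},0)$ is the group of germs at $0$ of holomorphic diffeomorphisms fixing $0$. A germ $f(z)=e^{2\pi i\alpha}z+O(z^2)$ with $\alpha\in\mathbb{R}\setminus\mathbb{Q}$ is linearizable if there is a holomorphic $h(w)=w+O(w^2)$ with $h^{-1}\circ f\circ h=R_\alpha$, $R_\alpha(w)=e^{2\pi i\alpha}w$; otherwise nonlinearizable. A Siegel compact of $f$ is a full, connected, compact $K\subset\mathbb{C}$ with $0\in K$, $K\ne\{0\}$, such that $f,f^{-1}$ extend univalently to a neighbourhood of $K$ and $f(K)=f^{-1}(K)=K$; $\mathcal{K}(f)$ is the family of all Siegel compacta of $f$. For families $\mathcal{K}$ of compacta containing $0$ with members of arbitrarily small diameter, $\mathcal{K}_1\sim\mathcal{K}_2$ if there is $\epsilon>0$ such that every compact of diameter $<\epsilon$ lies in $\mathcal{K}_1$ iff it lies in $\mathcal{K}_2$; classes are called germs of compacta. A germ of hedgehog is a germ $[\mathcal{K}(f)]$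 for some nonlinearizable $f$ with irrational rotation number. A germ $\phi$ acts by $\phi([\mathcal{K}])=[\{\phi(K):K\in\mathcal{K}'\}]$ for a representative $\mathcal{K}'\sim\mathcal{K}$ all of whose members have a neighbourhood on which $\phi$ is defined. The rotation number of $g$ with $|g'(0)|=1$ is the $\theta\in\mathbb{R}/\mathbb{Z}$ with $g'(0)=e^{2\pi i\theta}$. *)

(* Defs.v *)
(* The complex plane is modelled as R[i]
   (mathcomp-real-closed) over an arbitrary R : realType, equipped with its
   modulus topology / normed structure over itself (so [differentiable] below
   is complex differentiability). *)
From HB Require Import structures.
From mathcomp Require Import all_boot all_order all_algebra.
From mathcomp Require Import all_classical all_reals all_analysis.
From mathcomp.real_closed Require Import complex.
Import Order.TTheory GRing.Theory Num.Theory.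
Export numFieldTopology.Exports numFieldNormedType.Exports.

Set Implicit Arguments.
Unset Strict Implicit.
Unset Printing Implicit Defensive.

Local Open Scope ring_scope.
Local Open Scope classical_set_scope.

(* The complex numbers, as a numClosedFieldType (hence a normed module over
   itself, with the topology of the modulus). *)
Definition Cplx (R : realType) : numClosedFieldType := R[i].


Definition holo_on {R : realType} (U : set (Cplx R)) (f : (Cplx R) -> (Cplx R)) : Prop :=
  forall z, U z -> differentiable f z.

Definition germ_eq {R : realType} (f g : (Cplx R) -> (Cplx R)) : Prop :=
  \forall z \near (0 : (Cplx R)), f z = g z.

(* f represents an element of Diff(C,0): holomorphic on a neighbourhood of 0,
   fixing 0, with non-vanishing derivative at 0 (hence a local biholomorphism) *)
Definition in_Diff0 {R : realType} (f : (Cplx R) -> (Cplx R)) : Prop :=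
  exists r : (Cplx R), 0 < r /\ holo_on (ball 0 r) f /\ f 0 = 0 /\ f^`() 0 != 0.

Definition expi {R : realType} (t : R) : (Cplx R) :=
  (Complex (cos (2 * pi * t)) (sin (2 * pi * t)) : (Cplx R)).

Definition irrational {R : realType} (a : R) : Prop := forall q : rat, a <> ratr q.

Definition rot {R : realType} (a : R) : (Cplx R) -> (Cplx R) := fun w => expi a * w.

Definition linearizable {R : realType} (f : (Cplx R) -> (Cplx R)) (a : R) : Prop :=
  exists (h hinv : (Cplx R) -> (Cplx R)) (r : (Cplx R)), 0 < r /\
    holo_on (ball 0 r) h /\ holo_on (ball 0 r) hinv /\
    h 0 = 0 /\ h^`() 0 = 1 /\
    germ_eq (hinv \o h) id /\ germ_eq (h \o hinv) id /\
    germ_eq (hinv \o f \o h) (rot a).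

Definition nonlin_irrational {R : realType} (f : (Cplx R) -> (Cplx R)) : Prop :=
  in_Diff0 f /\
  exists a : R, irrational a /\ f^`() 0 = expi a /\ ~ linearizable f a.

Definition full {R : realType} (K : set (Cplx R)) : Prop := connected (~` K).

Definition Siegel_compact {R : realType} (f : (Cplx R) -> (Cplx R)) (K : set (Cplx R)) : Prop :=
  compact K /\ connected K /\ full K /\ K 0 /\ K <> [set 0] /\
      (exists (U : set (Cplx R)) (F : (Cplx R) -> (Cplx R)),
          open U /\ K `<=` U /\ holo_on U F /\ (forall x y, U x -> U y -> F x = F y -> x = y) /\
              germ_eq F f /\ F @` K = K) /\
      (exists (V : set (Cplx R)) (G : (Cplx R) -> (Cplx R)),
          open V /\ K `<=` V /\ holo_on V G /\ (forall x y, V x -> V y -> G x = G y -> x = y) /\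
              germ_eq (G \o f) id /\ G @` K = K).

Definition Siegel_compacta {R : realType} (f : (Cplx R) -> (Cplx R)) : set (set (Cplx R)) :=
  [set K | Siegel_compact f K].

Definition diam_lt {R : realType} (K : set (Cplx R)) (eps : (Cplx R)) : Prop :=
  exists d : (Cplx R), d < eps /\ forall x y, K x -> K y -> `|x - y| <= d.

Definition small_family {R : realType} (KK : set (set (Cplx R))) : Prop :=
  (forall K, KK K -> compact K /\ K 0) /\
  (forall eps : (Cplx R), 0 < eps -> exists K, KK K /\ diam_lt K eps).

Definition germ_equiv {R : realType} (K1 K2 : set (set (Cplx R))) : Prop :=
  exists eps : (Cplx R), 0 < eps /\
    forall K, compact K -> diam_lt K eps -> (K1 K <-> K2 K).

Definition hedgehog_germ {R : realType} (KK : set (set (Cplx R))) : Prop :=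
  small_family KK /\
  exists f : (Cplx R) -> (Cplx R), nonlin_irrational f /\ germ_equiv KK (Siegel_compacta f).

Definition image_family {R : realType} (g : (Cplx R) -> (Cplx R)) (r : (Cplx R)) (KK : set (set (Cplx R))) : set (set (Cplx R)) :=
  fun L => exists K, [/\ KK K, K `<=` ball 0 r & L = g @` K].

(* g([KK]) = [KK]: g is represented on the disc B(0,r) by a univalent
   holomorphic map, and the image of the representative
   {K in KK | K within B(0,r)} ~ KK is again ~ KK *)
Definition fixes_germ {R : realType} (g : (Cplx R) -> (Cplx R)) (KK : set (set (Cplx R))) : Prop :=
  exists r : (Cplx R), [/\ 0 < r, holo_on (ball 0 r) g, (forall x y, ball 0 r x -> ball 0 r y -> g x = g y -> x = y)
                 & germ_equiv (image_family g r KK) KK].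

Definition Aut {R : realType} (KK : set (set (Cplx R))) (g : (Cplx R) -> (Cplx R)) : Prop :=
  in_Diff0 g /\ fixes_germ g KK.

(* Main.v *)
(** Let [f] be a nonlinearizable germ with irrational rotation number [a] whose
small Siegel compacta are the small members of [KK], and let [g] preserve the
germ of [KK], so that [g] permutes these small compacta.

If [K] is a small Siegel compact of maximal radius [rho], then [K] is almost
dense in the circle [|z| = rho]: the orbit under [f] of a point of [K] of
modulus [rho] stays in [K] and, for a bounded time, follows the irrational
rotation up to [o(rho)].

Suppose [g'(0) = 1] and [g <> id], say [g z = z + b z^(n+1) + O(z^(n+2))] with
[b <> 0].  For [N ~ t / rho^n] the iterate [g^N] is, at scale [rho], the time-[t]
flow of [b z^(n+1)] up to [O(t^2)].  It pushes points outwards in the directions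
[u] with [b u^n > 0] and inwards in those with [b u^n < 0], so [g^N(K)] is not
nearly dense in a circle centred at [0] although it is a small Siegel compact:
contradiction.  Hence [g'(0) = 1] forces [g = id], so [lambda] is injective and
the automorphisms commute.

If [|g'(0)| < 1], let [h] be the Koenigs linearization of [g].  As [f] is itself
an automorphism it commutes with [g], so [h f h^-1] commutes with a linear
contraction, hence is linear and [f] is linearizable: contradiction.  Applied
to [g] and to its inverse, this gives [|g'(0)| = 1].

The Taylor expansion of a complex differentiable function comes from Goursat's
bisection argument applied to the form [f(z) dz / (z - w)] along the homotopy
contracting a circle to [w]. *)
Require Import Defs.
From HB Require Import structures.
From mathcomp Require Import all_boot all_order all_algebra.
From mathcomp Require Import all_classical all_reals all_analysis.
From mathcomp.real_closed Require Import complex.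
From mathcomp Require Import ring lra.
Import Order.TTheory GRing.Theory Num.Theory.
Import numFieldTopology.Exports numFieldNormedType.Exports.
Local Open Scope ring_scope.
Local Open Scope classical_set_scope.
Import Normc.
Set Implicit Arguments.
Unset Strict Implicit.
Unset Printing Implicit Defensive.

(** * Modulus and complex derivative *)

Section Modulus.
Variable R : realType.
Local Notation C := (Cplx R).
Implicit Types (z w x y : C) (f g : C -> C) (r : R).

(** One application of [g] moves a point of modulus rho by only O(rho^(n+1)), invisible to a density
    statement that is accurate to a fixed fraction of rho. About t / rho^n iterations produce a
    displacement of order t rho with error O(t^2 rho), and density to within t^2 rho holds once the
    compact is small enough. Hence the order of choices: t from the Taylor data of [g], then the
    compact, then N. If rho' is the maximal modulus of g^N(K), a point of K in an expanding
    direction gives rho' >= rho (1 + N rho^n |b| - D1 t^2); a point of g^N(K) in a contracting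
    direction, pulled back to K, gives rho' <= rho (1 + D2 t^2). With N rho^n >= t / 2 this bounds
    |b| by a multiple of t, which the choice of t excludes. Two obstacles: a Siegel compact is
    invariant under an extension known to agree with [f] only near 0, so the agreement must be
    carried along the connected compact; and every intermediate g^j(K) must stay small, as [g] acts
    on the family only at small scale. *)

Definition cmod z : R := normc z.

Definition ofR r : C := Complex r 0.

Lemma norm_cmod z : `|z| = ofR (cmod z).
Proof. by []. Qed.

Lemma ofR_le r s : (ofR r <= ofR s) = (r <= s).
Proof. exact: lecR. Qed.

Lemma ofR_lt r s : (ofR r < ofR s) = (r < s).
Proof. exact: ltcR. Qed.

Lemma ofRD r s : ofR (r + s) = ofR r + ofR s.
Proof. exact: (rmorphD (real_complex R)). Qed.

Lemma ofRM r s : ofR (r * s) = ofR r * ofR s.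
Proof. exact: (rmorphM (real_complex R)). Qed.

Lemma ofRN r : ofR (- r) = - ofR r.
Proof. exact: (rmorphN (real_complex R)). Qed.

Lemma ofR0 : ofR 0 = 0. Proof. by []. Qed.
Lemma ofR1 : ofR 1 = 1. Proof. by []. Qed.

Lemma ofRX r n : ofR (r ^+ n) = ofR r ^+ n.
Proof. exact: (rmorphXn (real_complex R)). Qed.

Lemma ofR_nat n : ofR n%:R = n%:R.
Proof. exact: (rmorph_nat (real_complex R)). Qed.

Lemma ofR_gt0 r : (0 < ofR r) = (0 < r).
Proof. exact: ltcR. Qed.

Lemma pos_ofR z : 0 < z -> exists2 r, 0 < r & z = ofR r.
Proof.
case: z => a b; rewrite ltcE /= => /andP[/eqP -> a0].
by exists a.
Qed.

Lemma cmod0 : cmod 0 = 0. Proof. exact: normc0. Qed.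
Lemma cmod1 : cmod 1 = 1. Proof. exact: normc1. Qed.

Lemma cmodM z w : cmod (z * w) = cmod z * cmod w.
Proof. exact: normcM. Qed.

Lemma cmodN z : cmod (- z) = cmod z.
Proof. exact: normcN. Qed.

Lemma cmodBC z w : cmod (z - w) = cmod (w - z).
Proof. by rewrite -cmodN opprB. Qed.

Lemma cmodV z : cmod z^-1 = (cmod z)^-1.
Proof. exact: normcV. Qed.

Lemma cmodX z n : cmod (z ^+ n) = cmod z ^+ n.
Proof. by elim: n => [|n IH]; rewrite ?expr0 ?cmod1 // !exprS cmodM IH. Qed.

Lemma cmod_ge0 z : 0 <= cmod z.
Proof. by case: z => a b; exact: sqrtr_ge0. Qed.

Lemma cmod_eq0 z : (cmod z == 0) = (z == 0).
Proof.
apply/eqP/eqP => [/eq0_normc //|->]; exact: cmod0.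
Qed.

Lemma cmod_gt0 z : (0 < cmod z) = (z != 0).
Proof. by rewrite lt_def cmod_ge0 cmod_eq0 andbT. Qed.

Lemma cmodD z w : cmod (z + w) <= cmod z + cmod w.
Proof. exact: le_normcD. Qed.

Lemma cmodB z w : cmod (z - w) <= cmod z + cmod w.
Proof. by rewrite -(cmodN w) cmodD. Qed.

Lemma cmod_tri z w x : cmod (z - w) <= cmod (z - x) + cmod (x - w).
Proof. have -> : z - w = (z - x) + (x - w) by ring. exact: cmodD. Qed.

Lemma cmod_sub z w : cmod z - cmod w <= cmod (z - w).
Proof. by rewrite lerBlDr -{1}(subrK w z) cmodD. Qed.

Lemma cmod_ofR r : cmod (ofR r) = `|r|.
Proof. by rewrite /cmod /= expr0n addr0 sqrtr_sqr. Qed.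

Lemma cmod_Re z : `|complex.Re z| <= cmod z.
Proof.
case: z => a b /=; rewrite -sqrtr_sqr ler_wsqrtr //.
by rewrite lerDl sqr_ge0.
Qed.

Lemma cmod_Im z : `|complex.Im z| <= cmod z.
Proof.
case: z => a b /=; rewrite -sqrtr_sqr ler_wsqrtr //.
by rewrite lerDr sqr_ge0.
Qed.

Lemma cmod_ReIm z : cmod z <= `|complex.Re z| + `|complex.Im z|.
Proof.
case: z => a b; rewrite [complex.Re _]/= [complex.Im _]/=.
have -> : (Complex a b : C) = ofR a + (Complex 0 1 : C) * ofR b.
  exact: (complexE (Complex a b)).
apply: le_trans (cmodD _ _) _; rewrite cmodM !cmod_ofR.
by rewrite {1}/cmod /= expr0n add0r expr1n sqrtr1 mul1r.
Qed.

Lemma ball_cmod z r w : ball z (ofR r) w <-> cmod (w - z) < r.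
Proof.
rewrite -ball_normE /ball_ /= norm_cmod ofR_lt cmodBC; exact: iff_refl.
Qed.

Lemma nbhs_cmod z (P : C -> Prop) :
  (\forall w \near z, P w) <-> exists2 d, 0 < d & forall w, cmod (w - z) < d -> P w.
Proof.
split.
  move=> /nbhs_ballP[e /= e0 eP]; have [d d0 ed] := pos_ofR e0.
  by exists d => // w wd; apply: eP; rewrite ed; apply/ball_cmod.
move=> [d d0 dP]; apply/nbhs_ballP; exists (ofR d) => /=; first by rewrite ofR_gt0.
by move=> w /ball_cmod /dP.
Qed.

(** Multiplied out, so that the estimate involves no quotient and [w = z] is allowed; [cderiv_cvg]
    matches it with the limit of difference quotients. *)
Definition cderiv f z d := forall e, 0 < e ->
  exists2 s, 0 < s & forall w, cmod (w - z) < s ->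
    cmod (f w - f z - d * (w - z)) <= e * cmod (w - z).

Lemma cderiv_cvg f z d : cderiv f z d <->
  h^-1 *: ((f \o shift z) (h *: 1) - f z) @[h --> (0 : C)^'] --> d.
Proof.
split.
  move=> fd; apply/cvgrPdist_le => eps /pos_ofR[e e0 ->].
  have [s s0 sP] := fd _ e0.
  apply/nbhs_ballP; exists (ofR s) => /=; first by rewrite ofR_gt0.
  move=> h /ball_cmod; rewrite subr0 => hs h0.
  rewrite norm_cmod ofR_le.
  have {sP} := sP (h + z); rewrite addrK => /(_ hs).
  have h0' : 0 < cmod h by rewrite cmod_gt0.
  rewrite -ler_pdivrMr // -cmodV -cmodM => H.
  apply: le_trans H; rewrite -cmodN le_eqVlt; apply/orP; left; apply/eqP; congr cmod.
  rewrite /= /GRing.scale /= mulr1; field.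
  exact: h0.
move=> /cvgrPdist_le H e e0.
have /nbhs_ballP[eps /= /pos_ofR[s s0 ->] sP] := H (ofR e) ltac:(by rewrite ofR_gt0).
exists s => // w ws; have [->|wz] := eqVneq w z.
  by rewrite !subrr mulr0 subr0 cmod0 mulr0.
have wz0 : w - z != 0 by rewrite subr_eq0.
have := sP (w - z); rewrite /= norm_cmod ofR_le => H1.
have : cmod (d - (w - z)^-1 *: (f ((w - z) *: 1 + z) - f z)) <= e.
  by apply: H1 => //; apply/ball_cmod; rewrite subr0.
have wz1 : 0 < cmod (w - z) by rewrite cmod_gt0.
rewrite -(ler_pM2r wz1) -cmodM; apply: le_trans.
rewrite -cmodN le_eqVlt; apply/orP; left; apply/eqP; congr cmod.
rewrite /= /GRing.scale /= mulr1 subrK; field.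
exact: wz0.
Qed.

Lemma cderiv_derive1 f z d : cderiv f z d -> derive1 f z = d.
Proof.
move/cderiv_cvg => H; rewrite derive1E /derive; apply: cvg_lim => //.
Qed.

Lemma cderiv_differentiable f z d : cderiv f z d -> differentiable f z.
Proof.
move/cderiv_cvg => H; apply/derivable1_diffP/cvg_ex; by exists d.
Qed.

Lemma differentiable_cderiv f z : differentiable f z -> cderiv f z (derive1 f z).
Proof.
move/derivable1_diffP => H; apply/cderiv_cvg.
by rewrite derive1E.
Qed.

End Modulus.

(** * Complex-valued functions of a real variable *)

Section RealParameter.
Variable R : realType.
Local Notation C := (Cplx R).
Implicit Types (phi psi : R -> C) (x y a b : R).

(* Stated on real and imaginary parts because [Cplx R] is a normed module over
   itself only, not over [R]. *)
Definition rder phi x (d : C) :=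
  is_derive x 1 (@complex.Re R \o phi) (complex.Re d) /\
  is_derive x 1 (@complex.Im R \o phi) (complex.Im d).

Lemma ReD (z w : C) : complex.Re (z + w) = complex.Re z + complex.Re w.
Proof. by case: z; case: w. Qed.
Lemma ImD (z w : C) : complex.Im (z + w) = complex.Im z + complex.Im w.
Proof. by case: z; case: w. Qed.
Lemma ReN (z : C) : complex.Re (- z) = - complex.Re z.
Proof. by case: z. Qed.
Lemma ImN (z : C) : complex.Im (- z) = - complex.Im z.
Proof. by case: z. Qed.
Lemma ReM (z w : C) : complex.Re (z * w) =
  complex.Re z * complex.Re w - complex.Im z * complex.Im w.
Proof. by case: z; case: w. Qed.
Lemma ImM (z w : C) : complex.Im (z * w) =
  complex.Re z * complex.Im w + complex.Im z * complex.Re w.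
Proof. by case: z; case: w. Qed.

Lemma rder_eq phi psi x d e :
  rder phi x d -> phi =1 psi -> d = e -> rder psi x e.
Proof. by move=> H /funext <- <-. Qed.

Lemma rder_cst (c : C) x : rder (fun=> c) x 0.
Proof. by split; exact: is_derive_cst. Qed.

Lemma rderD phi psi x d e :
  rder phi x d -> rder psi x e -> rder (fun t => phi t + psi t) x (d + e).
Proof.
move=> [H1 H2] [H3 H4]; split.
- rewrite ReD (_ : _ \o _ = (@complex.Re R \o phi) + (@complex.Re R \o psi)).
    exact: is_deriveD.
  by apply/funext => t /=; rewrite ReD.
- rewrite ImD (_ : _ \o _ = (@complex.Im R \o phi) + (@complex.Im R \o psi)).
    exact: is_deriveD.
  by apply/funext => t /=; rewrite ImD.
Qed.

Lemma rderM phi psi x d e :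
  rder phi x d -> rder psi x e ->
  rder (fun t => phi t * psi t) x (d * psi x + phi x * e).
Proof.
move=> [H1 H2] [H3 H4]; split.
- rewrite (_ : _ \o _ = (@complex.Re R \o phi) * (@complex.Re R \o psi)
                      - (@complex.Im R \o phi) * (@complex.Im R \o psi)).
    have := is_deriveB (is_deriveM H1 H3) (is_deriveM H2 H4).
    congr (is_derive _ _ _); rewrite ReD !ReM /= /GRing.scale /=; ring.
  by apply/funext => t /=; rewrite ReM.
- rewrite (_ : _ \o _ = (@complex.Re R \o phi) * (@complex.Im R \o psi)
                      + (@complex.Im R \o phi) * (@complex.Re R \o psi)).
    have := is_deriveD (is_deriveM H1 H4) (is_deriveM H2 H3).
    congr (is_derive _ _ _); rewrite ImD !ImM /= /GRing.scale /=; ring.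
  by apply/funext => t /=; rewrite ImM.
Qed.

Lemma rderZ (c : C) phi x d :
  rder phi x d -> rder (fun t => c * phi t) x (c * d).
Proof.
move=> H; apply: rder_eq (rderM (rder_cst c x) H) _ _ => //; ring.
Qed.

Lemma rderB phi psi x d e :
  rder phi x d -> rder psi x e -> rder (fun t => phi t - psi t) x (d - e).
Proof.
move=> H1 H2; apply: rder_eq (rderD H1 (rderZ (-1) H2)) _ _ => [t|]; ring.
Qed.

Lemma rderX phi x d n :
  rder phi x d -> rder (fun t => phi t ^+ n.+1) x (n.+1%:R * phi x ^+ n * d).
Proof.
move=> H; elim: n => [|n IH].
  by apply: rder_eq H _ _ => [t|]; rewrite ?expr1 // expr0 !mul1r.
apply: rder_eq (rderM H IH) _ _ => [t|]; first by rewrite -exprS.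
rewrite [phi x ^+ n.+1]exprS -[in RHS](addn1 n.+1) natrD; ring.
Qed.

(** The real mean value theorem is applied to the two parts separately, at different intermediate
    points; this costs the factor 2 that recurs in the integral bounds below. *)
Lemma rder_mvt phi (dphi : R -> C) M a b : a <= b ->
  (forall t, a <= t <= b -> rder phi t (dphi t)) ->
  (forall t, a <= t <= b -> cmod (dphi t) <= M) ->
  cmod (phi b - phi a) <= 2 * M * (b - a).
Proof.
move=> ab H HM.
have sub t : t \in `]a, b[%R -> a <= t <= b.
  by rewrite in_itv /= => /andP[/ltW -> /ltW ->].
have [c1 c1i E1] : exists2 c, c \in `[a, b]%R &
    complex.Re (phi b) - complex.Re (phi a) = complex.Re (dphi c) * (b - a).
  apply: (MVT_segment ab (f := @complex.Re R \o phi) (df := @complex.Re R \o dphi)).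
    by move=> t /sub /H [].
  apply: derivable_within_continuous => t; rewrite in_itv /= => /H [[]] //.
have [c2 c2i E2] : exists2 c, c \in `[a, b]%R &
    complex.Im (phi b) - complex.Im (phi a) = complex.Im (dphi c) * (b - a).
  apply: (MVT_segment ab (f := @complex.Im R \o phi) (df := @complex.Im R \o dphi)).
    by move=> t /sub /H [].
  apply: derivable_within_continuous => t; rewrite in_itv /= => /H [_ []] //.
have ba0 : 0 <= b - a by rewrite subr_ge0.
apply: le_trans (cmod_ReIm _) _.
rewrite ReD ImD ReN ImN E1 E2 !normrM (ger0_norm ba0) -mulrDl ler_wpM2r //.
rewrite mulr2n mulrDl !mul1r; apply: lerD.
  by apply: le_trans (cmod_Re _) _; apply: HM; move: c1i; rewrite in_itv.
by apply: le_trans (cmod_Im _) _; apply: HM; move: c2i; rewrite in_itv.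
Qed.

Definition rcont phi := forall x e, 0 < e ->
  exists2 s, 0 < s & forall y, `|y - x| < s -> cmod (phi y - phi x) <= e.

Lemma rcontE phi : rcont phi <->
  continuous (@complex.Re R \o phi) /\ continuous (@complex.Im R \o phi).
Proof.
split=> [H|[H1 H2]].
  split=> x; apply/cvgrPdist_le => e /(H x)[s s0 sP].
    near=> y; rewrite /= -ReN -ReD.
    apply: le_trans (cmod_Re _) _; rewrite cmodBC; apply: sP.
    by near: y; apply/nbhs_ballP; exists s => //= y; rewrite /ball /= distrC.
  near=> y; rewrite /= -ImN -ImD.
  apply: le_trans (cmod_Im _) _; rewrite cmodBC; apply: sP.
  by near: y; apply/nbhs_ballP; exists s => //= y; rewrite /ball /= distrC.
move=> x e e0; have e20 : 0 < e / 2 by rewrite divr_gt0.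
have /cvgrPdist_le /(_ _ e20) /nbhs_ballP[s1 /= s10 P1] := H1 x.
have /cvgrPdist_le /(_ _ e20) /nbhs_ballP[s2 /= s20 P2] := H2 x.
exists (Num.min s1 s2); first by rewrite lt_min s10.
move=> y; rewrite lt_min => /andP[y1 y2].
apply: le_trans (cmod_ReIm _) _; rewrite ReD ImD ReN ImN (splitr e).
by apply: lerD; rewrite distrC; [apply: P1|apply: P2]; rewrite /ball /= distrC.
Unshelve. all: by end_near. Qed.

Lemma rcont_cst (c : C) : rcont (fun=> c).
Proof. by move=> x e e0; exists 1 => // y _; rewrite subrr cmod0 ltW. Qed.

Lemma rcontD phi psi : rcont phi -> rcont psi -> rcont (fun t => phi t + psi t).
Proof.
move=> /rcontE[H1 H2] /rcontE[H3 H4]; apply/rcontE; split=> x.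
  rewrite (_ : _ \o _ = (fun t => (@complex.Re R \o phi) t + (@complex.Re R \o psi) t)).
    by apply: cvgD; [exact: H1|exact: H3].
  by apply/funext => t /=; rewrite ReD.
rewrite (_ : _ \o _ = (fun t => (@complex.Im R \o phi) t + (@complex.Im R \o psi) t)).
  by apply: cvgD; [exact: H2|exact: H4].
by apply/funext => t /=; rewrite ImD.
Qed.

Lemma rcontM phi psi : rcont phi -> rcont psi -> rcont (fun t => phi t * psi t).
Proof.
move=> /rcontE[H1 H2] /rcontE[H3 H4]; apply/rcontE; split=> x.
  rewrite (_ : _ \o _ = (fun t =>
     (@complex.Re R \o phi) t * (@complex.Re R \o psi) t -
     (@complex.Im R \o phi) t * (@complex.Im R \o psi) t)).
    apply: cvgB; apply: cvgM;
      by [exact: H1|exact: H2|exact: H3|exact: H4].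
  by apply/funext => t /=; rewrite ReM.
rewrite (_ : _ \o _ = (fun t =>
   (@complex.Re R \o phi) t * (@complex.Im R \o psi) t +
   (@complex.Im R \o phi) t * (@complex.Re R \o psi) t)).
  apply: cvgD; apply: cvgM;
    by [exact: H1|exact: H2|exact: H3|exact: H4].
by apply/funext => t /=; rewrite ImM.
Qed.

Lemma rcont_rder phi (dphi : R -> C) : (forall x, rder phi x (dphi x)) -> rcont phi.
Proof.
move=> H; apply/rcontE; split=> x; apply: differentiable_continuous;
  by apply/derivable1_diffP; have [[? _] [? _]] := H x.
Qed.

Lemma rcontV phi : rcont phi -> (forall x, phi x != 0) -> rcont (fun t => (phi t)^-1).
Proof.
move=> H nz x e e0.
have m0 : 0 < cmod (phi x) by rewrite cmod_gt0.
have [s s0 sP] := H x _ (divr_gt0 m0 (ltr0n _ 2)).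
have [s' s'0 s'P] := H x (e * (cmod (phi x) ^+ 2 / 2)) ltac:(by rewrite !(mulr_gt0, divr_gt0, exprn_gt0)).
exists (Num.min s s'); first by rewrite lt_min s0.
move=> y; rewrite lt_min => /andP[/sP ys /s'P ys'].
have my : cmod (phi x) / 2 <= cmod (phi y).
  have := cmod_sub (phi x) (phi y); rewrite cmodBC; lra.
have -> : (phi y)^-1 - (phi x)^-1 = - (phi y - phi x) * ((phi y)^-1 * (phi x)^-1).
  by field; rewrite !nz.
rewrite cmodM cmodN cmodM !cmodV.
have my0 : 0 < cmod (phi y) by rewrite cmod_gt0.
rewrite -invfM ler_pdivrMr ?mulr_gt0 //.
apply: le_trans ys' _; rewrite ler_pM2l //.
nra.
Qed.

End RealParameter.

(** * Antiderivatives and integrals of complex-valued paths *)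

Section Primitive.
Variable R : realType.
Local Notation C := (Cplx R).
Implicit Types (phi psi : R -> C) (x y a b : R).

(** Integrating from [-1] keeps [0] in the interior of the domain, so the primitive has a two-sided
    derivative at the left end of intervals that start at [0]. *)
Lemma real_primitive (f : R -> R) : continuous f ->
  exists F : R -> R, forall x, -1 < x -> is_derive x 1 F (f x).
Proof.
move=> fc.
exists (fun x => \int[lebesgue_measure]_(t in `[(-1 : R), x]) f t).
move=> x x1.
have xx1 : x < x + 1 by rewrite ltrDl.
have intf : lebesgue_measure.-integrable `[-1, (x + 1)%R] (EFin \o f).
  apply: continuous_compact_integrable; first exact: segment_compact.
  by apply: continuous_subspaceT => ?; exact: fc.
have [H1 H2] := @continuous_FTC1_closed R f (-1) x (x + 1) xx1 intf x1 (fc x).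
split; first exact: H1.
by rewrite -H2 derive1E.
Qed.

(** Continuity is assumed under the existential, so that [prim] can be chosen for every path without
    a proof argument. *)
Lemma rprimitive phi : exists P : R -> C, rcont phi ->
  forall x, -1 < x -> rder P x (phi x).
Proof.
have [|] := pselect (rcont phi); last by exists phi.
move=> /rcontE[/real_primitive[F HF] /real_primitive[G HG]].
exists (fun x => Complex (F x) (G x)) => _ x x1; split.
  by rewrite (_ : _ \o _ = F) //; exact: HF.
by rewrite (_ : _ \o _ = G) //; exact: HG.
Qed.

Definition prim phi : R -> C := sval (cid (rprimitive phi)).

Lemma primP phi x : rcont phi -> -1 < x -> rder (prim phi) x (phi x).
Proof. by rewrite /prim; case: cid => P /= H /H; apply. Qed.

(* Antiderivatives are only provided on [x > -1], so [cint phi a b] is the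
   integral for [0 <= a <= b] only. *)
Definition cint phi a b : C := prim phi b - prim phi a.

Lemma cint_eq phi P a b : 0 <= a <= b -> rcont phi ->
  (forall x, a <= x <= b -> rder P x (phi x)) -> cint phi a b = P b - P a.
Proof.
move=> /andP[a0 ab] pc HP.
have := @rder_mvt R (fun t => prim phi t - P t) (fun=> 0) 0 a b ab.
rewrite mulr0 mul0r => H.
apply/eqP; rewrite -subr_eq0 -cmod_eq0 eq_le cmod_ge0 andbT.
have -> : cint phi a b - (P b - P a) = prim phi b - P b - (prim phi a - P a).
  rewrite /cint; ring.
apply: H => [t tab|t _]; last by rewrite cmod0.
apply: rder_eq (rderB (primP pc _) (HP _ tab)) _ _ => //; last by rewrite subrr.
by move: tab => /andP[]; lra.
Qed.

Lemma cint_bound phi M a b : 0 <= a <= b -> rcont phi ->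
  (forall x, a <= x <= b -> cmod (phi x) <= M) ->
  cmod (cint phi a b) <= 2 * M * (b - a).
Proof.
move=> /andP[a0 ab] pc HM; apply: rder_mvt (HM) => // t /andP[t0 _].
by apply: primP => //; lra.
Qed.

Lemma cintD phi psi a b : 0 <= a <= b -> rcont phi -> rcont psi ->
  cint (fun t => phi t + psi t) a b = cint phi a b + cint psi a b.
Proof.
move=> /[dup] ab /andP[a0 _] H1 H2; rewrite (@cint_eq _ (fun t => prim phi t + prim psi t)) //.
- rewrite /cint; ring.
- exact: rcontD.
- by move=> x /andP[x0 _]; apply: rderD; apply: primP => //; lra.
Qed.

Lemma cintZ (c : C) phi a b : 0 <= a <= b -> rcont phi ->
  cint (fun t => c * phi t) a b = c * cint phi a b.
Proof.
move=> /[dup] ab /andP[a0 _] H1; rewrite (@cint_eq _ (fun t => c * prim phi t)) //.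
- rewrite /cint; ring.
- by apply: rcontM => //; exact: rcont_cst.
- by move=> x /andP[x0 _]; apply: rderZ; apply: primP => //; lra.
Qed.

Lemma cint_sum n (phi : nat -> R -> C) a b : 0 <= a <= b ->
  (forall k, rcont (phi k)) ->
  rcont (fun t => \sum_(k < n) phi k t) /\
  cint (fun t => \sum_(k < n) phi k t) a b = \sum_(k < n) cint (phi k) a b.
Proof.
move=> ab H; elim: n => [|n [IH1 IH2]].
  under [X in rcont X]funext do rewrite big_ord0.
  under [X in cint X]funext do rewrite big_ord0.
  split; first exact: rcont_cst.
  rewrite big_ord0 (@cint_eq _ (fun=> 0)) ?subrr //; first exact: rcont_cst.
  by move=> x _; exact: rder_cst.
under [X in rcont X]funext do rewrite big_ord_recr.
under [X in cint X]funext do rewrite big_ord_recr.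
by rewrite /= big_ord_recr cintD // IH2; split => //; apply: rcontD.
Qed.

End Primitive.

(** * Goursat's theorem *)

Section Bisection.
Variable R : realType.
Implicit Types (a c l m : R).

Lemma nested_segments (a b : nat -> R) :
  (forall n, a n <= a n.+1) -> (forall n, b n.+1 <= b n) -> (forall n, a n <= b n) ->
  exists s, forall n, a n <= s <= b n.
Proof.
move=> amono bmono ab.
have a_le n k : a n <= a (n + k)%N.
  by elim: k => [|k IH]; rewrite ?addn0 // addnS; apply: le_trans IH _.
have b_le n k : b (n + k)%N <= b n.
  by elim: k => [|k IH]; rewrite ?addn0 // addnS; apply: le_trans IH.
have {}ab n k : a k <= b n.
  have [/subnKC <-|/ltnW /subnKC <-] := leqP k n.
    by apply: le_trans (a_le k (n - k)%N) _.
  by apply: le_trans (b_le n (k - n)%N).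
exists (sup (range a)) => n; apply/andP; split.
  apply: ub_le_sup; last by exists n.
  by exists (b 0%N) => _ [k _ <-].
by apply: ge_sup => [|_ [k _ <-]]; [exists (a 0%N), 0%N|].
Qed.

(** [Bad n x y] speaks of the rectangle with lower left corner [(x, y)] and sides [l / 2 ^+ n],
    [m / 2 ^+ n]; the corner alone is recorded because the stage fixes the size. *)
Lemma bisection (Bad : nat -> R -> R -> Prop) a c l m :
  0 <= l -> 0 <= m -> Bad 0%N a c ->
  (forall n x y, Bad n x y -> exists i j : bool,
    Bad n.+1 (x + i%:R * (l / 2 ^+ n.+1)) (y + j%:R * (m / 2 ^+ n.+1))) ->
  exists s t, forall n, exists x y, [/\ Bad n x y,
    a <= x <= s, s <= x + l / 2 ^+ n <= a + l,
    c <= y <= t & t <= y + m / 2 ^+ n <= c + m].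
Proof.
move=> l0 m0 B0 BS.
have step n (p : R * R) : exists q : R * R, Bad n p.1 p.2 ->
    Bad n.+1 q.1 q.2 /\ exists i j : bool,
     q = (p.1 + i%:R * (l / 2 ^+ n.+1), p.2 + j%:R * (m / 2 ^+ n.+1)).
  have [|] := pselect (Bad n p.1 p.2); last by exists p.
  move=> /[dup] H /BS[i [j Bij]].
  exists (p.1 + i%:R * (l / 2 ^+ n.+1), p.2 + j%:R * (m / 2 ^+ n.+1)) => _.
  by split => //; exists i, j.
pose nxt n p := sval (cid (step n p)).
have nxtP n p : Bad n p.1 p.2 -> Bad n.+1 (nxt n p).1 (nxt n p).2 /\
   exists i j : bool, nxt n p =
     (p.1 + i%:R * (l / 2 ^+ n.+1), p.2 + j%:R * (m / 2 ^+ n.+1)).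
  by rewrite /nxt; case: cid.
pose fix u n := if n is k.+1 then nxt k (u k) else (a, c).
have Bu n : Bad n (u n).1 (u n).2.
  by elim: n => [//|n /nxtP[]].
have half (k : R) n : k / 2 ^+ n = 2 * (k / 2 ^+ n.+1).
  by rewrite exprS; field; rewrite expf_neq0.
have pos (k : R) n : 0 <= k -> 0 <= k / 2 ^+ n by move=> ?; rewrite divr_ge0 // exprn_ge0.
have uS n : exists i j : bool, u n.+1 =
     ((u n).1 + i%:R * (l / 2 ^+ n.+1), (u n).2 + j%:R * (m / 2 ^+ n.+1)).
  by have [_] := nxtP n (u n) (Bu n).
have M1 n : (u n).1 <= (u n.+1).1.
  have [i [j ->]] := uS n => /=; have := pos l n.+1 l0; case: i => /=; lra.
have M2 n : (u n).2 <= (u n.+1).2.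
  have [i [j ->]] := uS n => /=; have := pos m n.+1 m0; case: j => /=; lra.
have N1 n : (u n.+1).1 + l / 2 ^+ n.+1 <= (u n).1 + l / 2 ^+ n.
  have [i [j ->]] := uS n => /=; rewrite (half l n); have := pos l n.+1 l0; case: i => /=; lra.
have N2 n : (u n.+1).2 + m / 2 ^+ n.+1 <= (u n).2 + m / 2 ^+ n.
  have [i [j ->]] := uS n => /=; rewrite (half m n); have := pos m n.+1 m0; case: j => /=; lra.
have B1 n : (u n).1 <= (u n).1 + l / 2 ^+ n by rewrite lerDl pos.
have B2 n : (u n).2 <= (u n).2 + m / 2 ^+ n by rewrite lerDl pos.
have [s sP] := nested_segments M1 N1 B1.
have [t tP] := nested_segments M2 N2 B2.
have ge1 n : a <= (u n).1 by elim: n => [//|n IH]; apply: le_trans IH _.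
have ge2 n : c <= (u n).2 by elim: n => [//|n IH]; apply: le_trans IH _.
have le1 n : (u n).1 + l / 2 ^+ n <= a + l.
  by elim: n => [|n IH]; [rewrite expr0 divr1|apply: le_trans IH].
have le2 n : (u n).2 + m / 2 ^+ n <= c + m.
  by elim: n => [|n IH]; [rewrite expr0 divr1|apply: le_trans IH].
exists s, t => n; exists (u n).1, (u n).2.
have /andP[? ?] := sP n; have /andP[? ?] := tP n.
by split; rewrite ?ge1 ?ge2 ?le1 ?le2 //; apply/andP.
Qed.

End Bisection.

Section Geometric.
Variable R : realType.

Lemma expr_small (x e M : R) : 0 <= x < 1 -> 0 < e -> 0 <= M -> exists n : nat, M * x ^+ n < e.
Proof.
move=> /andP[x0 x1] e0 M0.
have /cvgrPdist_lt /(_ _ e0) [n _ nP] : geometric M x n @[n --> \oo] --> (0 : R).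
  by apply: cvg_geometric; rewrite ger0_norm.
exists n; have := nP n (leqnn n); rewrite /= sub0r normrN /geometric /=.
by apply: le_lt_trans; rewrite ler_norm.
Qed.

End Geometric.

Section Goursat.
Variable R : realType.
Local Notation C := (Cplx R).

Lemma cint_chasles (phi : R -> C) a b c : cint phi a c = cint phi a b + cint phi b c.
Proof. rewrite /cint; ring. Qed.

(** As [ph' = ph * p], the path [(A + B * ph) * p] has the primitive [A * P + B * ph]; only the
    deviation of [g] from its affine model contributes to the error. *)
Lemma goursat_edge (g ph p P : R -> C) (A B : C) e K (a b : R) : 0 <= a <= b ->
  rcont (fun t => g t * p t) ->
  (forall t, a <= t <= b -> rder P t (p t)) ->
  (forall t, a <= t <= b -> rder ph t (ph t * p t)) ->
  (forall t, a <= t <= b -> cmod (p t) <= K) ->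
  (forall t, a <= t <= b -> cmod (g t - (A + B * ph t)) <= e) ->
  cmod (cint (fun t => g t * p t) a b - (A * (P b - P a) + B * (ph b - ph a)))
    <= 2 * (e * K) * (b - a).
Proof.
move=> /andP[a0 ab] gc HP Hph HK He.
pose F t := prim (fun t => g t * p t) t - (A * P t + B * ph t).
have -> : cint (fun t => g t * p t) a b - (A * (P b - P a) + B * (ph b - ph a))
  = F b - F a by rewrite /F /cint; ring.
apply: (@rder_mvt _ F (fun t => (g t - (A + B * ph t)) * p t)) => // t tab.
  have t1 : -1 < t by move: tab => /andP[]; lra.
  apply: rder_eq (rderB (primP gc t1) (rderD (rderZ A (HP _ tab)) (rderZ B (Hph _ tab)))) _ _ => //.
  ring.
by rewrite cmodM ler_pM ?cmod_ge0 ?He ?HK.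
Qed.

(* The form [G (p ds + q dt)], where [Phi] plays the role of [z - w] and satisfies
   [d Phi = Phi (p ds + q dt)]. *)
Variables (G Phi : R -> R -> C) (p q P Q : R -> C) (S T K : R).
Hypotheses (S0 : 0 <= S) (T0 : 0 <= T) (K0 : 0 <= K).
Hypothesis Gp : forall t, rcont (fun s => G s t * p s).
Hypothesis Gq : forall s, rcont (fun t => G s t * q t).
Hypothesis HP : forall s, 0 <= s <= S -> rder P s (p s).
Hypothesis HQ : forall t, 0 <= t <= T -> rder Q t (q t).
Hypothesis Phip : forall s t, rder (Phi^~ t) s (Phi s t * p s).
Hypothesis Phiq : forall s t, rder (Phi s) t (Phi s t * q t).
Hypothesis pK : forall s, 0 <= s <= S -> cmod (p s) <= K.
Hypothesis qK : forall t, 0 <= t <= T -> cmod (q t) <= K.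
Hypothesis G_diff : forall s t e, 0 <= s <= S -> 0 <= t <= T -> 0 < e ->
  exists d (A B : C), 0 < d /\ forall s' t', 0 <= s' <= S -> 0 <= t' <= T ->
    `|s' - s| < d -> `|t' - t| < d ->
    cmod (G s' t' - (A + B * Phi s' t')) <= e * (`|s' - s| + `|t' - t|).

Let rect a b c d := cint (fun s => G s c * p s) a b + cint (fun t => G b t * q t) c d
  - cint (fun s => G s d * p s) a b - cint (fun t => G a t * q t) c d.

(** The explicit primitive of the part affine in [Phi] cancels around the boundary, which leaves the
    four edge errors. *)
Let rect_small a b c d (A B : C) e : 0 <= a <= b -> b <= S -> 0 <= c <= d -> d <= T ->
  (forall s t, a <= s <= b -> c <= t <= d -> cmod (G s t - (A + B * Phi s t)) <= e) ->
  cmod (rect a b c d) <= 4 * (e * K) * ((b - a) + (d - c)).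
Proof.
move=> /[dup] ab /andP[a0 a1] bS /[dup] cd /andP[c0 c1] dT H.
have inS s : a <= s <= b -> 0 <= s <= S by move=> /andP[? ?]; apply/andP; split; lra.
have inT t : c <= t <= d -> 0 <= t <= T by move=> /andP[? ?]; apply/andP; split; lra.
have hor t : c <= t <= d ->
  cmod (cint (fun s => G s t * p s) a b - (A * (P b - P a) + B * (Phi b t - Phi a t)))
    <= 2 * (e * K) * (b - a).
  move=> tcd; apply: (@goursat_edge (G^~ t) (Phi^~ t)) => // s sab.
  - exact/HP/inS.
  - exact/pK/inS.
  - exact: H.
have ver s : a <= s <= b ->
  cmod (cint (fun t => G s t * q t) c d - (A * (Q d - Q c) + B * (Phi s d - Phi s c)))
    <= 2 * (e * K) * (d - c).
  move=> sab; apply: (@goursat_edge (G s) (Phi s)) => // t tcd.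
  - exact/HQ/inT.
  - exact/qK/inT.
  - exact: H.
have H1 := hor c ltac:(by rewrite lexx).
have H2 := hor d ltac:(by rewrite lexx andbT).
have H3 := ver a ltac:(by rewrite lexx).
have H4 := ver b ltac:(by rewrite lexx andbT).
set h1 := (X in cmod X <= _) in H1; set h2 := (X in cmod X <= _) in H2.
set h3 := (X in cmod X <= _) in H3; set h4 := (X in cmod X <= _) in H4.
have -> : rect a b c d = (h1 + h4) - (h2 + h3).
  rewrite /rect /h1 /h2 /h3 /h4; ring.
have := cmodB (h1 + h4) (h2 + h3).
have := cmodD h1 h4; have := cmodD h2 h3; lra.
Qed.

Let rect_eq0 : rect 0 S 0 T = 0.
Proof.
apply/eqP; rewrite -cmod_eq0; apply/negP => /negP nz.
have eta0 : 0 < cmod (rect 0 S 0 T) by rewrite lt_def nz cmod_ge0.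
set eta := cmod _ in eta0.
(* One of the four quarters carries at least a quarter of the integral, while [rect_small] bounds it
   by [e] times the squared size: both sides scale by 1/4 at each stage, so a small [e] gives the
   contradiction. *)
pose Bad n x y := eta / 4 ^+ n <= cmod (rect x (x + S / 2 ^+ n) y (y + T / 2 ^+ n)).
have half (k : R) n : k / 2 ^+ n = 2 * (k / 2 ^+ n.+1).
  by rewrite exprS; field; rewrite expf_neq0.
have quart (k : R) n : k / 4 ^+ n = 4 * (k / 4 ^+ n.+1).
  by rewrite exprS; field; rewrite expf_neq0.
have [||||s [t stP]] := @bisection R Bad 0 0 S T; rewrite ?S0 ?T0 //.
- by rewrite /Bad !expr0 !divr1 !add0r.
- move=> n x y; rewrite /Bad (half S) (half T) (quart eta).
  set h := S / _; set k := T / _; set z := eta / _ => H.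
  pose r (i j : bool) := cmod (rect (x + i%:R * h) (x + i%:R * h + h) (y + j%:R * k) (y + j%:R * k + k)).
  have sum4 : 4 * z <= r false false + r false true + r true false + r true true.
    apply: le_trans H _.
    rewrite /r !mul0r !mul1r !addr0.
    have -> : x + 2 * h = x + h + h by ring.
    have -> : y + 2 * k = y + k + k by ring.
    have -> : rect x (x + h + h) y (y + k + k) =
      rect x (x + h) y (y + k) + rect x (x + h) (y + k) (y + k + k) +
      rect (x + h) (x + h + h) y (y + k) + rect (x + h) (x + h + h) (y + k) (y + k + k).
      rewrite /rect.
      rewrite !(@cint_chasles _ x (x + h) (x + h + h)) !(@cint_chasles _ y (y + k) (y + k + k)); ring.
    by do 3![apply: le_trans (cmodD _ _) _; apply: lerD => //].
  have [?|H1] := leP z (r false false); first by exists false, false.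
  have [?|H2] := leP z (r false true); first by exists false, true.
  have [?|H3] := leP z (r true false); first by exists true, false.
  exists true, true; rewrite -/(r true true); lra.
have [x0 [y0 [_ /andP[x0a x0b] /andP[x1a x1b] /andP[y0a y0b] /andP[y1a y1b]]]] := stP 0%N.
rewrite !expr0 !divr1 !add0r in x1a x1b y1a y1b.
have s0S : 0 <= s <= S by apply/andP; split; lra.
have t0T : 0 <= t <= T by apply/andP; split; lra.
(* Makes [4 * e * (K * (S + T) ^+ 2)] smaller than [eta]; the summand 1 covers the case where the
   product vanishes. *)
pose e := eta / (8 * (K * (S + T) ^+ 2 + 1)).
have KST : 0 <= K * (S + T) ^+ 2 by rewrite mulr_ge0 // sqr_ge0.
have e0 : 0 < e by rewrite divr_gt0 //; lra.
have [d [A [B [d0 dP]]]] := G_diff s0S t0T e0.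
have [n nP] := @expr_small R 2^-1 d (S + T) ltac:(apply/andP; lra) d0 ltac:(lra).
rewrite exprVn in nP.
have [x [y [bad /andP[x2a x2b] /andP[x3a x3b] /andP[y2a y2b] /andP[y3a y3b]]]] := stP n.
rewrite !add0r in x3b y3b.
have n0 : 0 < (2 ^+ n : R)^-1 by rewrite invr_gt0 exprn_gt0.
have n4 : (4 ^+ n : R)^-1 = (2 ^+ n)^-1 ^+ 2.
  by rewrite -exprVn -exprM mulnC exprM -!exprVn; congr (_ ^+ n); field.
rewrite /Bad n4 in bad; move: bad nP n0 x3a x3b y3a y3b.
set u := _^-1 => bad nP u0 x3a x3b y3a y3b.
have Su : 0 <= S * u by rewrite mulr_ge0 // ltW.
have Tu : 0 <= T * u by rewrite mulr_ge0 // ltW.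
have := @rect_small x (x + S * u) y (y + T * u) A B (e * ((S + T) * u)).
move=> /(_ ltac:(apply/andP; lra) ltac:(lra) ltac:(apply/andP; lra) ltac:(lra)) H.
have : eta * u ^+ 2 <= 4 * (e * ((S + T) * u) * K) * ((S + T) * u).
  apply: le_trans bad _; apply: le_trans (H _) _.
    move=> s' t' /andP[s'1 s'2] /andP[t'1 t'2].
    have hs : `|s' - s| <= S * u by rewrite ler_norml; apply/andP; lra.
    have ht : `|t' - t| <= T * u by rewrite ler_norml; apply/andP; lra.
    apply: le_trans (dP _ _ _ _ _ _) _; try (apply/andP); try lra.
    by rewrite ler_pM2l //; lra.
  by rewrite le_eqVlt; apply/orP; left; apply/eqP; ring.
have -> : 4 * (e * ((S + T) * u) * K) * ((S + T) * u) = 4 * e * (K * (S + T) ^+ 2) * u ^+ 2.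
  by ring.
rewrite ler_pM2r ?exprn_gt0 //.
have : e * (8 * (K * (S + T) ^+ 2 + 1)) = eta by rewrite /e divfK //; lra.
set kk := K * _ in KST *; nra.
Qed.

Lemma goursat :
  cint (fun s => G s 0 * p s) 0 S + cint (fun t => G S t * q t) 0 T =
  cint (fun s => G s T * p s) 0 S + cint (fun t => G 0 t * q t) 0 T.
Proof. by apply/eqP; rewrite -subr_eq0 opprD addrA; apply/eqP/rect_eq0. Qed.

End Goursat.

(** * Cauchy's formula and Taylor expansion *)

Section Circle.
Variable R : realType.
Local Notation C := (Cplx R).

Definition Ci : C := Complex 0 1.

Lemma cmod_Ci : cmod Ci = 1.
Proof. by rewrite /cmod /= expr0n add0r expr1n sqrtr1. Qed.

Definition circ (t : R) : C := Complex (cos t) (sin t).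

Lemma cmod_circ t : cmod (circ t) = 1.
Proof. by rewrite /cmod /= cos2Dsin2 sqrtr1. Qed.

Lemma circ_neq0 t : circ t != 0.
Proof. by rewrite -cmod_gt0 cmod_circ. Qed.

Lemma circ0 : circ 0 = 1.
Proof. by rewrite /circ cos0 sin0. Qed.

Lemma circD s t : circ (s + t) = circ s * circ t.
Proof.
rewrite /circ cosD sinD /GRing.mul /=; congr Complex.
by rewrite addrC mulrC [sin t * _]mulrC.
Qed.

Lemma circ2pi : circ (2 * pi) = 1.
Proof. by rewrite /circ mulr_natl cos2pi sin2pi. Qed.

Lemma rder_circ t : rder circ t (Ci * circ t).
Proof.
split; rewrite ?ReM ?ImM /= !mul0r !mul1r ?sub0r ?add0r.
  by rewrite (_ : _ \o _ = cos) //; exact: is_derive_cos.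
by rewrite (_ : _ \o _ = sin) //; exact: is_derive_sin.
Qed.

Lemma rcont_circ : rcont circ.
Proof. exact: rcont_rder rder_circ. Qed.

Lemma rder_ofR (g : R -> R) (x d : R) : is_derive x 1 g d -> rder (fun t => ofR (g t)) x (ofR d).
Proof.
move=> H; split; first by rewrite (_ : _ \o _ = g).
rewrite (_ : _ \o _ = cst 0) //; exact: is_derive_cst.
Qed.

Lemma rder_circV t : rder (fun t => (circ t)^-1) t (- Ci * (circ t)^-1).
Proof.
have E s : (circ s)^-1 = Complex (cos s) (- sin s).
  apply: (mulfI (circ_neq0 s)); rewrite mulfV ?circ_neq0 //.
  rewrite /circ /GRing.mul /=; apply/eqP; rewrite eq_complex /=.
  by apply/andP; split; apply/eqP; [rewrite mulrN opprK -!expr2 cos2Dsin2|ring].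
have -> : (fun t => (circ t)^-1) = (fun s => ofR (cos s) - Ci * ofR (sin s)).
  apply/funext => s; rewrite E; apply/eqP; rewrite eq_complex /=.
  by apply/andP; split; apply/eqP; ring.
rewrite E; apply: rder_eq (rderB (rder_ofR (is_derive_cos t)) (rderZ Ci (rder_ofR (is_derive_sin t)))) _ _ => //.
by apply/eqP; rewrite eq_complex /=; apply/andP; split; apply/eqP; ring.
Qed.

Lemma rder_lip (phi dphi : R -> C) (M a b : R) : 
  (forall t, a <= t <= b -> rder phi t (dphi t)) ->
  (forall t, a <= t <= b -> cmod (dphi t) <= M) ->
  forall s t, a <= s <= b -> a <= t <= b -> cmod (phi t - phi s) <= 2 * M * `|t - s|.
Proof.
move=> H HM.
have key s t : a <= s -> s <= t -> t <= b -> cmod (phi t - phi s) <= 2 * M * `|t - s|.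
  move=> a1 st tb; rewrite (ger0_norm (_ : 0 <= t - s)) ?subr_ge0 //.
  apply: (@rder_mvt _ phi dphi) => // u /andP[u1 u2].
    by apply: H; rewrite (le_trans a1 u1) (le_trans u2 tb).
  by apply: HM; rewrite (le_trans a1 u1) (le_trans u2 tb).
move=> s t /andP[s1 s2] /andP[t1 t2]; have [st|/ltW ts] := leP s t; first exact: key.
by rewrite cmodBC distrC; exact: key.
Qed.

Definition hol (f : C -> C) c (rho : R) :=
  forall z, cmod (z - c) < rho -> exists d, cderiv f z d.

Lemma cderiv_cont (f : C -> C) z d : cderiv f z d -> forall e, 0 < e ->
  exists2 s, 0 < s & forall w, cmod (w - z) < s -> cmod (f w - f z) <= e.
Proof.
move=> H e e0; have [s s0 sP] := H 1 ltr01.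
have d0 := cmod_ge0 d.
have k0 : 0 < 1 + cmod d by lra.
exists (Num.min s (e / (1 + cmod d))); first by rewrite lt_min s0 divr_gt0.
move=> w; rewrite lt_min => /andP[/sP ws]; rewrite ltr_pdivlMr // => we.
rewrite mul1r in ws.
have -> : f w - f z = (f w - f z - d * (w - z)) + d * (w - z) by ring.
apply: le_trans (cmodD _ _) _; rewrite cmodM.
by rewrite mulrDr mulr1 [X in _ + X]mulrC in we; lra.
Qed.

Lemma rcont_comp (f : C -> C) (phi : R -> C) : rcont phi ->
  (forall t, exists d, cderiv f (phi t) d) -> rcont (fun t => f (phi t)).
Proof.
move=> pc H x e e0; have [d /cderiv_cont /(_ e e0)[s s0 sP]] := H x.
have [s' s'0 s'P] := pc x (s / 2) ltac:(by rewrite divr_gt0).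
by exists s' => // y /s'P ys; apply: sP; lra.
Qed.

End Circle.

Section Cauchy.
Variable R : realType.
Local Notation C := (Cplx R).
Variables (f : C -> C) (rho r : R) (w : C).
Hypotheses (fhol : hol f 0 rho) (r0 : 0 < r) (rrho : r < rho) (wr : cmod w < r).

(* With [Phi s t = exp(-s^2) (r e^(it) - w)] the form [dz / (z - w)] pulls back to
   [p s ds + q t dt]: each coefficient depends on one variable only, so the part
   of [f] affine in [z - w] has an explicit primitive.  Letting [s] go to
   infinity contracts the circle to [w] while [s = 0] is the circle itself. *)
Let ta (s : R) : C := ofR (expR (- s ^+ 2)).
Let ga t : C := ofR r * circ t - w.
Let p (s : R) : C := ofR (- (2 * s)).
Let q t : C := Ci R * (ofR r * circ t) / ga t.
Let Phi s t := ta s * ga t.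

Let cmod_rcirc t : cmod (ofR r * circ t) = r.
Proof. by rewrite cmodM cmod_circ mulr1 cmod_ofR gtr0_norm. Qed.

Let ga_ge t : r - cmod w <= cmod (ga t).
Proof. by rewrite -{1}(cmod_rcirc t) cmod_sub. Qed.

Let ga_le t : cmod (ga t) <= 2 * r.
Proof. apply: le_trans (cmodB _ _) _; rewrite cmod_rcirc; have := wr; lra. Qed.

Let ga_neq0 t : ga t != 0.
Proof. by rewrite -cmod_gt0; apply: lt_le_trans (ga_ge t); rewrite subr_gt0. Qed.

Let rder_ga t : rder ga t (ga t * q t).
Proof.
apply: rder_eq (rderB (rderZ (ofR r) (rder_circ t)) (rder_cst w t)) _ _ => //.
rewrite /q subr0; field; exact: ga_neq0.
Qed.

Let rcont_ga : rcont ga. Proof. exact: rcont_rder rder_ga. Qed.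

Let rcont_q : rcont q.
Proof.
apply: rcontM; last exact: rcontV.
by do 2![apply: rcontM; first exact: rcont_cst]; exact: rcont_circ.
Qed.

Let is_derive_msqr (s : R) : is_derive s 1 (fun s : R => - s ^+ 2) (- (2 * s)).
Proof.
have -> : (fun s : R => - s ^+ 2) = - (id * id)%R.
  by apply/funext => t; rewrite expr2.
rewrite mulr_natl mulr2n.
have := is_deriveN (is_deriveM (is_derive_id s 1) (is_derive_id s 1)).
by rewrite /GRing.scale /= mulr1.
Qed.

Let rder_ta s : rder ta s (ta s * p s).
Proof.
rewrite /ta /p -ofRM; apply: rder_ofR.
exact: (is_derive1_comp (is_derive_expR _) (is_derive_msqr s)).
Qed.

Let ta01 (s : R) : 0 < expR (- s ^+ 2) <= (1 : R).
Proof. by rewrite expR_gt0 -expR0 ler_expR oppr_le0 sqr_ge0. Qed.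

Let cmod_ta s : cmod (ta s) = expR (- s ^+ 2).
Proof. by rewrite cmod_ofR gtr0_norm ?expR_gt0. Qed.

(** [w + Phi s t] lies on the segment from [w] to a point of the circle, since the contraction
    factor is in []0, 1]]. *)
Let inside s t : cmod (w + Phi s t - 0) < rho.
Proof.
apply: le_lt_trans rrho.
have -> : w + Phi s t - 0 = ofR (1 - expR (- s ^+ 2)) * w + ta s * (ofR r * circ t).
  rewrite ofRD ofRN ofR1 /Phi /ga -/(ta s); ring.
apply: le_trans (cmodD _ _) _; rewrite !cmodM cmod_circ cmod_ta !cmod_ofR.
have /andP[t0 t1] := ta01 s.
rewrite ger0_norm ?subr_ge0 // gtr0_norm // mulr1.
have := wr; move: (expR _) (cmod w) t0 t1 => u c; nra.
Qed.

Let rder_Phis s t : rder (Phi^~ t) s (Phi s t * p s).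
Proof.
apply: rder_eq (rderM (rder_ta s) (rder_cst (ga t) s)) _ _ => //.
rewrite /Phi; ring.
Qed.

Let rder_Phit s t : rder (Phi s) t (Phi s t * q t).
Proof. apply: rder_eq (rderZ (ta s) (rder_ga t)) _ _ => //; rewrite /Phi; ring. Qed.

Let G s t := f (w + Phi s t).

Let rcont_Gs t : rcont (G^~ t).
Proof.
apply: rcont_comp; last by move=> s; exact/fhol/inside.
apply: rcontD; first exact: rcont_cst.
exact: (rcont_rder (rder_Phis^~ t)).
Qed.

Let rcont_Gt s : rcont (G s).
Proof.
apply: rcont_comp; last by move=> t; exact/fhol/inside.
apply: rcontD; first exact: rcont_cst.
exact: (rcont_rder (rder_Phit s)).
Qed.

Let q_le t : cmod (q t) <= r / (r - cmod w).
Proof.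
rewrite /q !cmodM cmodV cmod_Ci cmod_circ cmod_ofR gtr0_norm // mul1r mulr1.
by rewrite ler_pM2l // lef_pV2 ?posrE ?cmod_gt0 ?subr_gt0 ?ga_ge ?ga_neq0.
Qed.

Let Phi_lip S s s' t t' : 0 <= S -> 0 <= s <= S -> 0 <= s' <= S ->
  cmod (Phi s' t' - Phi s t) <= (8 * S * r + 2 * r) * (`|s' - s| + `|t' - t|).
Proof.
move=> S0 sS s'S.
have -> : Phi s' t' - Phi s t = (ta s' - ta s) * ga t' + ta s * (ga t' - ga t).
  rewrite /Phi; ring.
have H1 : cmod (ta s' - ta s) <= 2 * (2 * S) * `|s' - s|.
  apply: (@rder_lip _ ta (fun s => ta s * p s) (2 * S) 0 S) => // u /andP[u0 uS].
  rewrite cmodM cmod_ta cmod_ofR normrN ger0_norm ?mulr_ge0 //.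
  have /andP[? ?] := ta01 u; by rewrite -[leRHS]mul1r; apply: ler_pM; rewrite ?expR_ge0 //; lra.
have H2 : cmod (ga t' - ga t) <= 2 * r * `|t' - t|.
  have [a [b [tab tab']]] : exists a b, a <= t <= b /\ a <= t' <= b.
    by exists (Num.min t t'), (Num.max t t'); rewrite !ge_min !le_max !lexx !orbT.
  apply: (@rder_lip _ ga (fun t => ga t * q t) r a b) => // u _.
  have -> : ga u * q u = Ci R * (ofR r * circ u) by rewrite /q; field; exact: ga_neq0.
  by rewrite cmodM cmod_rcirc cmod_Ci mul1r.
apply: le_trans (cmodD _ _) _; rewrite !cmodM cmod_ta.
have /andP[t0 t1] := ta01 s.
have A1 := ler_pM (cmod_ge0 _) (cmod_ge0 _) H1 (ga_le t').
have A2 : expR (- s ^+ 2) * cmod (ga t' - ga t) <= 2 * r * `|t' - t|.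
  by rewrite -[leRHS]mul1r; apply: ler_pM; rewrite ?cmod_ge0 // ltW.
have h3 : 0 <= S * r * `|t' - t| by rewrite !mulr_ge0 // ltW.
have h5 : 0 <= r * `|s' - s| by rewrite !mulr_ge0 // ltW.
apply: le_trans (lerD A1 A2) _.
move: `|s' - s| `|t' - t| h3 h5 => a b h3 h5.
have -> : (8 * S * r + 2 * r) * (a + b) = 2 * (2 * S) * a * (2 * r) + 2 * r * b + (8 * (S * r * b) + 2 * (r * a)) by ring.
by rewrite lerDl; lra.
Qed.

Let twopi_ge0 : 0 <= 2 * pi :> R.
Proof. by rewrite mulr_ge0 // pi_ge0. Qed.

(** The edges [t = 0] and [t = 2 * pi] carry the same integral because the circle closes, so they
    cancel in [goursat]. *)
Let cauchy_const S : 0 <= S ->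
  cint (fun t => G S t * q t) 0 (2 * pi) = cint (fun t => G 0 t * q t) 0 (2 * pi).
Proof.
move=> S0; have rw : 0 < r - cmod w by rewrite subr_gt0.
have Kq0 : 0 < r / (r - cmod w) by rewrite divr_gt0.
have := @goursat R G Phi p q (fun s => ofR (- s ^+ 2)) (prim q) S (2 * pi)
  (2 * S + r / (r - cmod w)) S0 twopi_ge0.
have -> : (fun s => G s (2 * pi) * p s) = fun s => G s 0 * p s.
  by apply/funext => s; rewrite /G /Phi /ga circ2pi circ0.
move=> H; apply: (addrI (cint (fun s => G s 0 * p s) 0 S)); apply: H.
  - by rewrite addr_ge0 ?(ltW Kq0) // mulr_ge0.
  - move=> t; apply: rcontM; first exact: rcont_Gs.
    have -> : p = fun s => ofR (-2) * ofR s.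
      by apply/funext => s; rewrite /p -ofRM mulNr.
    apply: rcontM; first exact: rcont_cst.
    by apply: rcont_rder => x; apply: rder_ofR; exact: is_derive_id.
  - by move=> s; apply: rcontM; [exact: rcont_Gt|exact: rcont_q].
  - by move=> s _; apply: rder_ofR; exact: is_derive_msqr.
  - move=> t /andP[t0 _]; apply: primP; first exact: rcont_q.
    by apply: lt_le_trans t0; rewrite ltrN10.
  - exact: rder_Phis.
  - exact: rder_Phit.
  - move=> s /andP[s0 sS]; rewrite /p cmod_ofR normrN ger0_norm ?mulr_ge0 //; lra.
  - move=> t _; apply: le_trans (q_le t) _; by rewrite lerDr mulr_ge0.
  - move=> s t e sS _ e0.
    have [d fd] := fhol (inside s t).
    pose L := 8 * S * r + 2 * r.
    have L0 : 0 < L.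
      by apply: ltr_wpDl; [rewrite !mulr_ge0 // ltW|rewrite mulr_gt0].
    have [x x0 xP] := fd (e / L) (divr_gt0 e0 L0).
    exists (x / (2 * L)), (f (w + Phi s t) - d * Phi s t), d; split.
      by rewrite divr_gt0 // mulr_gt0.
    move=> s' t' s'S _ hs ht.
    have lip := Phi_lip t t' S0 sS s'S; rewrite -/L in lip.
    have -> : G s' t' - (f (w + Phi s t) - d * Phi s t + d * Phi s' t') =
      f (w + Phi s' t') - f (w + Phi s t) - d * (w + Phi s' t' - (w + Phi s t)).
      rewrite /G; ring.
    have E : w + Phi s' t' - (w + Phi s t) = Phi s' t' - Phi s t by ring.
    apply: le_trans (xP _ _) _; rewrite E.
      apply: le_lt_trans lip _.
      rewrite mulrC -ltr_pdivlMr //; have -> : x / L = x / (2 * L) + x / (2 * L).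
        by field; rewrite gt_eqF.
      exact: ltrD.
    rewrite mulrAC ler_pdivrMr // -mulrA ler_pM2l // mulrC; exact: lip.
Qed.

(** Far along the contraction the integrand is uniformly close to [f w] times the kernel. The
    integral of the kernel is left as it stands; [cint_kernel] evaluates it. *)
Lemma cauchy_formula :
  cint (fun t => f (ofR r * circ t) *
     (Ci R * (ofR r * circ t) / (ofR r * circ t - w))) 0 (2 * pi) =
  f w * cint (fun t => Ci R * (ofR r * circ t) / (ofR r * circ t - w)) 0 (2 * pi).
Proof.
have J0 : (fun t => f (ofR r * circ t) * q t) = fun t => G 0 t * q t.
  apply/funext => t; congr (f _ * _).
  rewrite /Phi /ta expr0n oppr0 expR0 ofR1 /ga; ring.
rewrite -[X in cint X _ _]/(fun t => f (ofR r * circ t) * q t) J0 -/q.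
apply/eqP; rewrite -subr_eq0 -cmod_eq0; apply/negP => /negP nz.
set D := (X in cmod X) in nz.
have D0 : 0 < cmod D by rewrite lt_def nz cmod_ge0.
have rw : 0 < r - cmod w by rewrite subr_gt0.
pose K := r / (r - cmod w).
have K0 : 0 < K by rewrite divr_gt0.
have pi0 : 0 < pi :> R := pi_gt0 R.
(* With this [e] the bound [2 * (e * K) * (2 * pi)] equals half of [cmod D]. *)
pose e := cmod D / (8 * K * pi).
have e0 : 0 < e.
  rewrite /e; apply: divr_gt0; first exact: D0.
  by apply: mulr_gt0 pi0; apply: mulr_gt0 K0; rewrite ltr0n.
have wrho : cmod (w - 0) < rho by rewrite subr0 (lt_trans wr).
have [d /cderiv_cont /(_ e e0)[x x0 xP]] := fhol wrho.
(* [expR (S ^+ 2) >= 1 + S ^+ 2 > 2 * r / x], where the summand 1 ensures [S <= S ^+ 2]. *)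
pose S := 2 * r / x + 1.
have rx : 0 < 2 * r / x by apply: divr_gt0 x0; rewrite mulr_gt0.
have S1 : 1 <= S by rewrite /S lerDr ltW.
have S0 : 0 <= S by apply: le_trans S1.
have expS : expR (- S ^+ 2) * (2 * r) < x.
  rewrite expRN mulrC ltr_pdivrMr ?expR_gt0 // -ltr_pdivrMl // [_ * _]mulrC.
  apply: lt_le_trans (expR_ge1Dx _).
  have : S <= S ^+ 2 by rewrite expr2 ler_peMl.
  by rewrite /S; lra.
have small t : cmod (G S t - f w) <= e.
  apply: xP; rewrite addrAC subrr add0r; apply: le_lt_trans expS.
  by rewrite /Phi cmodM cmod_ta ler_pM2l ?expR_gt0.
have pi02 : (0 : R) <= 0 <= 2 * (pi : R) by apply/andP; split; [exact: lexx|exact: twopi_ge0].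
have cd : rcont (fun t => (G S t - f w) * q t).
  by apply: rcontM (rcont_q); apply: rcontD; [exact: rcont_Gt|exact: rcont_cst].
have DE : D = cint (fun t => (G S t - f w) * q t) 0 (2 * pi).
  have -> : (fun t => (G S t - f w) * q t) = fun t => G S t * q t + (- f w) * q t.
    by apply/funext => t; ring.
  rewrite cintD ?cintZ //; try exact: rcont_q.
  - by rewrite cauchy_const // /D mulNr.
  - by apply: rcontM (rcont_q); exact: rcont_Gt.
  - by apply: rcontM (rcont_q); exact: rcont_cst.
have : cmod D <= 2 * (e * K) * (2 * pi - 0).
  rewrite DE; apply: cint_bound => // t _.
  by rewrite cmodM; apply: ler_pM; rewrite ?cmod_ge0 ?small ?q_le.
have key (a k u : R) : 0 < k -> 0 < u -> 2 * (a / (8 * k * u) * k) * (2 * u - 0) = a / 2.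
  by move=> k0 u0; field; rewrite !gt_eqF.
rewrite key //; move: D0; lra.
Qed.

End Cauchy.

(** * Taylor coefficients and remainder from the Cauchy kernel *)

Section Taylor.
Variable R : realType.
Local Notation C := (Cplx R).
Implicit Types (f : C -> C) (w : C).

Definition kernel (r : R) w (t : R) : C :=
  Ci R * (ofR r * circ t) / (ofR r * circ t - w).

(** [2 pi i] times the [k]-th Taylor coefficient; the exponent is [k] and not [k + 1] because
    [dz = i z dt] on the circle. *)
Definition coeff f (r : R) k : C :=
  cint (fun t => f (ofR r * circ t) * (Ci R * (ofR r * circ t)^-1 ^+ k)) 0 (2 * pi).

Lemma twopi_seg : 0 <= (0 : R) <= 2 * (pi : R).
Proof. by rewrite lexx mulr_ge0 // pi_ge0. Qed.

Lemma cmod_rcirc (r t : R) : 0 < r -> cmod (ofR r * circ t) = r.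
Proof. by move=> r0; rewrite cmodM cmod_circ mulr1 cmod_ofR gtr0_norm. Qed.

Lemma rcirc_neq0 (r t : R) : 0 < r -> ofR r * circ t != 0 :> C.
Proof. by move=> r0; rewrite -cmod_gt0 cmod_rcirc. Qed.

Lemma rcont_rcirc (r : R) : rcont (fun t => ofR r * circ t : C).
Proof. by apply: rcontM (@rcont_circ R); exact: rcont_cst. Qed.

Lemma rcontX (phi : R -> C) n : rcont phi -> rcont (fun t => phi t ^+ n).
Proof.
move=> H; elim: n => [|n IH].
  under [X in rcont X]funext do rewrite expr0.
  exact: rcont_cst.
under [X in rcont X]funext do rewrite exprS.
exact: rcontM.
Qed.

Lemma kernel_neq0 (r : R) w t : cmod w < r -> ofR r * circ t - w != 0.
Proof.
move=> wr; have r0 : 0 < r by exact: le_lt_trans (cmod_ge0 w) wr.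
rewrite -cmod_gt0; apply: lt_le_trans (cmod_sub _ _).
by rewrite cmod_rcirc // subr_gt0.
Qed.

Lemma rcont_kernel (r : R) w : cmod w < r -> rcont (kernel r w).
Proof.
move=> wr; apply: rcontM.
  by apply: rcontM (rcont_rcirc r); exact: rcont_cst.
apply: rcontV => [|t]; last exact: kernel_neq0.
by apply: rcontD (rcont_rcirc r) _; exact: rcont_cst.
Qed.

Lemma kernel_le (r : R) w t : cmod w < r -> cmod (kernel r w t) <= r / (r - cmod w).
Proof.
move=> wr; have r0 : 0 < r by exact: le_lt_trans (cmod_ge0 w) wr.
rewrite /kernel cmodM cmodV cmodM cmod_Ci mul1r cmod_rcirc // ler_pM2l //.
rewrite lef_pV2 ?posrE ?cmod_gt0 ?subr_gt0 ?kernel_neq0 //.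
by apply: le_trans (cmod_sub _ _); rewrite cmod_rcirc.
Qed.

(** Finite geometric series with exact remainder, so that only finite sums are exchanged with the
    integral. *)
Lemma kernel_expand (r : R) w t n : cmod w < r ->
  kernel r w t = \sum_(k < n) w ^+ k * (Ci R * (ofR r * circ t)^-1 ^+ k)
    + w ^+ n * ((ofR r * circ t)^-1 ^+ n * kernel r w t).
Proof.
move=> wr; have r0 : 0 < r by exact: le_lt_trans (cmod_ge0 w) wr.
elim: n => [|n IH]; first by rewrite big_ord0 !expr0 !mul1r add0r.
rewrite {1}IH big_ord_recr /= -addrA; congr (_ + _).
rewrite /kernel !exprS.
have z0 := rcirc_neq0 t r0; have z1 := kernel_neq0 t wr.
move: (ofR r * circ t) z0 z1 => z z0 z1; move: (z^-1 ^+ n) (w ^+ n) => a b.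
by field; rewrite z0 z1.
Qed.

Lemma cint_kernel_expand f (r : R) w n (M : R) : cmod w < r ->
  rcont (fun t => f (ofR r * circ t)) ->
  (forall t, 0 <= t <= 2 * pi -> cmod (f (ofR r * circ t)) <= M) ->
  cmod (cint (fun t => f (ofR r * circ t) * kernel r w t) 0 (2 * pi)
    - \sum_(k < n) coeff f r k * w ^+ k)
  <= 4 * pi * M * (r / (r - cmod w)) * (cmod w / r) ^+ n.
Proof.
move=> wr fc fM; have r0 : 0 < r by exact: le_lt_trans (cmod_ge0 w) wr.
have zVc : rcont (fun t => (ofR r * circ t : C)^-1).
  by apply: rcontV (rcont_rcirc r) _ => t; exact: rcirc_neq0.
have kc := rcont_kernel wr.
pose a k t := w ^+ k * (f (ofR r * circ t) * (Ci R * (ofR r * circ t)^-1 ^+ k)).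
pose b t := f (ofR r * circ t) * ((ofR r * circ t)^-1 ^+ n * kernel r w t).
have cc k : rcont (fun t => f (ofR r * circ t) * (Ci R * (ofR r * circ t)^-1 ^+ k)).
  apply: rcontM fc _; apply: rcontM; [exact: rcont_cst|exact: rcontX].
have ac k : rcont (a k) by apply: rcontM (cc k); exact: rcont_cst.
have bc : rcont b by apply: rcontM fc _; apply: rcontM kc; exact: rcontX.
have -> : (fun t => f (ofR r * circ t) * kernel r w t) =
  fun t => \sum_(k < n) a k t + w ^+ n * b t.
  apply/funext => t; rewrite (kernel_expand t n wr) mulrDr mulr_sumr; congr (_ + _).
    by apply: eq_bigr => k _; rewrite /a; ring.
  by rewrite /b; ring.
have [sc Es] := cint_sum n twopi_seg ac.
rewrite cintD ?twopi_seg //; last by apply: rcontM bc; exact: rcont_cst.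
rewrite Es cintZ ?twopi_seg //.
have -> : \sum_(k < n) cint (a k) 0 (2 * pi) = \sum_(k < n) coeff f r k * w ^+ k.
  by apply: eq_bigr => k _; rewrite /a cintZ ?twopi_seg // mulrC.
rewrite addrAC subrr add0r cmodM cmodX.
have M0 : 0 <= M by apply: le_trans (fM 0 twopi_seg); exact: cmod_ge0.
have rw : 0 < r - cmod w by rewrite subr_gt0.
have bM : cmod (cint b 0 (2 * pi)) <= 2 * (M * (r^-1 ^+ n * (r / (r - cmod w)))) * (2 * pi - 0).
  apply: cint_bound; [exact: twopi_seg|exact: bc|] => t tpi.
  rewrite /b cmodM; apply: ler_pM; rewrite ?cmod_ge0 ?fM //.
  rewrite cmodM cmodX cmodV cmod_rcirc //.
  by apply: ler_wpM2l; [rewrite exprn_ge0 ?invr_ge0 ?ltW|exact: kernel_le].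
apply: le_trans (ler_wpM2l (exprn_ge0 n (cmod_ge0 w)) bM) _.
by rewrite le_eqVlt; apply/orP; left; apply/eqP; rewrite expr_div_n exprVn; ring.
Qed.

(** For positive [k] the integrand has a primitive proportional to [(circ t)^-1 ^+ k], which takes
    equal values at both ends. *)
Lemma coeff_cst (r : R) k : 0 < r -> coeff (fun=> 1) r k = if k == 0%N then Ci R * ofR (2 * pi) else 0.
Proof.
move=> r0; rewrite /coeff.
have zVc : rcont (fun t => (ofR r * circ t : C)^-1).
  by apply: rcontV (rcont_rcirc r) _ => t; exact: rcirc_neq0.
have cc j : rcont (fun t => 1 * (Ci R * (ofR r * circ t)^-1 ^+ j)).
  by apply: rcontM (rcont_cst _) _; apply: rcontM; [exact: rcont_cst|exact: rcontX].
case: k => [|k] /=.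
  rewrite (@cint_eq _ _ (fun t => Ci R * ofR t)) ?twopi_seg //.
    by rewrite ofR0 mulr0 subr0.
  move=> t _; apply: rder_eq (rderZ (Ci R) (rder_ofR (is_derive_id t 1))) _ _ => //.
  by rewrite expr0 ofR1 !mulr1 mul1r.
pose P t : C := - (ofR r)^-1 ^+ k.+1 / k.+1%:R * (circ t)^-1 ^+ k.+1.
rewrite (@cint_eq _ _ P) ?twopi_seg //.
  by rewrite /P circ0 circ2pi subrr.
move=> t _.
apply: rder_eq (rderZ (- (ofR r)^-1 ^+ k.+1 / k.+1%:R) (rderX k (rder_circV t))) _ _ => //.
rewrite invfM exprMn; move: ((ofR r)^-1 ^+ k.+1) => a.
rewrite [(circ t)^-1 ^+ k.+1]exprS; move: ((circ t)^-1 ^+ k) => b.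
have : k.+1%:R != 0 :> C by rewrite pnatr_eq0.
move: (k.+1%:R) (circ t)^-1 => m u m0; field; exact: m0.
Qed.

(** Neither logarithm nor winding number enters: in the expansion for the constant function 1 only
    the term of index 0 survives, and the remainder tends to 0. *)
Lemma cint_kernel (r : R) w : cmod w < r -> cint (kernel r w) 0 (2 * pi) = Ci R * ofR (2 * pi).
Proof.
move=> wr; have r0 : 0 < r by exact: le_lt_trans (cmod_ge0 w) wr.
apply/eqP; rewrite -subr_eq0 -cmod_eq0; apply/negP => /negP nz.
set D := cmod _ in nz; have D0 : 0 < D by rewrite lt_def nz cmod_ge0.
have rw : 0 < r - cmod w by rewrite subr_gt0.
have [||n nP] := @expr_small R (cmod w / r) D (4 * pi * 1 * (r / (r - cmod w))) _ D0.
- by rewrite divr_ge0 ?cmod_ge0 ?(ltW r0) //= ltr_pdivrMr // mul1r.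
- by rewrite mulr1 !mulr_ge0 ?pi_ge0 ?invr_ge0 // ltW.
have := @cint_kernel_expand (fun=> 1) r w n.+1 1 wr (rcont_cst _).
rewrite cmod1 => /(_ (fun _ _ => lexx _)).
rewrite big_ord_recl expr0 mulr1 coeff_cst //= big1 => [|k _]; last first.
  by rewrite coeff_cst //= mul0r.
rewrite addr0; under [X in cint X]funext do rewrite mul1r.
rewrite -/D leNgt => /negP; apply; apply: le_lt_trans nP.
rewrite exprS mulrCA -[leRHS]mul1r; apply: ler_wpM2r.
  by rewrite mulr1 !mulr_ge0 ?exprn_ge0 ?divr_ge0 ?cmod_ge0 ?pi_ge0 ?invr_ge0 // ltW.
by rewrite ler_pdivrMr // mul1r ltW.
Qed.

(* The bound is uniform in the truncation order [n], which is all that the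
   applications need: no infinite series occurs. *)
Lemma taylor f rho r M : hol f 0 rho -> 0 < r -> r < rho ->
  (forall t, 0 <= t <= 2 * pi -> cmod (f (ofR r * circ t)) <= M) ->
  exists a : nat -> C, (forall k, cmod (a k) <= 2 * M / r ^+ k) /\
    forall n w, cmod w <= r / 2 ->
      cmod (f w - \sum_(k < n) a k * w ^+ k) <= 4 * M * (cmod w / r) ^+ n.
Proof.
move=> fh r0 rrho fM.
have fc : rcont (fun t => f (ofR r * circ t)).
  apply: rcont_comp (rcont_rcirc r) _ => t; apply: fh.
  by rewrite subr0 cmod_rcirc.
have M0 : 0 <= M by apply: le_trans (fM 0 twopi_seg); exact: cmod_ge0.
pose W : C := Ci R * ofR (2 * pi).
have pi0 : 0 < (pi : R) by exact: pi_gt0.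
have cW : cmod W = 2 * pi by rewrite cmodM cmod_Ci cmod_ofR mul1r gtr0_norm ?mulr_gt0.
have W0 : W != 0 by rewrite -cmod_gt0 cW mulr_gt0.
exists (fun k => coeff f r k / W); split.
  move=> k; rewrite cmodM cmodV cW ler_pdivrMr ?mulr_gt0 //.
  apply: le_trans (@cint_bound _ _ (M * r^-1 ^+ k) _ _ twopi_seg _ _) _.
  - apply: rcontM fc _; apply: rcontM; [exact: rcont_cst|apply: rcontX].
    by apply: rcontV (rcont_rcirc r) _ => t; exact: rcirc_neq0.
  - move=> t tpi; rewrite cmodM; apply: ler_pM; rewrite ?cmod_ge0 ?fM //.
    by rewrite cmodM cmod_Ci mul1r cmodX cmodV cmod_rcirc.
  - by rewrite le_eqVlt; apply/orP; left; apply/eqP; rewrite exprVn; ring.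
move=> n w wr2; have wr : cmod w < r by lra.
have := cint_kernel_expand n wr fc fM.
rewrite /kernel (cauchy_formula fh r0 rrho wr) -/(kernel r w) cint_kernel // -/W.
move=> H.
have -> : f w - \sum_(k < n) coeff f r k / W * w ^+ k =
   (f w * W - \sum_(k < n) coeff f r k * w ^+ k) / W.
  rewrite mulrBl mulfK // mulr_suml; congr (_ - _).
  by apply: eq_bigr => k _; ring.
rewrite cmodM cmodV cW ler_pdivrMr ?mulr_gt0 //.
apply: le_trans H _.
have -> : 4 * M * (cmod w / r) ^+ n * (2 * pi) = 4 * pi * M * 2 * (cmod w / r) ^+ n by ring.
apply: ler_wpM2r; first by rewrite exprn_ge0 // divr_ge0 ?cmod_ge0 // ltW.
apply: ler_wpM2l; first by rewrite !mulr_ge0 // ltW.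
by rewrite ler_pdivrMr; lra.
Qed.

End Taylor.

(** * Local theory of holomorphic functions *)

Section CderivRules.
Variable R : realType.
Local Notation C := (Cplx R).
Implicit Types (f g : C -> C) (z w d e c : C).

Lemma cderiv_is_derive f z d : cderiv f z d <-> is_derive z 1 f d.
Proof.
split=> [H|[H1 H2]].
  split; first by apply/derivable1_diffP; exact: cderiv_differentiable H.
  by rewrite -derive1E; exact: cderiv_derive1.
apply/cderiv_cvg; rewrite -H2; exact: H1.
Qed.

Lemma cderiv_uniq f z d e : cderiv f z d -> cderiv f z e -> d = e.
Proof. by move=> /cderiv_derive1 <- /cderiv_derive1. Qed.

Lemma cderiv_cst c z : cderiv (fun=> c) z 0.
Proof. by apply/cderiv_is_derive; exact: is_derive_cst. Qed.

Lemma cderiv_id z : cderiv id z 1.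
Proof. by apply/cderiv_is_derive; exact: is_derive_id. Qed.

Lemma cderivD f g z d e : cderiv f z d -> cderiv g z e ->
  cderiv (fun w => f w + g w) z (d + e).
Proof.
by move=> /cderiv_is_derive H1 /cderiv_is_derive H2; apply/cderiv_is_derive; exact: is_deriveD.
Qed.

Lemma cderivM f g z d e : cderiv f z d -> cderiv g z e ->
  cderiv (fun w => f w * g w) z (f z * e + g z * d).
Proof.
by move=> /cderiv_is_derive H1 /cderiv_is_derive H2; apply/cderiv_is_derive; exact: is_deriveM.
Qed.

Lemma cderivZ c f z d : cderiv f z d -> cderiv (fun w => c * f w) z (c * d).
Proof. by move=> H; have := cderivM (cderiv_cst c z) H; rewrite mulr0 addr0. Qed.

Lemma cderivB f g z d e : cderiv f z d -> cderiv g z e ->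
  cderiv (fun w => f w - g w) z (d - e).
Proof.
move=> H1 H2; have := cderivD H1 (cderivZ (-1) H2).
by under [X in cderiv X]funext do rewrite mulN1r; rewrite mulN1r.
Qed.

Lemma cderiv_comp f g z d e : cderiv f z d -> cderiv g (f z) e ->
  cderiv (fun w => g (f w)) z (e * d).
Proof.
move=> /[dup] /cderiv_cont fc fd gd eps eps0.
have e0 := cmod_ge0 e; have d0 := cmod_ge0 d.
pose k := 1 + cmod d + cmod e.
have k0 : 0 < k by rewrite /k; lra.
pose eta := Num.min 1 (eps / k).
have eta0 : 0 < eta by rewrite lt_min ltr01 divr_gt0.
have eta1 : eta <= 1 by rewrite ge_min lexx.
have etak : eta * k <= eps by rewrite -ler_pdivlMr // ge_min lexx orbT.
have [s1 s10 H1] := fd eta eta0; have [s2 s20 H2] := gd eta eta0.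
have [s3 s30 H3] := fc (s2 / 2) ltac:(by rewrite divr_gt0).
exists (Num.min s1 s3); first by rewrite lt_min s10.
move=> w; rewrite lt_min => /andP[/H1 w1 /H3 w3].
have w2 : cmod (f w - f z) < s2 by lra.
have {}w2 := H2 _ w2.
have fw : cmod (f w - f z) <= (eta + cmod d) * cmod (w - z).
  have -> : f w - f z = (f w - f z - d * (w - z)) + d * (w - z) by ring.
  by apply: le_trans (cmodD _ _) _; rewrite cmodM mulrDl lerD2r.
have -> : g (f w) - g (f z) - e * d * (w - z) =
  (g (f w) - g (f z) - e * (f w - f z)) + e * (f w - f z - d * (w - z)) by ring.
apply: le_trans (cmodD _ _) _; rewrite cmodM.
have x0 := cmod_ge0 (w - z).
have A : eta * cmod (f w - f z) <= eta * ((1 + cmod d) * cmod (w - z)).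
  apply: ler_wpM2l; first exact: ltW.
  by apply: le_trans fw _; apply: ler_wpM2r; rewrite // lerD2r.
have B : cmod e * cmod (f w - f z - d * (w - z)) <= cmod e * (eta * cmod (w - z)).
  exact: ler_wpM2l.
apply: le_trans (lerD (le_trans w2 A) B) _.
have -> : eta * ((1 + cmod d) * cmod (w - z)) + cmod e * (eta * cmod (w - z)) =
   (eta * k) * cmod (w - z) by rewrite /k; ring.
exact: ler_wpM2r.
Qed.

Lemma cderiv_inv z : z != 0 -> cderiv (fun w => w^-1) z (- z^-1 ^+ 2).
Proof.
move=> z0 e e0.
have m0 : 0 < cmod z by rewrite cmod_gt0.
exists (Num.min (cmod z / 2) (e * cmod z ^+ 3 / 2)).
  by rewrite lt_min !(divr_gt0, mulr_gt0, exprn_gt0).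
move=> w; rewrite lt_min => /andP[w1 w2].
have wz : cmod z / 2 <= cmod w.
  have := cmod_sub z w; rewrite cmodBC; lra.
have w0 : w != 0 by rewrite -cmod_gt0; lra.
have -> : w^-1 - z^-1 - - z^-1 ^+ 2 * (w - z) = (w - z) * ((w - z) * (w^-1 * z^-1 ^+ 2)).
  by field; rewrite w0 z0.
rewrite cmodM mulrC; apply: ler_wpM2r; first exact: cmod_ge0.
rewrite !cmodM !cmodV -!invfM ler_pdivrMr ?mulr_gt0 ?cmod_gt0 //.
apply: le_trans (ltW w2) _.
have -> : e * cmod z ^+ 3 / 2 = e * (cmod z / 2 * (cmod z * cmod z)).
  by rewrite !exprS; ring.
by rewrite ler_pM2l // ler_pM2r // mulr_gt0.
Qed.

Lemma cderivV f z d : f z != 0 -> cderiv f z d ->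
  cderiv (fun w => (f w)^-1) z (- (f z)^-1 ^+ 2 * d).
Proof. by move=> fz0 fd; exact: cderiv_comp fd (cderiv_inv fz0). Qed.

Lemma cderiv_shift f c z d : cderiv f (c + z) d -> cderiv (fun w => f (c + w)) z d.
Proof.
move=> H e /H[s s0 sP]; exists s => // w.
by have := sP (c + w); have -> : c + w - (c + z) = w - z by ring.
Qed.

Lemma hol_shift f c z r s : hol f c r -> cmod (z - c) + s <= r ->
  hol (fun w => f (z + w)) 0 s.
Proof.
move=> H zs w; rewrite subr0 => ws.
have [|d /cderiv_shift fd] := H (z + w); last by exists d.
rewrite addrAC; apply: le_lt_trans (cmodD _ _) _; lra.
Qed.

Lemma hol_sub f c r c' r' : cmod (c' - c) + r' <= r -> hol f c r -> hol f c' r'.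
Proof.
move=> cr H z zc; apply: H.
by have := cmod_tri z c c'; lra.
Qed.

End CderivRules.

Section LocalTheory.
Variable R : realType.
Local Notation C := (Cplx R).
Implicit Types (f g : C -> C) (z w c : C) (r rho s M : R).

Lemma rcont_bounded (phi : R -> C) (a b : R) : a <= b -> rcont phi ->
  exists M, forall t, a <= t <= b -> cmod (phi t) <= M.
Proof.
move=> ab pc.
have cc : continuous (fun t => cmod (phi t)).
  move=> t; apply/cvgrPdist_le => e /(pc t)[s s0 sP].
  near=> u.
  have /sP : `|u - t| < s.
    by near: u; apply/nbhs_ballP; exists s => //= u; rewrite /ball /= distrC.
  have := cmod_sub (phi t) (phi u); have := cmod_sub (phi u) (phi t).
  rewrite [cmod (phi t - _)]cmodBC ler_norml => ? ? ?; apply/andP; lra.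
have cw : {within `[a, b], continuous (fun t => cmod (phi t))}.
  by apply: continuous_subspaceT => ?; exact: cc.
have [c _ cP] := EVT_max ab cw.
by exists (cmod (phi c)) => t tab; apply: cP; rewrite in_itv.
Unshelve. all: by end_near. Qed.

Lemma taylor_ball f c rho : 0 < rho -> hol f c rho ->
  exists (a : nat -> C) M, 0 <= M /\ forall n w, cmod w <= rho / 4 ->
    cmod (f (c + w) - \sum_(k < n) a k * w ^+ k) <= M * (cmod w / (rho / 2)) ^+ n.
Proof.
move=> rho0 fh.
have r0 : 0 < rho / 2 by rewrite divr_gt0.
have fh0 : hol (fun w => f (c + w)) 0 rho.
  by apply: hol_shift fh _; rewrite subrr cmod0 add0r.
have [M MP] : exists M, forall t, 0 <= t <= 2 * pi ->
    cmod (f (c + ofR (rho / 2) * circ t)) <= M.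
  apply: rcont_bounded; first by case/andP: (twopi_seg R).
  apply: (rcont_comp (f := fun w => f (c + w)) (rcont_rcirc (rho / 2))) => t; apply: fh0.
  by rewrite subr0 cmod_rcirc //; lra.
have rr : rho / 2 < rho by lra.
have [a [_ aP]] := taylor fh0 r0 rr MP.
exists a, (4 * M); split.
  by rewrite mulr_ge0 //; apply: le_trans (MP 0 (twopi_seg R)); exact: cmod_ge0.
by move=> n w wr; apply: aP; lra.
Qed.

(** If all coefficients vanish, the remainder bound decays like a power of 1/2, because [rho / 4] is
    half the radius of the circle; otherwise the first non-zero coefficient leads. *)
Lemma order_or_zero f c rho : 0 < rho -> hol f c rho ->
  (forall w, cmod w <= rho / 4 -> f (c + w) = 0) \/
  exists k (a : C) M, [/\ a != 0, 0 <= M & forall w, cmod w <= rho / 4 ->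
    cmod (f (c + w) - a * w ^+ k) <= M * cmod w ^+ k.+1].
Proof.
move=> rho0 /(taylor_ball rho0)[a [M [M0 aP]]].
have r0 : 0 < rho / 2 by rewrite divr_gt0.
have [a0|] := pselect (forall k, a k = 0).
  left=> w wr; apply/eqP; rewrite -cmod_eq0; apply/negP => /negP nz.
  have fw0 : 0 < cmod (f (c + w)) by rewrite lt_def nz cmod_ge0.
  have [n nP] := @expr_small R 2^-1 _ M ltac:(apply/andP; lra) fw0 M0.
  have := aP n w wr; rewrite big1 ?subr0 => [|k _]; last by rewrite a0 mul0r.
  rewrite leNgt => /negP; apply; apply: le_lt_trans nP.
  apply: ler_wpM2l => //; apply: lerXn2r; rewrite ?nnegrE.
  - by rewrite divr_ge0 ?cmod_ge0 // ltW.
  - by rewrite invr_ge0.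
  - by rewrite ler_pdivrMr //; lra.
move=> /existsNP/cid[k0 /eqP ak0]; right.
have exk : exists k, a k != 0 by exists k0.
have [k ak kmin] := ex_minnP exk.
exists k, (a k), (M / (rho / 2) ^+ k.+1); split => //.
  by rewrite divr_ge0 // exprn_ge0 // ltW.
move=> w wr; have := aP k.+1 w wr.
rewrite big_ord_recr big1 /= => [|j _]; last first.
  have [->|/kmin] := eqVneq (a j) 0; first by rewrite mul0r.
  by rewrite leqNgt ltn_ord.
by rewrite add0r expr_div_n mulrA mulrAC.
Qed.

Lemma local_identity f c rho s : 0 < rho -> hol f c rho -> 0 < s ->
  (forall z, cmod (z - c) < s -> f z = 0) ->
  forall z, cmod (z - c) <= rho / 4 -> f z = 0.
Proof.
move=> rho0 fh s0 fs z zc.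
have [H|[k [a [M [a0 M0 H]]]]] := order_or_zero rho0 fh.
  by have := H (z - c) zc; rewrite addrC subrK.
exfalso.
have am : 0 < cmod a by rewrite cmod_gt0.
(* At this real displacement [M * x < cmod a], so the leading term exceeds the remainder at a point
   where [f] vanishes. *)
pose x := Num.min (Num.min (rho / 4) (s / 2)) (cmod a / (2 * (M + 1))).
have x0 : 0 < x by rewrite !lt_min !divr_gt0 ?mulr_gt0 //; lra.
have x1 : x <= rho / 4 by rewrite !ge_min lexx.
have x2 : x <= s / 2 by rewrite !ge_min lexx orbT.
have x3 : x <= cmod a / (2 * (M + 1)) by rewrite !ge_min lexx !orbT.
have cx : cmod (ofR x : C) = x by rewrite cmod_ofR gtr0_norm.
have := H (ofR x); rewrite cx => /(_ x1).
rewrite fs ?sub0r ?cmodN; last by rewrite addrAC subrr add0r cx; lra.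
rewrite cmodM cmodX cx exprS mulrA ler_pM2r ?exprn_gt0 //.
move: x3; rewrite ler_pdivlMr; [nra|lra].
Qed.

(** A weak maximum principle; its factor 2, inherited from [rder_mvt], is absorbed by the choice of
    [s2] in [local_inverse]. *)
Lemma cmod_le_circle f rho r M : hol f 0 rho -> 0 < r -> r < rho ->
  (forall z, cmod z = r -> cmod (f z) <= M) -> cmod (f 0) <= 2 * M.
Proof.
move=> fh r0 rrho fM.
have [t _|a [aM aP]] := @taylor R f rho r M fh r0 rrho; first by rewrite fM // cmod_rcirc.
have := aP 1%N 0; rewrite cmod0 => /(_ ltac:(rewrite divr_ge0 // ltW //)).
rewrite big_ord1 expr0 mulr1 mul0r expr1 mulr0 => H.
have -> : f 0 = a 0%N.
  by apply/eqP; rewrite -subr_eq0 -cmod_eq0 eq_le H cmod_ge0.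
by have := aM 0%N; rewrite expr0 divr1.
Qed.

(** The quadratic remainder depends on [f] through [M] alone; this uniformity drives the Lipschitz
    estimate and the passage to limits of holomorphic sequences. *)
Lemma cauchy_estimates f c rho M : 0 < rho -> hol f c rho ->
  (forall z, cmod (z - c) < rho -> cmod (f z) <= M) ->
  exists2 d, cderiv f c d & cmod d <= 4 * M / rho /\
    forall w, cmod w <= rho / 4 ->
      cmod (f (c + w) - f c - d * w) <= 16 * M / rho ^+ 2 * cmod w ^+ 2.
Proof.
move=> rho0 fh fM.
have r0 : 0 < rho / 2 by rewrite divr_gt0.
have M0 : 0 <= M by apply: le_trans (fM c _); rewrite ?cmod_ge0 // subrr cmod0.
have fh0 : hol (fun w => f (c + w)) 0 rho.
  by apply: hol_shift fh _; rewrite subrr cmod0 add0r.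
have [||a [aM aP]] := @taylor R _ rho (rho / 2) M fh0 r0; first by lra.
  move=> t _; apply: fM; rewrite addrAC subrr add0r cmod_rcirc //; lra.
have fc : f c = a 0%N.
  have := aP 1%N 0; rewrite cmod0 => /(_ ltac:(rewrite divr_ge0 // ltW //)).
  rewrite big_ord1 expr0 mulr1 mul0r expr1 mulr0 addr0 => H.
  by apply/eqP; rewrite -subr_eq0 -cmod_eq0 eq_le H cmod_ge0.
have second w : cmod w <= rho / 4 ->
      cmod (f (c + w) - f c - a 1%N * w) <= 16 * M / rho ^+ 2 * cmod w ^+ 2.
  move=> wr; have := aP 2%N w ltac:(lra).
  rewrite big_ord_recr big_ord1 /= expr0 mulr1 expr1 -fc opprD addrA => H.
  apply: le_trans H _; rewrite le_eqVlt; apply/orP; left; apply/eqP.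
  by field; rewrite gt_eqF.
exists (a 1%N); last first.
  split => //; apply: le_trans (aM 1%N) _.
  by rewrite expr1 le_eqVlt; apply/orP; left; apply/eqP; field; rewrite gt_eqF.
move=> e e0.
pose K := 16 * M / rho ^+ 2.
have K0 : 0 <= K.
  by rewrite /K divr_ge0 // ?exprn_ge0 ?(ltW rho0) // mulr_ge0 ?ler0n.
exists (Num.min (rho / 4) (e / (K + 1))).
  by rewrite lt_min !divr_gt0 //; lra.
move=> w; rewrite lt_min => /andP[/ltW w1]; rewrite ltr_pdivlMr; last by lra.
move=> w2; have := second _ w1; have -> : c + (w - c) = w by ring.
move=> H.
apply: le_trans H _; rewrite -/K expr2 mulrA; apply: ler_wpM2r; first exact: cmod_ge0.
by have := cmod_ge0 (w - c); nra.
Qed.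

End LocalTheory.

(** * Lipschitz estimates and the local inverse theorem *)

Section LocalInverse.
Variable R : realType.
Local Notation C := (Cplx R).
Implicit Types (f g h : C -> C) (z w x y : C) (r rho s M : R).

(** Within distance [s / 4] the second-order estimate at [y] applies; further apart the trivial
    bound [2 * M] suffices. *)
Lemma hol_lipschitz f s M : 0 < s -> hol f 0 (2 * s) ->
  (forall z, cmod z < 2 * s -> cmod (f z) <= M) ->
  forall x y, cmod x < s -> cmod y < s -> cmod (f x - f y) <= 8 * M / s * cmod (x - y).
Proof.
move=> s0 fh fM x y xs ys.
have M0 : 0 <= M by apply: le_trans (fM 0 _); rewrite ?cmod_ge0 // cmod0 mulr_gt0.
have yh : hol f y s by apply: hol_sub fh; rewrite subr0; lra.
have yM z : cmod (z - y) < s -> cmod (f z) <= M.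
  by move=> zy; apply: fM; have := cmod_tri z 0 y; rewrite !subr0; lra.
have [d _ [dM dP]] := cauchy_estimates s0 yh yM.
have [near|far] := leP (cmod (x - y)) (s / 4).
  have := dP (x - y) near; have -> : y + (x - y) = x by ring.
  move=> H; have -> : f x - f y = (f x - f y - d * (x - y)) + d * (x - y) by ring.
  apply: le_trans (cmodD _ _) _; rewrite cmodM.
  have A : cmod d * cmod (x - y) <= 4 * M / s * cmod (x - y).
    by apply: ler_wpM2r; rewrite ?cmod_ge0.
  apply: le_trans (lerD H A) _.
  have -> : 8 * M / s * cmod (x - y) = 4 * M / s * cmod (x - y) + 4 * M / s * cmod (x - y) by ring.
  rewrite lerD2r expr2 mulrA; apply: ler_wpM2r; first exact: cmod_ge0.
  have -> : 4 * M / s = 16 * M / s ^+ 2 * (s / 4) by field; rewrite gt_eqF.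
  apply: ler_wpM2l near.
  by apply: divr_ge0; [apply: mulr_ge0; rewrite ?ler0n|exact: sqr_ge0].
apply: le_trans (cmodB _ _) _.
have fx : cmod (f x) <= M by apply: fM; lra.
have fy : cmod (f y) <= M by apply: fM; lra.
rewrite mulrAC ler_pdivlMr //; nra.
Qed.

(* [g - l z] is [o(|z|)], and Cauchy's estimate on discs of comparable radius
   turns this into a small Lipschitz constant. *)
Lemma strict_derivative g rho (l : C) e : 0 < rho -> hol g 0 rho -> g 0 = 0 ->
  cderiv g 0 l -> 0 < e -> exists s, [/\ 0 < s, s <= rho &
   forall x y, cmod x < s -> cmod y < s -> cmod (g x - g y - l * (x - y)) <= e * cmod (x - y)].
Proof.
move=> rho0 gh g0 gl e0.
(* [hol_lipschitz] costs a factor [8 / t], and [g z - l * z] is at most [e / 16 * (2 * t)] on the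
   disc of radius [2 * t]: the product is [e]. *)
have [s s0 sP] := gl (e / 16) ltac:(by rewrite divr_gt0).
pose t := Num.min s rho / 2.
have m0 : 0 < Num.min s rho by rewrite lt_min s0.
have t0 : 0 < t by rewrite divr_gt0.
have ms : Num.min s rho <= s by rewrite ge_min lexx.
have mr : Num.min s rho <= rho by rewrite ge_min lexx orbT.
pose phi z := g z - l * z.
have ph : hol phi 0 (2 * t).
  move=> z zt; have [|d gd] := gh z; first by move: zt; rewrite /t; lra.
  by exists (d - l * 1); apply: cderivB gd (cderivZ l (cderiv_id z)).
exists t; split => //; first by rewrite /t; lra.
move=> x y xt yt.
have := @hol_lipschitz phi t (e / 16 * (2 * t)) t0 ph _ x y xt yt.
have -> : phi x - phi y = g x - g y - l * (x - y) by rewrite /phi; ring.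
have -> : 8 * (e / 16 * (2 * t)) / t = e by field; rewrite gt_eqF.
apply=> z zt.
have := sP z; rewrite g0 !subr0 => H.
apply: le_trans (H _) _; first by move: zt; rewrite /t; lra.
by apply: ler_wpM2l; rewrite ?divr_ge0 ?(ltW e0) // ltW.
Qed.

(** Near 0 the map stretches distances by at least [cmod l / 2]. This yields injectivity, the
    Lipschitz bound for [h] and a lower bound for the derivative of [g], hence differentiability of
    [h] at every point of its disc. *)
Lemma local_inverse g rho (l : C) : 0 < rho -> hol g 0 rho -> g 0 = 0 ->
  cderiv g 0 l -> l != 0 -> exists h s s2,
  [/\ 0 < s, s <= rho & 0 < s2] /\
  [/\ forall x y, cmod x < s -> cmod y < s -> cmod l / 2 * cmod (x - y) <= cmod (g x - g y),
      hol h 0 s2, h 0 = 0, cderiv h 0 l^-1 &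
      (forall w, cmod w < s2 -> cmod (h w) < s /\ g (h w) = w) /\
      (forall z, cmod z < s -> cmod (g z) < s2 -> h (g z) = z)].
Proof.
move=> rho0 gh g0 gl l0.
have l0' : 0 < cmod l by rewrite cmod_gt0.
have l20 : 0 < cmod l / 2 by rewrite divr_gt0.
have [s [s0 srho sP]] := strict_derivative rho0 gh g0 gl l20.
have low x y : cmod x < s -> cmod y < s -> cmod l / 2 * cmod (x - y) <= cmod (g x - g y).
  move=> xs ys; have := sP x y xs ys; have := cmod_sub (l * (x - y)) (g x - g y).
  rewrite (cmodBC (l * (x - y))) cmodM; have := cmod_ge0 (x - y); lra.
have inj x y : cmod x < s -> cmod y < s -> g x = g y -> x = y.
  move=> xs ys gxy; apply/eqP; rewrite -subr_eq0 -cmod_eq0 eq_le cmod_ge0 andbT.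
  by have := low x y xs ys; rewrite gxy subrr cmod0 pmulr_rle0.
(* An omitted value [w] would satisfy [cmod l * s / 4 - cmod w <= 2 * cmod w], by [cmod_le_circle]
   on the circle of radius [s / 2]; hence the 12. *)
pose s2 := cmod l * s / 12.
have s20 : 0 < s2 by rewrite divr_gt0 ?mulr_gt0 // ltr0n.
have surj w : cmod w < s2 -> exists z, cmod z < s /\ g z = w.
  move=> ws; apply: contrapT => /forallNP nz.
  have {}nz z : cmod z < s -> g z - w != 0.
    by move=> zs; rewrite subr_eq0; apply/eqP => gz; apply: (nz z).
  (* Otherwise [1 / (g - w)] is holomorphic, but larger at [0] than on a circle. *)
  have ih : hol (fun z => (g z - w)^-1) 0 s.
    move=> z; rewrite subr0 => zs.
    have [|d gd] := gh z; first by rewrite subr0; lra.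
    by have := @cderivV R (fun z => g z - w) z _ (nz z zs) (cderivB gd (cderiv_cst w z)); exists (- (g z - w)^-1 ^+ 2 * (d - 0)).
  have h2 : 0 < s / 2 by rewrite divr_gt0.
  have k0 : 0 < cmod l * s / 4 - cmod w by move: ws; rewrite /s2; have := mulr_gt0 l0' s0; lra.
  have w0 : 0 < cmod w.
    by have := nz 0; rewrite g0 sub0r oppr_eq0 cmod0 cmod_gt0; apply.
  have hs : s / 2 < s by lra.
  have H := @cmod_le_circle R _ s (s / 2) (cmod l * s / 4 - cmod w)^-1 ih h2 hs.
  rewrite g0 sub0r invrN cmodN cmodV in H.
  have {}H : (cmod w)^-1 <= 2 * (cmod l * s / 4 - cmod w)^-1.
    apply: H => z zs; rewrite cmodV lef_pV2 ?posrE ?cmod_gt0 ?nz //; last by rewrite zs; lra.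
    have := low z 0; rewrite g0 !subr0 cmod0 zs => /(_ ltac:(lra) s0).
    have := cmod_sub (g z) w; lra.
  move: H; rewrite -[leLHS]mul1r ler_pdivrMr // mulrAC ler_pdivlMr // mul1r.
  by move: ws; rewrite /s2; lra.
have exh w : exists z, cmod w < s2 -> cmod z < s /\ g z = w.
  have [/surj[z zP]|] := pselect (cmod w < s2); last by exists 0.
  by exists z.
pose h w := sval (cid (exh w)).
have hP w : cmod w < s2 -> cmod (h w) < s /\ g (h w) = w by rewrite /h; case: cid.
have hg z : cmod z < s -> cmod (g z) < s2 -> h (g z) = z.
  by move=> zs /hP[hs ghz]; apply: inj.
have h0 : h 0 = 0 by rewrite -[in LHS]g0 hg ?g0 ?cmod0.
have hlip w v : cmod w < s2 -> cmod v < s2 -> cmod (h w - h v) <= 2 / cmod l * cmod (w - v).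
  move=> /hP[hw gw] /hP[hv gv]; have := low _ _ hw hv; rewrite gw gv => H.
  rewrite mulrAC ler_pdivlMr //; lra.
have hd w d : cmod w < s2 -> cderiv g (h w) d -> cderiv h w d^-1.
  move=> ws gd; have [hws ghw] := hP w ws.
  have d0 : cmod l / 2 <= cmod d.
    rewrite leNgt; apply/negP => dl.
    (* A derivative below [cmod l / 2] would contradict the stretching along the small real
       displacement [u]. *)
    pose e := (cmod l / 2 - cmod d) / 2.
    have e0 : 0 < e by rewrite divr_gt0 // subr_gt0.
    have [t t0 tP] := gd e e0.
    pose u := Num.min (t / 2) ((s - cmod (h w)) / 2).
    have u0 : 0 < u by rewrite lt_min !divr_gt0 // subr_gt0.
    have u1 : u <= t / 2 by rewrite ge_min lexx.
    have u2 : u <= (s - cmod (h w)) / 2 by rewrite ge_min lexx orbT.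
    have cu : cmod (ofR u : C) = u by rewrite cmod_ofR gtr0_norm.
    have E : h w + ofR u - h w = ofR u by ring.
    have hu : cmod (h w + ofR u) < s by have := cmodD (h w) (ofR u); rewrite cu; lra.
    have := tP (h w + ofR u); rewrite E cu => /(_ ltac:(lra)) H1.
    have := low _ _ hu hws; rewrite E cu => H2.
    have := cmod_sub (g (h w + ofR u) - g (h w)) (d * ofR u); rewrite cmodM cu => H3.
    have : 0 < e * u by rewrite mulr_gt0.
    by move: H1 H2 H3; rewrite /e; lra.
  have d0' : 0 < cmod d by lra.
  have dn0 : d != 0 by rewrite -cmod_gt0.
  move=> e e0.
  pose e' := e * (cmod d * cmod l / 2).
  have e'0 : 0 < e' by rewrite mulr_gt0 // divr_gt0 // mulr_gt0.
  have [t t0 tP] := gd e' e'0.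
  exists (Num.min (s2 - cmod w) (t * (cmod l / 2))).
    by rewrite lt_min subr_gt0 ws mulr_gt0.
  move=> v; rewrite lt_min => /andP[v1 v2].
  have vs : cmod v < s2 by have := cmod_sub v w; lra.
  have [hvs ghv] := hP v vs.
  have lip := hlip v w vs ws.
  have hvw : cmod (h v - h w) < t.
    apply: le_lt_trans lip _; rewrite mulrAC ltr_pdivrMr //; lra.
  have := tP _ hvw; rewrite ghv ghw => H.
  have -> : h v - h w - d^-1 * (v - w) = - d^-1 * (v - w - d * (h v - h w)) by field.
  rewrite cmodM cmodN cmodV mulrC ler_pdivrMr //.
  apply: le_trans H _; apply: le_trans (ler_wpM2l (ltW e'0) lip) _.
  rewrite le_eqVlt; apply/orP; left; apply/eqP; rewrite /e'; field; by rewrite gt_eqF.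
exists h, s, s2; do 2!split => //.
  move=> w; rewrite subr0 => ws; have [hws _] := hP w ws.
  have [|d gd] := gh (h w); first by rewrite subr0; lra.
  by exists d^-1; exact: hd.
by apply: hd; rewrite ?cmod0 // h0.
Qed.

End LocalInverse.

(** * Germs and their action on families of compacta *)

Section Germs.
Variable R : realType.
Local Notation C := (Cplx R).
Implicit Types (f g h : C -> C) (z w l m : C) (r s e : R) (K L : set C).

Definition is_germ g l := l != 0 /\
  exists r, [/\ 0 < r, hol g 0 r, g 0 = 0 & cderiv g 0 l].

Lemma in_Diff0P g : in_Diff0 g <-> is_germ g (derive1 g 0).
Proof.
split=> [[r [/pos_ofR[s s0 ->] [gh [g0 gd]]]]|[l0 [r [r0 gh g0 gd]]]].
  split=> //; exists s; split => //.
    by move=> z zs; exists (derive1 g z); apply/differentiable_cderiv/gh/ball_cmod.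
  by apply/differentiable_cderiv/gh/ball_cmod; rewrite subrr cmod0.
exists (ofR r); split; first by rewrite ofR_gt0.
by split=> // z /ball_cmod /gh[d /cderiv_differentiable].
Qed.

Lemma is_germ_derive1 g l : is_germ g l -> derive1 g 0 = l.
Proof. by move=> [_ [r [_ _ _ /cderiv_derive1]]]. Qed.

Lemma is_germ_Diff0 g l : is_germ g l -> in_Diff0 g.
Proof. by move=> H; apply/in_Diff0P; rewrite (is_germ_derive1 H). Qed.

Lemma is_germ_cont g l e : is_germ g l -> 0 < e ->
  exists2 s, 0 < s & forall z, cmod z < s -> cmod (g z) < e.
Proof.
move=> [_ [r [_ _ g0 /cderiv_cont H]]] e0.
have [s s0 sP] := H (e / 2) ltac:(by rewrite divr_gt0).
by exists s => // z zs; have := sP z; rewrite g0 !subr0 => /(_ zs); lra.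
Qed.

Lemma is_germ_id : is_germ id 1.
Proof.
split; first exact: oner_neq0.
exists 1; split => //; last exact: cderiv_id.
by move=> z _; exists 1; exact: cderiv_id.
Qed.

Lemma is_germ_comp f g l m : is_germ f l -> is_germ g m -> is_germ (f \o g) (l * m).
Proof.
move=> [l0 [r [r0 fh f0 fd]]] /[dup] /is_germ_cont gc [m0 [s [s0 gh g0 gd]]].
split; first by rewrite mulf_neq0.
have [t t0 tP] := gc r r0.
exists (Num.min s t); split; first by rewrite lt_min s0.
- move=> z; rewrite subr0 lt_min => /andP[zs /tP zt].
  have [|d zd] := gh z; first by rewrite subr0.
  have [|e gzd] := fh (g z); first by rewrite subr0.
  by exists (e * d); exact: (cderiv_comp zd gzd).
- by rewrite /= g0.
- by apply: (cderiv_comp gd); rewrite g0.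
Qed.

Lemma germ_eq_sym f g : germ_eq f g -> germ_eq g f.
Proof. by rewrite /germ_eq; apply: filterS => z ->. Qed.

Lemma germ_eq_trans f g h : germ_eq f g -> germ_eq g h -> germ_eq f h.
Proof. by rewrite /germ_eq; apply: filterS2 => z -> ->. Qed.

Lemma germ_eq_comp f f' g g' l : is_germ g l -> germ_eq f f' -> germ_eq g g' ->
  germ_eq (f \o g) (f' \o g').
Proof.
move=> /is_germ_cont gc /nbhs_cmod[r r0 ff] /nbhs_cmod[s s0 gg].
have [t t0 tP] := gc r r0.
apply/nbhs_cmod; exists (Num.min s t); first by rewrite lt_min s0.
move=> z; rewrite lt_min => /andP[zs]; rewrite subr0 => /tP zt.
by rewrite /= -gg // ff // subr0.
Qed.

Lemma germ_eq_refl f : germ_eq f f.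
Proof. by apply/nbhs_cmod; exists 1. Qed.

Lemma is_germ_inv g l : is_germ g l -> exists h,
  [/\ is_germ h l^-1, germ_eq (h \o g) id & germ_eq (g \o h) id].
Proof.
move=> /[dup] /is_germ_cont gc [l0 [r [r0 gh g0 gd]]].
have [h [s [s2 [[s0 sr s20] [_ hh h0 hd [H1 H2]]]]]] := local_inverse r0 gh g0 gd l0.
exists h; split.
- by split; [rewrite invr_eq0|exists s2].
- have [t t0 tP] := gc s2 s20.
  apply/nbhs_cmod; exists (Num.min s t); first by rewrite lt_min s0.
  by move=> z; rewrite subr0 lt_min => /andP[zs zt] /=; apply: H2; rewrite // tP.
- by apply/nbhs_cmod; exists s2 => // w; rewrite subr0 => /H1[].
Qed.

(** Discs about 0 replace diameters: for compacta containing 0 the two notions of smallness agree up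
    to a factor 4. *)
Definition inD K r := forall z, K z -> cmod z < r.

Lemma diam_ltP K r : 0 < r -> K 0 -> inD K (r / 4) -> diam_lt K (ofR r).
Proof.
move=> r0 K0 Kr; exists (ofR (r / 2)); split; first by rewrite ofR_lt; lra.
move=> x y /Kr xr /Kr yr; rewrite norm_cmod ofR_le.
by have := cmodB x y; lra.
Qed.

Lemma diam_lt_inD K r : K 0 -> diam_lt K (ofR r) -> inD K r.
Proof.
move=> K0 [d [dr dP]] z Kz; rewrite -ofR_lt; apply: le_lt_trans dr.
by have := dP z 0 Kz K0; rewrite subr0 norm_cmod.
Qed.

Lemma germ_equiv_small (K1 K2 : set (set C)) : germ_equiv K1 K2 ->
  exists2 e, 0 < e & forall K, compact K -> K 0 -> inD K e -> (K1 K <-> K2 K).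
Proof.
move=> [_ [/pos_ofR[e e0 ->] H]]; exists (e / 4); first by rewrite divr_gt0.
by move=> K Kc K0 Ke; apply: H => //; exact: diam_ltP.
Qed.

Lemma small_germ_equiv (K1 K2 : set (set C)) e : 0 < e ->
  (forall K, K1 K -> K 0) -> (forall K, K2 K -> K 0) ->
  (forall K, compact K -> K 0 -> inD K e -> (K1 K <-> K2 K)) -> germ_equiv K1 K2.
Proof.
move=> e0 H1 H2 H; exists (ofR e); split; first by rewrite ofR_gt0.
move=> K Kc Kd; split=> HK.
  by have K0 := H1 _ HK; apply/H => //; exact: diam_lt_inD Kd.
by have K0 := H2 _ HK; apply/H => //; exact: diam_lt_inD Kd.
Qed.

Lemma hol_compact g r K : hol g 0 r -> compact K -> inD K r -> compact (g @` K).
Proof.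
move=> gh Kc Kr; apply: continuous_compact => //.
apply: continuous_in_subspaceT => z; rewrite inE => /Kr zr.
have [|d gd] := gh z; first by rewrite subr0.
exact: differentiable_continuous (cderiv_differentiable gd).
Qed.

(* The germ-level form of [g([KK]) = [KK]], free of the radius chosen in
   [fixes_germ]. *)
Definition preserves (KK : set (set C)) g := exists2 e, 0 < e &
  forall K, compact K -> K 0 -> inD K e -> (KK K <-> KK (g @` K)).

Section Family.
Variable KK : set (set C).
Hypothesis KKsmall : small_family KK.

Lemma KK_compact K : KK K -> compact K.
Proof. by move=> HK; have [/(_ K HK)[]] := KKsmall. Qed.

Lemma KK0 K : KK K -> K 0.
Proof. by move=> HK; have [/(_ K HK)[]] := KKsmall. Qed.

Lemma is_germ_image g l e : is_germ g l -> 0 < e -> exists2 s, 0 < s &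
  forall K, compact K -> K 0 -> inD K s -> [/\ compact (g @` K), (g @` K) 0 & inD (g @` K) e].
Proof.
move=> /[dup] /is_germ_cont gc [_ [r [r0 gh g0 _]]] /gc[s s0 sP].
exists (Num.min r s); first by rewrite lt_min r0.
move=> K Kc K0 Krs; split.
- by apply: hol_compact gh Kc _ => z /Krs; rewrite lt_min => /andP[].
- by exists 0.
- by move=> _ [z /Krs zK <-]; apply: sP; move: zK; rewrite lt_min => /andP[].
Qed.

Lemma image_near f g : germ_eq f g -> exists2 s, 0 < s &
  forall K, inD K s -> f @` K = g @` K.
Proof.
move=> /nbhs_cmod[s s0 sP]; exists s => // K Ks.
by apply/seteqP; split=> _ [z /[dup] Kz /Ks zs <-]; exists z => //; rewrite sP ?subr0.
Qed.

Lemma preserves_comp f g l m : is_germ f l -> is_germ g m ->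
  preserves KK f -> preserves KK g -> preserves KK (f \o g).
Proof.
move=> fg gg [e e0 eP] [d d0 dP].
have [s s0 sP] := is_germ_image gg e0.
exists (Num.min s d); first by rewrite lt_min s0.
move=> K Kc K0 Ksd.
have [] := sP K Kc K0; first by move=> z /Ksd; rewrite lt_min => /andP[].
move=> gKc gK0 gKe; rewrite -image_comp.
apply: iff_trans (eP _ gKc gK0 gKe); apply: dP => //.
by move=> z /Ksd; rewrite lt_min => /andP[].
Qed.

(** Applied to the image of [K] under [h], the equivalence for [g] compares that image with [K]
    itself. *)
Lemma preserves_inv g h l m : is_germ g l -> is_germ h m ->
  germ_eq (g \o h) id -> preserves KK g -> preserves KK h.
Proof.
move=> gg hg /image_near[t t0 gh] [e e0 eP].
have [s s0 sP] := is_germ_image hg e0.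
exists (Num.min s t); first by rewrite lt_min s0.
move=> K Kc K0 Kst.
have [] := sP K Kc K0; first by move=> z /Kst; rewrite lt_min => /andP[].
move=> hKc hK0 hKe; apply: iff_sym; apply: iff_trans (eP _ hKc hK0 hKe) _.
rewrite image_comp gh ?image_id //.
by move=> z /Kst; rewrite lt_min => /andP[].
Qed.

(** Membership in the image family only provides some [K'] in [KK] with the same image as [K];
    univalence on the disc identifies the two. *)
Lemma Aut_preserves g : Aut KK g -> preserves KK g.
Proof.
move=> [/in_Diff0P gg [_ [/pos_ofR[r r0 ->] gh ginj /germ_equiv_small[e e0 eP]]]].
have [s s0 sP] := is_germ_image gg e0.
exists (Num.min r s); first by rewrite lt_min r0.
move=> K Kc K0 Krs.
have Kr z : K z -> ball (0 : C) (ofR r) z.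
  by move=> /Krs; rewrite lt_min => /andP[zr _]; apply/ball_cmod; rewrite subr0.
have [] := sP K Kc K0; first by move=> z /Krs; rewrite lt_min => /andP[].
move=> gKc gK0 gKe; have H := eP _ gKc gK0 gKe; split=> HK.
  by apply/H; exists K; split.
have /H[K' [HK' K'r gKK']] := HK.
suff -> : K = K' by [].
apply/seteqP; split=> z Kz.
  have : (g @` K) (g z) by exists z.
  rewrite gKK' => -[z' K'z'] /ginj <- //; [exact: K'r|exact: Kr].
have : (g @` K') (g z) by exists z.
rewrite -gKK' => -[z' Kz'] /ginj <- //; [exact: Kr|exact: K'r].
Qed.

(** A small member [L] is exhibited as an image by pulling it back with the local inverse [h]. *)
Lemma preserves_Aut g l : is_germ g l -> preserves KK g -> Aut KK g.
Proof.
move=> gg [e e0 eP]; split; first exact: is_germ_Diff0 gg.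
have [l0 [rho [rho0 gh g0 gd]]] := gg.
have [h [s [s2 [[s0 sr s20] [low hh h0 hd [H1 H2]]]]]] := local_inverse rho0 gh g0 gd l0.
pose r := Num.min s e.
have r0 : 0 < r by rewrite lt_min s0.
have rs z : cmod z < r -> cmod z < s by rewrite lt_min => /andP[].
have re z : cmod z < r -> cmod z < e by rewrite lt_min => /andP[].
exists (ofR r); split; first by rewrite ofR_gt0.
- move=> z /ball_cmod zr; have [|d] := gh z; last exact: cderiv_differentiable.
  by apply: lt_le_trans sr; rewrite subr0; apply: rs; rewrite -(subr0 z).
- move=> x y /ball_cmod; rewrite subr0 => /rs xs /ball_cmod; rewrite subr0 => /rs ys gxy.
  apply/eqP; rewrite -subr_eq0 -cmod_eq0 eq_le cmod_ge0 andbT.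
  have := low x y xs ys; rewrite gxy subrr cmod0 pmulr_rle0 //.
  by rewrite divr_gt0 // cmod_gt0.
have hg : is_germ h l^-1 by split; [rewrite invr_eq0|exists s2].
have [t t0 tP] := is_germ_image hg r0.
apply: (@small_germ_equiv _ _ (Num.min s2 t)).
- by rewrite lt_min s20.
- by move=> _ [K [/KK0 K0 _ ->]]; exists 0.
- exact: KK0.
move=> L Lc L0 Lst; split.
  move=> [K [HK Kr ->]]; apply/(eP K) => //; [exact: KK_compact HK|exact: KK0 HK|].
  by move=> z /Kr /ball_cmod; rewrite subr0; exact: re.
move=> HL; have [] := tP L Lc L0; first by move=> z /Lst; rewrite lt_min => /andP[].
move=> hLc hL0 hLr.
have E : g @` (h @` L) = L.
  have gh' z : L z -> g (h z) = z.
    by move=> /Lst; rewrite lt_min => /andP[/H1[]].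
  apply/seteqP; split; first by move=> _ [_ [z Lz <-] <-]; rewrite gh'.
  by move=> z Lz; exists (h z); [exists z|rewrite gh'].
exists (h @` L); split => //.
- by apply/eP; rewrite ?E // => z /hLr; exact: re.
- by move=> z /hLr zr; apply/ball_cmod; rewrite subr0.
Qed.

End Family.
End Germs.

(** * Small Siegel compacta are nearly round *)

Section IrrationalRotation.
Variable R : realType.
Local Notation C := (Cplx R).
Implicit Types (a b t delta : R).

Lemma expi_circ t : expi t = circ (2 * pi * t).
Proof. by []. Qed.

Lemma expiD a b : expi (a + b) = expi a * expi b :> C.
Proof. by rewrite !expi_circ mulrDr circD. Qed.

Lemma cmod_expi t : cmod (expi t) = 1.
Proof. exact: cmod_circ. Qed.

Lemma expi_nat a n : expi (a *+ n) = expi a ^+ n :> C.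
Proof.
elim: n => [|n IH]; first by rewrite mulr0n expr0 expi_circ mulr0 circ0.
by rewrite mulrS expiD IH exprS.
Qed.

Lemma expi1 : expi 1 = 1 :> C.
Proof. by rewrite expi_circ mulr1 circ2pi. Qed.

Lemma expi_int (k : int) : expi k%:~R = 1 :> C.
Proof.
have H n : expi n%:R = 1 :> C by rewrite -[n%:R]/(1 *+ n) expi_nat expi1 expr1n.
case: k => n; first exact: H.
rewrite NegzE mulrNz; apply: (mulIf (_ : expi n.+1%:R != 0 :> C)).
  by rewrite H oner_neq0.
by rewrite -expiD addNr mul1r H expi_circ mulr0 circ0.
Qed.

Lemma unit_expi (u : C) : cmod u = 1 -> exists t, u = expi t.
Proof.
case: u => x y; rewrite /cmod /= => /(congr1 (fun z => z ^+ 2)).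
rewrite expr1n sqr_sqrtr ?addr_ge0 ?sqr_ge0 // => xy.
have x1 : -1 <= x <= 1.
  rewrite -ler_norml -(@ler_pXn2r _ 2) ?nnegrE // expr1n -normrX ger0_norm ?sqr_ge0 //.
  by rewrite -xy lerDl sqr_ge0.
have pi0 : 0 < (pi : R) := pi_gt0 R.
have sx : sin (acos x) = `|y|.
  rewrite sin_acos // -xy addrAC subrr add0r; exact: sqrtr_sqr.
have [y0|y0] := leP 0 y.
  exists (acos x / (2 * pi)); rewrite expi_circ /circ mulrC divfK ?mulf_neq0 ?gt_eqF //.
  by rewrite acosK ?in_itv // sx ger0_norm.
exists (- acos x / (2 * pi)); rewrite expi_circ /circ mulrC divfK ?mulf_neq0 ?gt_eqF //.
by rewrite cosN sinN acosK ?in_itv // sx ltr0_norm // opprK.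
Qed.

Lemma expi_lip a b : cmod (expi a - expi b : C) <= 4 * pi * `|a - b|.
Proof.
rewrite !expi_circ.
have [l [u [lb la]]] : exists l u, l <= 2 * pi * b <= u /\ l <= 2 * pi * a <= u.
  by exists (Num.min (2 * pi * b) (2 * pi * a)), (Num.max (2 * pi * b) (2 * pi * a)); rewrite !ge_min !le_max !lexx !orbT.
apply: le_trans (@rder_lip R (@circ R) (fun t => Ci R * circ t) 1 l u _ _ _ _ lb la) _.
- by move=> t _; exact: rder_circ.
- by move=> t _; rewrite cmodM cmod_Ci cmod_circ mulr1.
rewrite -mulrBr normrM ger0_norm ?mulr_ge0 ?pi_ge0 //.
by rewrite le_eqVlt; apply/orP; left; apply/eqP; ring.
Qed.

(* Pigeonhole: two of the fractional parts of [0, a, ..., M a] lie in a common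
   interval of length [1 / M]. *)
Lemma dirichlet_approx a (M : nat) : (0 < M)%N ->
  exists (q : nat) (p : int), (0 < q)%N /\ `|q%:R * a - p%:~R| < M%:R^-1.
Proof.
move=> M0; have MR : 0 < M%:R :> R by rewrite ltr0n.
pose fr x : R := x - (Num.floor x)%:~R.
have fr0 x : 0 <= fr x by rewrite subr_ge0 ge_floor.
have fr1 x : fr x < 1.
  by have := floorD1_gt x; rewrite rmorphD /= /fr; lra.
pose bx (j : nat) := Num.trunc (M%:R * fr (j%:R * a)).
have bxM j : (bx j < M)%N.
  rewrite truncn_lt_nat ?mulr_ge0 ?ler0n // -[ltRHS]mulr1 ltr_pM2l //.
have [inj|] := boolP (injectiveb (fun j : 'I_M.+1 => Ordinal (bxM j))).
  by have := leq_card _ (injectiveP _ inj); rewrite !card_ord ltnn.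
move=> /injectivePn[i [j ij /(congr1 val) /= bij]].
wlog lij : i j ij bij / (i < j)%N.
  move=> H; have [lt|] := ltnP i j; first exact: H bij lt.
  rewrite leq_eqVlt => /orP[/eqP ji|lt]; first by case/eqP: ij; exact/val_inj.
  by apply: (H j i) => //; rewrite eq_sym.
exists (j - i)%N, (Num.floor (j%:R * a) - Num.floor (i%:R * a)).
split; first by rewrite subn_gt0.
rewrite natrB ?(ltnW lij) // rmorphB /=.
have -> : (j%:R - i%:R) * a - ((Num.floor (j%:R * a))%:~R - (Num.floor (i%:R * a))%:~R)
  = fr (j%:R * a) - fr (i%:R * a) by rewrite /fr; ring.
have /andP[i1 i2] := truncn_itv (mulr_ge0 (ltW MR) (fr0 (i%:R * a))).
have /andP[j1 j2] := truncn_itv (mulr_ge0 (ltW MR) (fr0 (j%:R * a))).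
rewrite -/(bx i) -/(bx j) bij in i1 i2 j1 j2.
rewrite -[ltRHS]mul1r ltr_pdivlMr // -(ger0_norm (ltW MR)) -normrM.
rewrite ltr_norml; move: i2 j2; rewrite -natr1 => i2 j2.
by rewrite mulrBl !(mulrC _ M%:R); apply/andP; split; lra.
Qed.

(** By Dirichlet some multiple of [a] differs from an integer by a small non-zero [b]. The multiples
    of [b] go once around the circle in about [1 / |b|] steps of size at most [delta], so [N] does
    not depend on the target. *)
Lemma irrational_dense a delta : Defs.irrational a -> 0 < delta ->
  exists N : nat, forall t, exists j : nat, (j <= N)%N /\
    cmod (expi a ^+ j - expi t : C) <= delta.
Proof.
move=> airr d0; have pi0 : 0 < (pi : R) := pi_gt0 R.
pose M := (Num.trunc (4 * pi / delta)).+1.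
have M0 : 0 < M%:R :> R by rewrite ltr0n.
have [q [p [q0 qp]]] := dirichlet_approx a (isT : (0 < M)%N).
pose b := q%:R * a - p%:~R.
have b0 : b != 0.
  rewrite subr_eq0; apply/eqP => qa; apply: (airr (p%:~R / q%:R)).
  rewrite fmorph_div /= ratr_int ratr_nat -qa mulrAC divff ?mul1r //.
  by rewrite pnatr_eq0 -lt0n.
have nb0 : 0 < `|b| by rewrite normr_gt0.
have bd : 4 * pi * `|b| <= delta.
  have : 4 * pi / delta < M%:R by exact: truncnS_gt.
  rewrite ltr_pdivrMr // => H1.
  have : `|b| * M%:R < 1 by rewrite -ltr_pdivlMr // mul1r.
  move: (M%:R) M0 H1 => m m0 H1 H2.
  have : 4 * pi * (`|b| * m) < 1 * (m * delta).
    apply: le_lt_trans (_ : 4 * pi * 1 < _); last by rewrite mulr1 mul1r.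
    by apply: ler_wpM2l (ltW H2); apply: mulr_ge0; [rewrite ler0n|exact: ltW].
  by rewrite mul1r mulrA (mulrC m) ltr_pM2r // => /ltW.
have exb k : expi b ^+ k = expi a ^+ (k * q) :> C.
  rewrite mulnC exprM -(expi_nat a q) -(mulr_natl a q); congr (_ ^+ k).
  have -> : q%:R * a = b + p%:~R by rewrite /b subrK.
  by rewrite (expiD b) expi_int mulr1.
pose B := (Num.trunc `|b|^-1).
exists (B * q)%N => t.
(* The steps run in the direction of the sign of [b], so the representative of [t] modulo 1 is taken
   with that sign. *)
have [t' [tt' t'b t'1]] : exists t', [/\ expi t = expi t' :> C, 0 <= t' / b & `|t'| <= 1].
  pose t0 := t - (Num.floor t)%:~R.
  have t00 : 0 <= t0 by rewrite subr_ge0 ge_floor.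
  have t01 : t0 < 1.
    by have := floorD1_gt t; rewrite rmorphD /= /t0; lra.
  have et0 : expi t = expi t0 :> C.
    have -> : t = t0 + (Num.floor t)%:~R by rewrite /t0 subrK.
    by rewrite (expiD t0) expi_int mulr1.
  have [bp|bn|/eqP] := ltrgt0P b; last by rewrite (negbTE b0).
    by exists t0; split; rewrite ?divr_ge0 ?(ltW bp) // ger0_norm // ltW.
  exists (t0 - 1); split.
  - rewrite et0; have {1}-> : t0 = (t0 - 1) + 1 by rewrite subrK.
    by rewrite (expiD (t0 - 1)) expi1 mulr1.
  - rewrite ler_ndivlMr // mul0r; lra.
  - by rewrite ler0_norm; lra.
have /andP[k1 k2] := truncn_itv t'b; set k := Num.trunc _ in k1 k2.
exists (k * q)%N; split.
  rewrite leq_mul2r; apply/orP; right; apply: le_truncn.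
  apply: le_trans (ler_norm _) _; rewrite normrM normfV -[leRHS]mul1r.
  by apply: ler_wpM2r; rewrite ?invr_ge0.
rewrite -exb tt' -expi_nat; apply: le_trans (expi_lip _ _) _.
apply: le_trans bd; rewrite -!mulrA; apply: ler_wpM2l; first by rewrite ler0n.
apply: ler_wpM2l; first exact: ltW.
have -> : b *+ k - t' = b * (k%:R - t' / b) by rewrite -mulr_natl; field.
rewrite normrM -[leRHS]mulr1; apply: ler_wpM2l => //.
by rewrite ler_norml; move: k2; rewrite -natr1 => k2; apply/andP; split; lra.
Qed.

End IrrationalRotation.

(** * Invariance and near density in the maximal circle *)

Section SiegelCompacta.
Variable R : realType.
Local Notation C := (Cplx R).
Implicit Types (f g F : C -> C) (z w u : C) (r s e : R) (K L : set C).

Lemma max_cmod K : compact K -> K 0 ->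
  exists z, K z /\ forall w, K w -> cmod w <= cmod z.
Proof.
move=> Kc K0.
have cc (z : C) : cmod x @[x --> z] --> cmod z.
  apply/(@cvgrPdist_le _ _ _ _ (nbhs_filter z)) => e e0; apply/nbhs_cmod; exists e => // w wz.
  have := cmod_sub z w; have := cmod_sub w z; rewrite (cmodBC z) => A B.
  rewrite ler_norml; apply/andP; split; lra.
have cw : {within K, continuous (@cmod R)}.
  by apply: continuous_subspaceT => ?; exact: cc.
have [|z zK zP] := compact_EVT_max _ Kc cw; first by exists 0.
by exists z; split=> [|w wK]; [rewrite inE in zK|apply: zP; rewrite inE].
Qed.

(** The points with a neighbourhood on which [F = f] form an open set whose trace on [K] is closed
    in [K] by [local_identity] and contains 0. *)
Lemma connected_identity f F r (U K : set C) : hol f 0 r -> open U -> K `<=` U ->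
  holo_on U F -> germ_eq F f -> connected K -> K 0 -> inD K r ->
  forall z, K z -> F z = f z.
Proof.
move=> fh Uo KU Fh /nbhs_cmod[t t0 Ff] Kcon K0 Kr.
pose O : set C := [set z | exists2 s, 0 < s & forall w, cmod (w - z) < s -> F w = f w].
have Oo : open O.
  rewrite openE => z [s s0 sP]; apply/nbhs_cmod; exists (s / 2); first by rewrite divr_gt0.
  move=> w wz; exists (s / 2); first by rewrite divr_gt0.
  by move=> v vw; apply: sP; have := cmod_tri v z w; lra.
have clO z : K z -> closure O z -> O z.
  move=> Kz clz.
  have /nbhs_cmod[s s0 sU] : nbhs z U by apply: open_nbhs_nbhs; split=> //; exact: KU.
  have zr := Kr z Kz.
  pose rho := Num.min s (r - cmod z).
  have rho0 : 0 < rho by rewrite lt_min s0 subr_gt0.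
  have rhos : rho <= s by rewrite ge_min lexx.
  have rhor : rho <= r - cmod z by rewrite ge_min lexx orbT.
  have hF : hol (fun w => F w - f w) z rho.
    move=> w wz.
    have [|d fd] := fh w; first by rewrite subr0; have := cmod_sub w z; lra.
    have /differentiable_cderiv Fd : differentiable F w by apply: Fh; apply: sU; lra.
    by exists (derive1 F w - d); exact: cderivB.
  (* On the disc of radius [rho / 2] about [z'] the identity extends to radius [rho / 8], which
     still contains the disc of radius [rho / 32] about [z]. *)
  have [z' [[t' t'0 z'P] z'z]] := clz [set w | cmod (w - z) < rho / 16] ltac:(apply/nbhs_cmod; exists (rho / 16) => //; rewrite divr_gt0 // ltr0n //).
  rewrite /= in z'z.
  have hF' : hol (fun w => F w - f w) z' (rho / 2) by apply: hol_sub hF; lra.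
  have := @local_identity R _ z' (rho / 2) t' ltac:(lra) hF' t'0.
  move=> H.
  exists (rho / 32); first by rewrite divr_gt0 // ltr0n.
  move=> w wz; apply/eqP; rewrite -subr_eq0; apply/eqP; apply: H.
    by move=> v /z'P ->; rewrite subrr.
  by have := cmod_tri w z' z; rewrite (cmodBC z z'); lra.
have KO : K `&` O = K.
  apply: Kcon.
  - by exists 0; split => //; exists t.
  - by exists O.
  - exists (closure O); first exact: closed_closure.
    by apply/seteqP; split=> z [Kz Oz]; split => //; [exact: subset_closure|exact: clO].
move=> z; rewrite -KO => -[_ [s s0 sP]].
by apply: sP; rewrite subrr cmod0.
Qed.

Lemma Siegel_invariant f l : is_germ f l -> exists2 e, 0 < e &
  forall K, Siegel_compact f K -> inD K e -> f @` K = K.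
Proof.
move=> [_ [r [r0 fh _ _]]]; exists r => //.
move=> K [Kc [Kcon [_ [K0 [_ [[U [F [Uo [KU [Fh [_ [Ff FK]]]]]]] _]]]]]] Kr.
rewrite -[RHS]FK; have E := connected_identity fh Uo KU Fh Ff Kcon K0 Kr.
by apply/seteqP; split=> _ [z Kz <-]; exists z => //; rewrite E.
Qed.

(** [N] rotations come within [delta / 2] of every direction. The orbit stays in [K], so each step
    departs from the rotation by at most [eta * cmod z0], and [eta] is chosen so that [N] steps lose
    at most another [delta / 2]. *)
Lemma invariant_near_circle f a delta : is_germ f (expi a) -> Defs.irrational a -> 0 < delta ->
  exists2 e, 0 < e & forall K z0, inD K e -> f @` K = K -> K z0 ->
    (forall z, K z -> cmod z <= cmod z0) ->
    forall u, cmod u = cmod z0 -> exists2 z, K z & cmod (z - u) <= delta * cmod z0.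
Proof.
move=> [_ [r [r0 fh f0 fd]]] airr d0.
have d20 : 0 < delta / 2 by rewrite divr_gt0.
have [N NP] := irrational_dense airr d20.
pose eta := delta / 2 / N.+1%:R.
have N0 : 0 < N.+1%:R :> R by rewrite ltr0n.
have eta0 : 0 < eta by rewrite divr_gt0.
have [s s0 sP] := fd eta eta0.
exists s => // K z0 Ks fK Kz0 Kmax u uz0.
have [z00|z00] := eqVneq z0 0.
  exists z0 => //; move: uz0; rewrite z00 cmod0 => /eqP; rewrite cmod_eq0 => /eqP ->.
  by rewrite subrr cmod0 mulr0.
have r0' : 0 < cmod z0 by rewrite cmod_gt0.
have [t ut] := @unit_expi R (u / z0) ltac:(by rewrite cmodM cmodV uz0 divff // gt_eqF).
have {}ut : u = expi t * z0 by rewrite -ut divfK.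
have [j [jN jP]] := NP t.
have Kit i : K (iter i f z0).
  by elim: i => [//|i IH]; rewrite iterS -fK; exists (iter i f z0).
have close i : cmod (iter i f z0 - expi a ^+ i * z0) <= i%:R * (eta * cmod z0).
  elim: i => [|i IH]; first by rewrite expr0 mul1r subrr cmod0 mul0r.
  rewrite iterS; set x := iter i f z0 in IH *.
  have -> : f x - expi a ^+ i.+1 * z0 =
    (f x - f 0 - expi a * (x - 0)) + expi a * (x - expi a ^+ i * z0).
    by rewrite f0 exprS; ring.
  apply: le_trans (cmodD _ _) _; rewrite cmodM cmod_expi mul1r.
  have := sP x; rewrite subr0 => /(_ (Ks _ (Kit i))) H.
  have xz := ler_wpM2l (ltW eta0) (Kmax x (Kit i)).
  rewrite -natr1 mulrDl mul1r addrC.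
  by apply: lerD => //; apply: le_trans H xz.
exists (iter j f z0) => //.
have -> : iter j f z0 - u = (iter j f z0 - expi a ^+ j * z0) + (expi a ^+ j - expi t) * z0.
  by rewrite ut; ring.
apply: le_trans (cmodD _ _) _; rewrite cmodM.
have A : j%:R * (eta * cmod z0) <= delta / 2 * cmod z0.
  rewrite mulrA; apply: ler_wpM2r; first exact: ltW.
  rewrite /eta mulrCA ler_piMr ?(ltW d20) // ler_pdivrMr // mul1r ler_nat.
  exact: leqW.
have B : cmod (expi a ^+ j - expi t) * cmod z0 <= delta / 2 * cmod z0.
  by apply: ler_wpM2r jP; exact: ltW.
have := close j; lra.
Qed.

(** If the image of [K] is a member, it is invariant, so [K] and its image have the same image;
    injectivity near 0 then makes them equal. *)
Lemma preserves_self f l (KK : set (set C)) e : is_germ f l -> 0 < e ->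
  (forall K, KK K -> inD K e -> f @` K = K) -> preserves KK f.
Proof.
move=> fg e0 H; have [l0 [r [r0 fh f0 fd]]] := fg.
have [h [s [s2 [[s0 sr s20] [low _ _ _ _]]]]] := local_inverse r0 fh f0 fd l0.
have m0 : 0 < Num.min s e by rewrite lt_min s0.
have [t t0 tP] := is_germ_image fg m0.
exists (Num.min t (Num.min s e)); first by rewrite lt_min t0.
move=> K Kc K0 Kt; split.
  move=> HK; rewrite H // => z /Kt; by rewrite !lt_min => /and3P[].
move=> HfK; have [] := tP K Kc K0; first by move=> z /Kt; rewrite lt_min => /andP[].
move=> _ _ fKse.
have ffK : f @` (f @` K) = f @` K.
  by apply: H => // z /fKse; rewrite lt_min => /andP[].
suff -> : K = f @` K by [].
have inj x y : cmod x < s -> cmod y < s -> f x = f y -> x = y.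
  move=> xs ys fxy; apply/eqP; rewrite -subr_eq0 -cmod_eq0 eq_le cmod_ge0 andbT.
  have := low x y xs ys; rewrite fxy subrr cmod0 pmulr_rle0 //.
  by rewrite divr_gt0 // cmod_gt0.
have Ks z : K z -> cmod z < s by move=> /Kt; rewrite !lt_min => /and3P[].
have fKs z : (f @` K) z -> cmod z < s by move=> /fKse; rewrite lt_min => /andP[].
apply/seteqP; split=> z Hz.
  have : (f @` K) (f z) by exists z.
  rewrite -{1}ffK => -[y fKy yz].
  by have <- := inj y z (fKs y fKy) (Ks z Hz) yz.
have : (f @` (f @` K)) (f z) by exists z.
rewrite {1}ffK => -[y Ky yz].
by have <- := inj y z (Ks y Ky) (fKs z Hz) yz.
Qed.

End SiegelCompacta.

(** * Automorphisms tangent to the identity *)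

Section Parabolic.
Variable R : realType.
Local Notation C := (Cplx R).
Implicit Types (f g : C -> C) (x y z w u : C) (r s e : R) (K L : set C).

Lemma cmod_expB x y B m : cmod x <= B -> cmod y <= B ->
  cmod (x ^+ m.+1 - y ^+ m.+1) <= m.+1%:R * B ^+ m * cmod (x - y).
Proof.
move=> xB yB; have B0 : 0 <= B by apply: le_trans xB; exact: cmod_ge0.
elim: m => [|m IH]; first by rewrite !expr1 expr0 !mul1r.
have -> : x ^+ m.+2 - y ^+ m.+2 = x * (x ^+ m.+1 - y ^+ m.+1) + (x - y) * y ^+ m.+1.
  by rewrite !exprS; ring.
apply: le_trans (cmodD _ _) _; rewrite !cmodM cmodX.
have A1 : cmod x * cmod (x ^+ m.+1 - y ^+ m.+1) <= B * (m.+1%:R * B ^+ m * cmod (x - y)).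
  by apply: ler_pM; rewrite ?cmod_ge0.
have A2 : cmod (x - y) * cmod y ^+ m.+1 <= cmod (x - y) * B ^+ m.+1.
  by apply: ler_wpM2l; rewrite ?cmod_ge0 //; apply: lerXn2r; rewrite ?nnegrE ?cmod_ge0.
apply: le_trans (lerD A1 A2) _.
rewrite -(natr1 m.+1) exprS le_eqVlt; apply/orP; left; apply/eqP; ring.
Qed.

Lemma unit_root (c : C) n : (0 < n)%N -> cmod c = 1 -> exists2 u, cmod u = 1 & u ^+ n = c.
Proof.
move=> n0 c1; exists (n.-root c); last exact: rootCK.
by apply/eqP; rewrite -(pexpr_eq1 n0) ?cmod_ge0 // -cmodX rootCK // c1.
Qed.

(** Size of one step: on the disc of radius [2 * rho] a point moves by at most this constant times
    [rho ^+ n.+1]. *)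
Definition flowA (b : C) n (M : R) : R := (cmod b + M) * 2 ^+ n.+1.

(** Second-order error: the first summand measures the change of [b * w ^+ n.+1] along the orbit,
    the second the Taylor remainder of [g]. *)
Definition flowD (b : C) n (M : R) : R :=
  cmod b * n.+1%:R * 2 ^+ n * flowA b n M + M * 2 ^+ n.+2.

(* [g w = w + b w^(n+1) + O(w^(n+2))]: the first [N] iterates follow the time-[N]
   flow of [b w^(n+1)], up to a relative error [O(t^2)] on the disc of radius
   [rho] as long as [N rho^n <= t]. *)
Section Iterates.
Variables (g : C -> C) (b : C) (n N : nat) (M r0 rho t : R).
Hypothesis M0 : 0 <= M.
Hypothesis gE : forall w, cmod w <= r0 ->
  cmod (g w - w - b * w ^+ n.+1) <= M * cmod w ^+ n.+2.
Let A := flowA b n M.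
Let D := flowD b n M.
Hypotheses (rho0 : 0 < rho) (rho_r0 : 2 * rho <= r0) (rho1 : 2 * rho <= 1).
Hypotheses (rho_t : rho <= t) (Nrho : N%:R * rho ^+ n <= t) (At : A * t <= 1).

Lemma flow_const_ge0 : 0 <= A.
Proof. by rewrite mulr_ge0 ?exprn_ge0 // addr_ge0 // cmod_ge0. Qed.

Lemma flow_step w : cmod w <= 2 * rho ->
  cmod (g w - w - b * w ^+ n.+1) <= M * 2 ^+ n.+2 * rho ^+ n.+2 /\
  cmod (g w - w) <= A * rho ^+ n.+1.
Proof.
move=> wr; have r20 : 0 <= 2 * rho by rewrite mulr_ge0 // ltW.
have cw := cmod_ge0 w.
have H1 : cmod (g w - w - b * w ^+ n.+1) <= M * (2 * rho) ^+ n.+2.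
  apply: le_trans (gE _) _; first exact: le_trans rho_r0.
  by apply: ler_wpM2l => //; apply: lerXn2r; rewrite ?nnegrE.
split; first by apply: le_trans H1 _; rewrite exprMn mulrA.
have -> : g w - w = (g w - w - b * w ^+ n.+1) + b * w ^+ n.+1 by ring.
apply: le_trans (cmodD _ _) _; rewrite cmodM cmodX.
have H2 : cmod b * cmod w ^+ n.+1 <= cmod b * (2 * rho) ^+ n.+1.
  by apply: ler_wpM2l; rewrite ?cmod_ge0 //; apply: lerXn2r; rewrite ?nnegrE.
have H3 : M * (2 * rho) ^+ n.+2 <= M * (2 * rho) ^+ n.+1.
  by apply: ler_wpM2l => //; rewrite exprS ler_piMl // exprn_ge0.
apply: le_trans (lerD (le_trans H1 H3) H2) _.
by rewrite /A /flowA !exprMn le_eqVlt; apply/orP; left; apply/eqP; ring.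
Qed.

Let Nj j : (j <= N)%N -> j%:R * rho ^+ n <= t.
Proof.
move=> jN; apply: le_trans Nrho; apply: ler_wpM2r; last by rewrite ler_nat.
by rewrite exprn_ge0 // ltW.
Qed.

(** A bootstrap: the step bound holds on the disc of radius [2 * rho], and [A * t <= 1] keeps the
    total displacement below [rho], so the orbit does not leave that disc. *)
Lemma iter_close z j : cmod z <= rho -> (j <= N)%N ->
  cmod (iter j g z - z) <= A * t * rho /\ cmod (iter j g z) <= 2 * rho.
Proof.
move=> zr jN; have A0 := flow_const_ge0.
suff [H1 H2] : cmod (iter j g z - z) <= j%:R * (A * rho ^+ n.+1) /\ cmod (iter j g z) <= 2 * rho.
  split => //; apply: le_trans H1 _.
  rewrite exprS (_ : _ * _ = A * (j%:R * rho ^+ n) * rho); last by ring.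
  by apply: ler_wpM2r; [exact: ltW|apply: ler_wpM2l (Nj jN)].
elim: j jN => [_|j IH jN].
  by rewrite /= subrr cmod0 mul0r; split => //; have := rho0; lra.
have [H1 H2] := IH (ltnW jN).
have [_ H3] := flow_step H2.
have H4 : cmod (iter j.+1 g z - z) <= j.+1%:R * (A * rho ^+ n.+1).
  rewrite iterS; apply: le_trans (cmod_tri _ _ (iter j g z)) _.
  by rewrite -natr1 mulrDl mul1r addrC; apply: lerD.
split => //.
have H5 : j.+1%:R * (A * rho ^+ n.+1) <= rho.
  rewrite exprS (_ : _ * _ = A * (j.+1%:R * rho ^+ n) * rho); last by ring.
  rewrite -[leRHS]mul1r; apply: ler_wpM2r; first exact: ltW.
  by apply: le_trans At; apply: ler_wpM2l (Nj jN).
have := cmod_sub (iter j.+1 g z) z; lra.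
Qed.

(** Each step adds [b * z ^+ n.+1] up to [E]: the current point is within [A * t * rho] of [z].
    Summing, [rho <= t] turns the Taylor remainder into a term of order [t ^+ 2] as well. *)
Lemma iter_flow z : cmod z <= rho ->
  cmod (iter N g z - z - N%:R * b * z ^+ n.+1) <= D * t ^+ 2 * rho.
Proof.
move=> zr; have A0 := flow_const_ge0; have rh0 := ltW rho0.
have t0 : 0 <= t by apply: le_trans rho_t.
pose E := cmod b * (n.+1%:R * (2 * rho) ^+ n * (A * t * rho)) + M * 2 ^+ n.+2 * rho ^+ n.+2.
suff H j : (j <= N)%N -> cmod (iter j g z - z - j%:R * b * z ^+ n.+1) <= j%:R * E.
  apply: le_trans (H N (leqnn N)) _.
  have -> : N%:R * E = (N%:R * rho ^+ n) *
      (cmod b * n.+1%:R * 2 ^+ n * A * t + M * 2 ^+ n.+2 * rho) * rho.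
    by rewrite /E exprMn !exprS; ring.
  apply: ler_wpM2r => //.
  have -> : D * t ^+ 2 = t * (cmod b * n.+1%:R * 2 ^+ n * A * t + M * 2 ^+ n.+2 * t).
    by rewrite /D /flowD -/A; ring.
  have c1 : 0 <= cmod b * n.+1%:R * 2 ^+ n * A.
    apply: mulr_ge0 => //; apply: mulr_ge0; last exact: exprn_ge0.
    by apply: mulr_ge0; rewrite ?cmod_ge0.
  have c2 : 0 <= M * 2 ^+ n.+2 by apply: mulr_ge0 => //; exact: exprn_ge0.
  apply: ler_pM => //.
  - by apply: mulr_ge0; rewrite ?ler0n ?exprn_ge0.
  - by apply: addr_ge0; apply: mulr_ge0.
  - by apply: lerD => //; apply: ler_wpM2l.
elim: j => [_|j IH jN]; first by rewrite /= !mul0r subrr subr0 cmod0.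
have [C1 C2] := iter_close zr (ltnW jN).
have [C3 _] := flow_step C2.
rewrite iterS; set x := iter j g z in IH C1 C2 C3 *.
have -> : g x - z - j.+1%:R * b * z ^+ n.+1 =
  (x - z - j%:R * b * z ^+ n.+1) + (b * (x ^+ n.+1 - z ^+ n.+1) + (g x - x - b * x ^+ n.+1)).
  by rewrite -natr1; ring.
apply: le_trans (cmodD _ _) _; rewrite -natr1 mulrDl mul1r; apply: lerD; first exact: IH (ltnW jN).
apply: le_trans (cmodD _ _) _; apply: lerD => //; rewrite cmodM.
apply: ler_wpM2l; first exact: cmod_ge0.
have zr2 : cmod z <= 2 * rho by lra.
apply: le_trans (cmod_expB n C2 zr2) _; apply: ler_wpM2l => //.
by rewrite mulr_ge0 // exprn_ge0 // mulr_ge0.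
Qed.

Section Spread.
Variables (K : set C) (z0 z0' : C).
Hypotheses (b0 : b != 0) (n0 : (0 < n)%N) (t1 : t <= 1) (Nrho2 : t / 2 <= N%:R * rho ^+ n).
Hypotheses (z0rho : cmod z0 = rho) (K_max : forall z, K z -> cmod z <= rho).
Hypothesis K'_z0' : (iter N g @` K) z0'.
Hypothesis K'_max : forall z, (iter N g @` K) z -> cmod z <= cmod z0'.
Hypothesis K_circle : forall u, cmod u = rho ->
  exists2 z, K z & cmod (z - u) <= t ^+ 2 * rho.
Hypothesis K'_circle : forall u, cmod u = cmod z0' ->
  exists2 z, (iter N g @` K) z & cmod (z - u) <= t ^+ 2 * cmod z0'.

Let beta : R := cmod b.
Let rho' : R := cmod z0'.
(** The three errors in [spread_out]: distance from the aimed point to [K], change of the flow term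
    over that distance, and [iter_flow]. *)
Let D1 : R := 1 + beta * n.+1%:R + D.
(** The same three errors in [spread_in], enlarged because the aimed point has modulus up to
    [2 * rho] and is compared with the preimage [z], at distance up to [(A + 2) * t * rho]. *)
Let D2 : R := 2 + beta * n.+1%:R * 2 ^+ n * (A + 2) + D.

Let beta0 : 0 < beta. Proof. by rewrite cmod_gt0. Qed.
Let t0 : 0 < t. Proof. exact: lt_le_trans rho_t. Qed.
Let D0 : 0 <= D.
Proof.
have A0 := flow_const_ge0.
apply: addr_ge0; last by apply: mulr_ge0 => //; exact: exprn_ge0.
apply: mulr_ge0 => //; apply: mulr_ge0; last exact: exprn_ge0.
by apply: mulr_ge0; rewrite ?cmod_ge0.
Qed.

Let rho'2 : rho' <= 2 * rho.
Proof.
have [z Kz zE] := K'_z0'; rewrite /rho' -zE.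
by have [] := iter_close (K_max Kz) (leqnn N).
Qed.

(* [s = 1] and [s = -1] give the directions of strongest expansion and
   contraction. *)
Let direction (s : C) : cmod s = 1 -> exists2 u, cmod u = 1 & b * u ^+ n = s * ofR beta.
Proof.
move=> s1; have bn : cmod (s * ofR beta / b) = 1.
  by rewrite !cmodM cmodV cmod_ofR s1 mul1r gtr0_norm // divff // gt_eqF.
have [u u1 un] := unit_root n0 bn; exists u => //.
by rewrite un mulrC divfK.
Qed.

(** [K] has a point near the one of modulus [rho] in an expanding direction; its image is pushed
    outwards and still has modulus at most [rho']. *)
Let spread_out : rho * (1 + N%:R * rho ^+ n * beta - D1 * t ^+ 2) <= rho'.
Proof.
have [u u1 un] := direction (@cmod1 R).
pose p := ofR rho * u.
have cp : cmod p = rho by rewrite cmodM u1 mulr1 cmod_ofR gtr0_norm.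
have [z Kz zp] := K_circle cp.
have zr := K_max Kz.
have fz := iter_flow zr; set z' := iter N g z in fz.
have z'r : cmod z' <= rho' by apply: K'_max; exists z.
have Np : p + N%:R * b * p ^+ n.+1 = ofR (rho * (1 + N%:R * rho ^+ n * beta)) * u.
  have -> : N%:R * b * p ^+ n.+1 = N%:R * ofR rho ^+ n * (b * u ^+ n) * p.
    by rewrite /p exprMn !exprS; ring.
  by rewrite un ofRM ofRD !ofRM ofR1 ofRX ofR_nat /p; ring.
have t20 : 0 <= t ^+ 2 by exact: sqr_ge0.
have E : cmod (N%:R * b * (z ^+ n.+1 - p ^+ n.+1)) <= beta * n.+1%:R * t ^+ 2 * rho.
  rewrite !cmodM -ofR_nat cmod_ofR ger0_norm ?ler0n //.
  have pr : cmod p <= rho by rewrite cp.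
  have H := cmod_expB n zr pr.
  have H2 : cmod (z ^+ n.+1 - p ^+ n.+1) <= n.+1%:R * rho ^+ n * (t ^+ 2 * rho).
    apply: le_trans H _; apply: ler_wpM2l => //.
    by apply: mulr_ge0; rewrite ?ler0n ?exprn_ge0 // ltW.
  apply: le_trans (ler_wpM2l _ H2) _; first by rewrite mulr_ge0 ?ler0n ?cmod_ge0.
  have -> : N%:R * cmod b * (n.+1%:R * rho ^+ n * (t ^+ 2 * rho)) =
    (N%:R * rho ^+ n) * (beta * n.+1%:R * t ^+ 2 * rho) by rewrite /beta; ring.
  rewrite -[leRHS]mul1r; apply: ler_wpM2r; last exact: le_trans t1.
  by rewrite !mulr_ge0 ?ler0n // ltW.
have : cmod (p + N%:R * b * p ^+ n.+1) <= cmod z' + (cmod (z' - z - N%:R * b * z ^+ n.+1)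
    + (cmod (N%:R * b * (z ^+ n.+1 - p ^+ n.+1)) + cmod (z - p))).
  have -> : p + N%:R * b * p ^+ n.+1 = z' - ((z' - z - N%:R * b * z ^+ n.+1)
    + (N%:R * b * (z ^+ n.+1 - p ^+ n.+1) + (z - p))) by ring.
  apply: le_trans (cmodB _ _) _; apply: lerD => //.
  by apply: le_trans (cmodD _ _) _; apply: lerD => //; exact: cmodD.
rewrite Np cmodM u1 mulr1 cmod_ofR ger0_norm; last first.
  apply: mulr_ge0; first exact: ltW.
  apply: addr_ge0 => //; apply: mulr_ge0; last exact: ltW.
  by apply: mulr_ge0; rewrite ?ler0n ?exprn_ge0 // ltW.
move=> H; have H2 := le_trans H (lerD z'r (lerD fz (lerD E zp))).
have -> : rho * (1 + N%:R * rho ^+ n * beta - D1 * t ^+ 2) =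
   rho * (1 + N%:R * rho ^+ n * beta) - (D * t ^+ 2 * rho +
     (beta * n.+1%:R * t ^+ 2 * rho + t ^+ 2 * rho)) by rewrite /D1; ring.
by rewrite lerBlDr.
Qed.

(** The image of [K] has a point near the one of modulus [rho'] in a contracting direction; its
    preimage in [K] lies further out, up to the error, yet has modulus at most [rho]. *)
Let spread_in : rho' - D2 * t ^+ 2 * rho <= rho.
Proof.
have A0 := flow_const_ge0.
have [v v1 vn] := direction (ltac:(by rewrite cmodN cmod1) : cmod (- 1) = 1).
pose p := ofR rho' * v.
have cp : cmod p = rho' by rewrite cmodM v1 mulr1 cmod_ofR ger0_norm ?cmod_ge0.
have [z' [z Kz zz'] zp] := K'_circle cp.
have zr := K_max Kz.
have fz := iter_flow zr; rewrite zz' in fz.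
have [zc _] := iter_close zr (leqnn N); rewrite zz' in zc.
have r0' := cmod_ge0 z0'; rewrite -/rho' in r0' zp.
have Np : p - N%:R * b * p ^+ n.+1 = ofR (rho' * (1 + N%:R * rho' ^+ n * beta)) * v.
  have -> : N%:R * b * p ^+ n.+1 = N%:R * ofR rho' ^+ n * (b * v ^+ n) * p.
    by rewrite /p exprMn !exprS; ring.
  by rewrite vn ofRM ofRD !ofRM ofR1 ofRX ofR_nat /p; ring.
have t20 : 0 <= t ^+ 2 by exact: sqr_ge0.
have zp2 : cmod (z' - p) <= 2 * t ^+ 2 * rho.
  apply: le_trans zp _; have -> : 2 * t ^+ 2 * rho = t ^+ 2 * (2 * rho) by ring.
  exact: ler_wpM2l.
have zp3 : cmod (z - p) <= (A + 2) * t * rho.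
  have := cmod_tri z p z'; rewrite (cmodBC z z') => H.
  apply: le_trans H _; apply: le_trans (lerD zc zp2) _.
  rewrite -mulrDl; apply: ler_wpM2r; first exact: ltW.
  rewrite [leRHS]mulrDl lerD2l; apply: ler_wpM2l => //.
  by rewrite expr2 ler_piMl // ltW.
have E : cmod (N%:R * b * (z ^+ n.+1 - p ^+ n.+1)) <=
    beta * n.+1%:R * 2 ^+ n * (A + 2) * t ^+ 2 * rho.
  rewrite !cmodM -ofR_nat cmod_ofR ger0_norm ?ler0n //.
  have pr : cmod p <= 2 * rho by rewrite cp.
  have zr2 : cmod z <= 2 * rho by have := rho0; lra.
  have H := cmod_expB n zr2 pr.
  have H2 : cmod (z ^+ n.+1 - p ^+ n.+1) <= n.+1%:R * (2 * rho) ^+ n * ((A + 2) * t * rho).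
    apply: le_trans H _; apply: ler_wpM2l => //.
    by apply: mulr_ge0; rewrite ?ler0n ?exprn_ge0 // mulr_ge0 // ltW.
  apply: le_trans (ler_wpM2l _ H2) _; first by rewrite mulr_ge0 ?ler0n ?cmod_ge0.
  have -> : N%:R * cmod b * (n.+1%:R * (2 * rho) ^+ n * ((A + 2) * t * rho)) =
    (N%:R * rho ^+ n) * (beta * n.+1%:R * 2 ^+ n * (A + 2) * t * rho).
    by rewrite /beta exprMn; ring.
  have -> : beta * n.+1%:R * 2 ^+ n * (A + 2) * t ^+ 2 * rho =
    t * (beta * n.+1%:R * 2 ^+ n * (A + 2) * t * rho) by ring.
  apply: ler_wpM2r => //.
  apply: mulr_ge0; last exact: ltW.
  apply: mulr_ge0; last exact: ltW.
  apply: mulr_ge0; last by rewrite addr_ge0.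
  by apply: mulr_ge0; rewrite ?exprn_ge0 // mulr_ge0 ?ler0n // ltW.
have : cmod (p - N%:R * b * p ^+ n.+1) <= cmod z + (cmod (z' - z - N%:R * b * z ^+ n.+1)
    + (cmod (N%:R * b * (z ^+ n.+1 - p ^+ n.+1)) + cmod (z' - p))).
  have -> : p - N%:R * b * p ^+ n.+1 = z + ((z' - z - N%:R * b * z ^+ n.+1)
    + (N%:R * b * (z ^+ n.+1 - p ^+ n.+1) - (z' - p))) by ring.
  apply: le_trans (cmodD _ _) _; apply: lerD => //.
  by apply: le_trans (cmodD _ _) _; apply: lerD => //; exact: cmodB.
have q0 : 0 <= N%:R * rho' ^+ n * beta.
  apply: mulr_ge0; last exact: ltW.
  by apply: mulr_ge0; rewrite ?ler0n ?exprn_ge0.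
rewrite Np cmodM v1 mulr1 cmod_ofR ger0_norm; last by rewrite mulr_ge0 // addr_ge0.
move=> H; have H2 := le_trans H (lerD zr (lerD fz (lerD E zp2))).
(* The outward gain of the preimage is discarded; the gain from [spread_out] is the one that is
   compared with [t]. *)
rewrite lerBlDr; apply: le_trans (_ : rho' * (1 + N%:R * rho' ^+ n * beta) <= _).
  by rewrite ler_peMr // lerDl.
apply: le_trans H2 _; rewrite lerD2l le_eqVlt; apply/orP; left; apply/eqP.
by rewrite /D2; ring.
Qed.

(** Eliminating [rho'] leaves [N rho^n beta <= (D1 + D2) t^2], and [N rho^n] is at least [t / 2]. *)
Lemma spread_bound : beta <= 2 * (D1 + D2) * t.
Proof.
have h1 := spread_out; have h2 := spread_in.
have H : rho * (1 + N%:R * rho ^+ n * beta - D1 * t ^+ 2) - D2 * t ^+ 2 * rho <= rho.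
  by apply: le_trans h2; rewrite lerD2r.
have {}H : rho * (N%:R * rho ^+ n * beta) <= rho * ((D1 + D2) * t ^+ 2).
  move: H; rewrite -subr_ge0 => H; rewrite -subr_ge0; apply: le_trans H _.
  by rewrite le_eqVlt; apply/orP; left; apply/eqP; ring.
rewrite ler_pM2l // in H.
have : t * beta <= t * (2 * (D1 + D2) * t).
  have -> : t * (2 * (D1 + D2) * t) = 2 * ((D1 + D2) * t ^+ 2) by ring.
  have := ler_wpM2r (ltW beta0) Nrho2; lra.
by rewrite ler_pM2l.
Qed.

End Spread.
End Iterates.
End Parabolic.

(** * Triviality of tangent-to-identity automorphisms of a hedgehog germ *)

Section Hedgehog.
Variable R : realType.
Local Notation C := (Cplx R).
Implicit Types (f g h : C -> C) (z w u : C) (r s e : R) (K L : set C).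

Lemma small_member (KK : set (set C)) e : small_family KK -> 0 < e ->
  exists2 K, KK K & inD K e.
Proof.
move=> KKs e0; have [_ /(_ (ofR e))] := KKs; rewrite ofR_gt0 => /(_ e0)[K [HK Kd]].
by exists K => //; apply: diam_lt_inD Kd; exact: KK0 KKs _ HK.
Qed.

(** [K <> [set 0]] is recorded along with invariance because it makes the maximal modulus
    positive. *)
Lemma hedgehog_invariant (KK : set (set C)) : hedgehog_germ KK ->
  exists f a e, [/\ is_germ f (expi a), Defs.irrational a, ~ linearizable f a, 0 < e &
    forall K, KK K -> inD K e -> f @` K = K /\ K <> [set 0]].
Proof.
move=> [KKs [f [[/in_Diff0P fg [a [airr [fa nl]]]] /germ_equiv_small[e e0 eP]]]].
rewrite fa in fg; have [d d0 dP] := Siegel_invariant fg.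
exists f, a, (Num.min e d); split => //; first by rewrite lt_min e0.
move=> K HK Ked; have Ke : inD K e by move=> z /Ked; rewrite lt_min => /andP[].
have SK : Siegel_compact f K.
  by apply/(eP K) => //; [exact: KK_compact KKs _ HK|exact: KK0 KKs _ HK].
split; first by apply: dP => // z /Ked; rewrite lt_min => /andP[].
by case: SK => [_ [_ [_ [_ []]]]].
Qed.

Lemma parabolic_trivial (KK : set (set C)) f a e1 g : small_family KK ->
  is_germ f (expi a) -> Defs.irrational a -> 0 < e1 ->
  (forall K, KK K -> inD K e1 -> f @` K = K /\ K <> [set 0]) ->
  is_germ g 1 -> preserves KK g -> germ_eq g id.
Proof.
move=> KKs fg airr e10 inv [_ [r [r0 gh g0 gd]]] [e2 e20 pres].
have phih : hol (fun w => g w - w) 0 r.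
  move=> z /gh[d zd]; exists (d - 1).
  exact: (cderivB zd (@cderiv_id R z)).
have r40 : 0 < r / 4 by rewrite divr_gt0 // ltr0n.
have [H|[k [b [M [b0 M0 H]]]]] := order_or_zero r0 phih.
  apply/nbhs_cmod; exists (r / 4) => // w; rewrite subr0 => /ltW wr.
  by have := H w wr; rewrite add0r => /eqP; rewrite subr_eq0 => /eqP.
exfalso; have b0' : 0 < cmod b by rewrite cmod_gt0.
have {}H w : cmod w <= r / 4 -> cmod (g w - w - b * w ^+ k) <= M * cmod w ^+ k.+1.
  by move/H; rewrite add0r.
(* Orders 0 and 1 of [g - id] are excluded by [g 0 = 0] and [g'(0) = 1]; from here [n.+1] plays the
   role of [n] in the iteration estimates. *)
case: k H => [|[|n]] H.
- have := H 0; rewrite cmod0 g0 !subr0 sub0r cmodN expr0 mulr1 expr0n mulr0.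
  by move=> /(_ (ltW r40)); rewrite leNgt b0'.
- have [s s0 sP] := gd (cmod b / 4) ltac:(by rewrite divr_gt0 // ltr0n).
  pose x := Num.min (Num.min (r / 4) (s / 2)) (cmod b / (4 * (M + 1))).
  have x0 : 0 < x by rewrite !lt_min r40 !divr_gt0 ?mulr_gt0 ?ltr0n //; lra.
  have x1 : x <= r / 4 by rewrite !ge_min lexx.
  have x2 : x <= s / 2 by rewrite !ge_min lexx orbT.
  have x3 : x <= cmod b / (4 * (M + 1)) by rewrite !ge_min lexx !orbT.
  have cx : cmod (ofR x : C) = x by rewrite cmod_ofR gtr0_norm.
  have A1 := sP (ofR x); rewrite g0 mul1r !subr0 cx in A1.
  have {}A1 := A1 ltac:(lra).
  have A2 := H (ofR x); rewrite cx expr1 in A2; have {}A2 := A2 x1.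
  have A3 := cmod_sub (b * ofR x) (g (ofR x) - ofR x); rewrite cmodM cx (cmodBC (b * ofR x)) in A3.
  have A4 : cmod b * x <= cmod b / 4 * x + M * x ^+ 2 by lra.
  rewrite expr2 mulrA -mulrDl ler_pM2r // in A4.
  move: x3; rewrite ler_pdivlMr; last by lra.
  move=> x3; nra.
pose A := flowA b n.+1 M; pose D := flowD b n.+1 M; pose beta := cmod b.
pose D1 := 1 + beta * n.+2%:R + D.
pose D2 := 2 + beta * n.+2%:R * 2 ^+ n.+1 * (A + 2) + D.
have A0 : 0 <= A by exact: flow_const_ge0.
have D0 : 0 <= D.
  apply: addr_ge0; last by apply: mulr_ge0 => //; exact: exprn_ge0.
  apply: mulr_ge0 => //; apply: mulr_ge0; last exact: exprn_ge0.
  by apply: mulr_ge0; rewrite ?cmod_ge0.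
have D12 : 0 < D1 + D2.
  have c1 : 0 <= beta * n.+2%:R by apply: mulr_ge0; rewrite ?cmod_ge0.
  have c2 : 0 <= beta * n.+2%:R * 2 ^+ n.+1 * (A + 2).
    apply: mulr_ge0; first by apply: mulr_ge0 => //; exact: exprn_ge0.
    exact: addr_ge0.
  by rewrite /D1 /D2; lra.
(* The last bound gives [2 * (D1 + D2) * t <= beta / 2], against [spread_bound]; the second gives
   [A * t <= 1]. *)
pose t := Num.min (Num.min 1 (A + 1)^-1) (beta / (4 * (D1 + D2))).
have t0 : 0 < t.
  by rewrite !lt_min ltr01 invr_gt0 divr_gt0 ?mulr_gt0 ?ltr0n // andbT; lra.
have t1 : t <= 1 by rewrite !ge_min lexx.
have tA : A * t <= 1.
  have : t <= (A + 1)^-1 by rewrite !ge_min lexx orbT.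
  rewrite -[leRHS]mul1r ler_pdivlMr; last by lra.
  by rewrite mulrDr mulr1 mulrC; lra.
have tD : t <= beta / (4 * (D1 + D2)) by rewrite !ge_min lexx !orbT.
have [e3 e30 circle] := invariant_near_circle fg airr (exprn_gt0 2 t0).
(* Halved because the iterates of [K] may reach modulus [2 * rho]. *)
pose e := Num.min (Num.min (Num.min e1 e2) (Num.min e3 (r / 4))) t / 2.
have e0 : 0 < e.
  by apply: divr_gt0 => //; rewrite lt_min t0 andbT !lt_min e10 e20 e30 r40.
have e12 : 2 * e <= e1 by rewrite /e mulrC divfK // !ge_min lexx.
have e22 : 2 * e <= e2 by rewrite /e mulrC divfK // !ge_min lexx !orbT.
have e32 : 2 * e <= e3 by rewrite /e mulrC divfK // !ge_min lexx !orbT.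
have e42 : 2 * e <= r / 4 by rewrite /e mulrC divfK // !ge_min lexx !orbT.
have e52 : 2 * e <= t by rewrite /e mulrC divfK // ge_min lexx orbT.
have [K HK Ke] := small_member KKs e0.
have Kc := KK_compact KKs HK; have K0 := KK0 KKs HK.
have [z0 [Kz0 Kmax]] := max_cmod Kc K0.
pose rho := cmod z0.
have rhoe : rho < e by exact: Ke.
have Ksub e' : 2 * e <= e' -> inD K e'.
  by move=> ee z /Ke; have := cmod_ge0 z; lra.
have [fK Knt] := inv K HK (Ksub _ e12).
have rho0 : 0 < rho.
  rewrite cmod_gt0; apply/eqP => z00; apply: Knt; apply/seteqP; split=> z.
    move=> /Kmax; rewrite z00 cmod0 => z_le; apply/eqP.
    by rewrite -cmod_eq0 eq_le z_le cmod_ge0.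
  by move=> ->.
(* Truncation loses at most [rho ^+ n.+1 <= rho <= t / 2], so [N%:R * rho ^+ n.+1] lies between
   [t / 2] and [t]. *)
pose N := Num.trunc (t / rho ^+ n.+1).
have rn0 : 0 < rho ^+ n.+1 by exact: exprn_gt0.
have /andP[N1 N2] := truncn_itv (divr_ge0 (ltW t0) (ltW rn0)).
rewrite -/N in N1 N2.
have Nt : N%:R * rho ^+ n.+1 <= t by rewrite -ler_pdivlMr.
have rn : rho ^+ n.+1 <= rho.
  by rewrite exprS; apply: ler_piMr; [exact: ltW|apply: exprn_ile1; [exact: ltW|lra]].
have Nt2 : t / 2 <= N%:R * rho ^+ n.+1.
  move: N2; rewrite ltr_pdivrMr // -natr1 mulrDl mul1r; lra.
have rho_r : 2 * rho <= r / 4 by lra.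
have rho_1 : 2 * rho <= 1 by lra.
have rho_t : rho <= t by lra.
have Kr z : K z -> cmod z <= rho by exact: Kmax.
have close j z : (j <= N)%N -> K z -> cmod (iter j g z) <= 2 * rho.
  move=> jN /Kr zr.
  by have [] := @iter_close R g b n.+1 N M (r / 4) rho t M0 H rho0 rho_r rho_1 Nt tA z j zr jN.
have inE j e' : (j <= N)%N -> 2 * e <= e' -> inD (iter j g @` K) e'.
  by move=> jN ee _ [z Kz <-]; have := close j z jN Kz; lra.
have KKj j : (j <= N)%N -> KK (iter j g @` K).
  elim: j => [_|j IH jN]; first by rewrite (_ : iter 0 g = id) // image_id.
  have Hj := IH (ltnW jN).
  have -> : iter j.+1 g @` K = g @` (iter j g @` K).
    by rewrite image_comp; congr (_ @` K); apply/funext => z.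
  apply/(pres (iter j g @` K)) => //; [exact: KK_compact KKs _ Hj|exact: KK0 KKs _ Hj|].
  exact: inE (ltnW jN) e22.
have HK' := KKj N (leqnn N).
have [z0' [Kz0' Kmax']] := max_cmod (KK_compact KKs HK') (KK0 KKs HK').
have [fK' _] := inv _ HK' (inE N _ (leqnn N) e12).
have := @spread_bound R g b n.+1 N M (r / 4) rho t M0 H rho0 rho_r rho_1 rho_t Nt tA
  K z0' b0 isT t1 Nt2 Kr Kz0' Kmax'
  (fun u uz => circle K z0 (Ksub _ e32) fK Kz0 Kmax u uz)
  (fun u uz => circle _ z0' (inE N _ (leqnn N) e32) fK' Kz0' Kmax' u uz).
rewrite -/A -/D -/beta -/D1 -/D2.
move: tD; rewrite ler_pdivlMr; last by rewrite mulr_gt0 ?ltr0n.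
by have : 0 < beta := b0'; lra.
Qed.

End Hedgehog.

(** * Koenigs linearization *)

Section GeometricLimits.
Variable R : realType.
Local Notation C := (Cplx R).

Lemma le_geometric (x y K q : R) : 0 <= q < 1 -> (forall n, x <= y + K * q ^+ n) -> x <= y.
Proof.
move=> q01 H; rewrite leNgt; apply/negP => yx.
have yx0 : 0 < x - y by rewrite subr_gt0.
have [n nP] := expr_small q01 yx0 (normr_ge0 K).
have := H n; have : K * q ^+ n <= `|K| * q ^+ n.
  by apply: ler_wpM2r (ler_norm K); rewrite exprn_ge0 //; case/andP: q01.
lra.
Qed.

(** With [T n] the tail of the geometric series, the segments of centre [u n] and radius [T n] are
    nested. *)
Lemma real_geometric_limit (u : nat -> R) (K q : R) : 0 <= q < 1 ->
  (forall n, `|u n.+1 - u n| <= K * q ^+ n) ->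
  exists l, forall n, `|u n - l| <= K / (1 - q) * q ^+ n.
Proof.
move=> /andP[q0 q1] H; have q10 : 0 < 1 - q by rewrite subr_gt0.
pose T n := K / (1 - q) * q ^+ n.
have TS n : T n.+1 = T n - K * q ^+ n.
  by rewrite /T exprS; field; rewrite gt_eqF.
have K0 n : 0 <= K * q ^+ n by apply: le_trans (H n); exact: normr_ge0.
have T0 n : 0 <= T n.
  by rewrite /T mulrAC divr_ge0 // ltW.
have a_mono n : u n - T n <= u n.+1 - T n.+1.
  by have := H n; rewrite TS ler_norml => /andP[? ?]; lra.
have b_mono n : u n.+1 + T n.+1 <= u n + T n.
  by have := H n; rewrite TS ler_norml => /andP[? ?]; lra.
have ab n : u n - T n <= u n + T n by have := T0 n; lra.
have [l lP] := nested_segments a_mono b_mono ab.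
by exists l => n; have := lP n => /andP[? ?]; rewrite -/(T n) ler_norml; apply/andP; lra.
Qed.

Lemma geometric_limit (u : nat -> C) (K q : R) : 0 <= q < 1 ->
  (forall n, cmod (u n.+1 - u n) <= K * q ^+ n) ->
  exists l : C, forall n, cmod (u n - l) <= 2 * K / (1 - q) * q ^+ n.
Proof.
move=> q01 H.
have HRe n : `|complex.Re (u n.+1) - complex.Re (u n)| <= K * q ^+ n.
  by apply: le_trans (H n); rewrite -ReN -ReD; exact: cmod_Re.
have HIm n : `|complex.Im (u n.+1) - complex.Im (u n)| <= K * q ^+ n.
  by apply: le_trans (H n); rewrite -ImN -ImD; exact: cmod_Im.
have [x xP] := @real_geometric_limit (fun n => complex.Re (u n)) K q q01 HRe.
have [y yP] := @real_geometric_limit (fun n => complex.Im (u n)) K q q01 HIm.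
exists (Complex x y) => n; apply: le_trans (cmod_ReIm _) _.
rewrite ReD ImD ReN ImN; apply: le_trans (lerD (xP n) (yP n)) _.
by rewrite le_eqVlt; apply/orP; left; apply/eqP; ring.
Qed.

(** Cauchy's estimate on the differences makes the derivatives converge geometrically too, and the
    quadratic remainder of [u n] is bounded uniformly in [n], so it survives in the limit. *)
Lemma hol_geometric_limit (u : nat -> C -> C) (h : C -> C) s K q : 0 < s -> 0 <= q < 1 ->
  0 <= K -> (forall n, hol (u n) 0 s) ->
  (forall n w, cmod w < s -> cmod (u n w - h w) <= K * q ^+ n) ->
  (exists B, forall w, cmod w < s -> cmod (h w) <= B) ->
  hol h 0 s.
Proof.
move=> s0 q01 K0 uh uP [B hB] z; rewrite subr0 => zs.
have /andP[q0 q1] := q01.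
have qn n : 0 <= q ^+ n by rewrite exprn_ge0.
have qn1 n : q ^+ n <= 1 by rewrite exprn_ile1 // ltW.
pose rho := s - cmod z.
have rho0 : 0 < rho by rewrite subr_gt0.
have ins w : cmod (w - z) < rho -> cmod w < s.
  by have := cmod_sub w z; rewrite /rho; lra.
pose M := B + K.
have M0 : 0 <= M by apply: addr_ge0 => //; apply: le_trans (hB z zs); exact: cmod_ge0.
have uM n w : cmod (w - z) < rho -> cmod (u n w) <= M.
  move=> /ins ws; have := cmod_sub (u n w) (h w); have := hB w ws; have := uP n w ws.
  have : K * q ^+ n <= K by rewrite ler_piMr.
  by rewrite /M; lra.
have uhz n : hol (u n) z rho by apply: hol_sub (uh n); rewrite subr0 /rho; lra.
pose Q := 16 * M / rho ^+ 2.
have exd n : exists d, cderiv (u n) z d /\ forall w, cmod w <= rho / 4 ->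
    cmod (u n (z + w) - u n z - d * w) <= Q * cmod w ^+ 2.
  by have [d H [_ H2]] := cauchy_estimates rho0 (uhz n) (uM n); exists d.
pose d n := sval (cid (exd n)).
have dP n : cderiv (u n) z (d n) by rewrite /d; case: cid => ? [].
have dQ n w : cmod w <= rho / 4 -> cmod (u n (z + w) - u n z - d n * w) <= Q * cmod w ^+ 2.
  by have [_] := svalP (cid (exd n)); apply.
have dd n : cmod (d n.+1 - d n) <= 8 * K / rho * q ^+ n.
  have dh : hol (fun w => u n.+1 w - u n w) z rho.
    move=> w wz; have [x xP] := uhz n.+1 w wz; have [y yP] := uhz n w wz.
    by exists (x - y); exact: cderivB.
  have dM w : cmod (w - z) < rho -> cmod (u n.+1 w - u n w) <= 2 * K * q ^+ n.
    move=> /ins ws; have A1 := uP n.+1 w ws; have A2 := uP n w ws.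
    have := cmod_tri (u n.+1 w) (u n w) (h w); rewrite (cmodBC (h w)).
    have : K * q ^+ n.+1 <= K * q ^+ n by apply: ler_wpM2l => //; rewrite exprS ler_piMl // ltW.
    lra.
  have [x xP [xM _]] := cauchy_estimates rho0 dh dM.
  have -> : d n.+1 - d n = x by apply: cderiv_uniq xP; apply: cderivB (dP _) (dP _).
  apply: le_trans xM _; rewrite le_eqVlt; apply/orP; left; apply/eqP.
  by field; rewrite gt_eqF.
have [l lP] := geometric_limit q01 dd.
exists l.
have main w : cmod w <= rho / 4 -> cmod (h (z + w) - h z - l * w) <= Q * cmod w ^+ 2.
  move=> wr; have zws : cmod (z + w) < s.
    by apply: ins; rewrite addrAC subrr add0r; lra.
  apply: (@le_geometric _ _ (2 * K + 2 * (8 * K / rho) / (1 - q) * cmod w) q q01) => n.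
  have -> : h (z + w) - h z - l * w = (u n (z + w) - u n z - d n * w) +
    ((d n - l) * w - ((u n (z + w) - h (z + w)) - (u n z - h z))) by ring.
  apply: le_trans (cmodD _ _) _; apply: lerD; first exact: dQ.
  apply: le_trans (cmodB _ _) _; rewrite cmodM.
  have B1 := ler_wpM2r (cmod_ge0 w) (lP n).
  have B2 := le_trans (cmodB _ _) (lerD (uP n _ zws) (uP n z zs)).
  apply: le_trans (lerD B1 B2) _.
  by rewrite le_eqVlt; apply/orP; left; apply/eqP; ring.
have Q0 : 0 <= Q.
  by apply: divr_ge0; [apply: mulr_ge0; rewrite ?ler0n|exact: sqr_ge0].
move=> e e0; exists (Num.min (rho / 4) (e / (Q + 1))).
  by rewrite lt_min !divr_gt0 ?ltr0n //; lra.
move=> w; rewrite lt_min => /andP[/ltW w1]; rewrite ltr_pdivlMr; last by lra.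
move=> w2; have := main _ w1; have -> : z + (w - z) = w by ring.
move=> H; apply: le_trans H _; rewrite expr2 mulrA; apply: ler_wpM2r; first exact: cmod_ge0.
by have := cmod_ge0 (w - z); nra.
Qed.

End GeometricLimits.

Section Koenigs.
Variable R : realType.
Local Notation C := (Cplx R).
Implicit Types (f g h : C -> C) (z w l : C) (r s : R).

Lemma taylor1 g r l : 0 < r -> hol g 0 r -> g 0 = 0 -> cderiv g 0 l ->
  exists s M, [/\ 0 < s, s <= r, 0 <= M &
    forall w, cmod w <= s -> cmod (g w - l * w) <= M * cmod w ^+ 2].
Proof.
move=> r0 gh g0 gd; have [a [B [B0 aP]]] := taylor_ball r0 gh.
have r40 : 0 < r / 4 by rewrite divr_gt0 // ltr0n.
have gB z : cmod (z - 0) < r / 4 -> cmod (g z) <= B.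
  rewrite subr0 => /ltW zr; have := aP 0%N z zr.
  by rewrite big_ord0 subr0 expr0 mulr1 add0r.
have gh4 : hol g 0 (r / 4) by apply: hol_sub gh; rewrite subr0 cmod0; lra.
have [d dd [_ H]] := cauchy_estimates r40 gh4 gB.
have dl := cderiv_uniq dd gd; rewrite dl in H.
exists (r / 4 / 4), (16 * B / (r / 4) ^+ 2); split.
- by rewrite divr_gt0 // ltr0n.
- lra.
- by apply: divr_ge0; [apply: mulr_ge0; rewrite ?ler0n|exact: sqr_ge0].
- by move=> w /H; rewrite add0r g0 subr0.
Qed.

(** [h] is the limit of [l ^- n * g^n]. An increment is the quadratic remainder of [g] at a point of
    size [k ^+ n * cmod w], divided by [l ^+ n.+1], so it decays like [q ^+ n] with
    [q = k ^+ 2 / cmod l]. *)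
Lemma koenigs g l : is_germ g l -> cmod l < 1 ->
  exists h, is_germ h 1 /\ germ_eq (h \o g) (fun z => l * h z).
Proof.
move=> [l0 [r [r0 gh g0 gd]]] l1.
have [r1 [M [r10 r1r M0 gM]]] := taylor1 r0 gh g0 gd.
pose x := cmod l; have x0 : 0 < x by rewrite cmod_gt0.
have x1 : x < 1 := l1.
(* [k] lies strictly between [|l|] and [sqrt |l|], so that [q = k^2 / |l| < 1];
   indeed [4 (1 - q) = (1 - |l|)^2 (4 - |l|)]. *)
pose k := x * (3 - x) / 2; pose q := x * (3 - x) ^+ 2 / 4.
have xk : x < k by rewrite /k; nra.
have k0 : 0 < k by lra.
have q0 : 0 <= q by rewrite /q; apply: divr_ge0 => //; apply: mulr_ge0; [exact: ltW|exact: sqr_ge0].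
have q1 : q < 1.
  have : 0 < (1 - x) ^+ 2 * (4 - x).
    by apply: mulr_gt0; [apply: exprn_gt0; lra|lra].
  have -> : (1 - x) ^+ 2 * (4 - x) = 4 * (1 - q) by rewrite /q; field.
  by rewrite pmulr_rgt0 ?ltr0n // subr_gt0.
have k1 : k < 1 by rewrite /k; nra.
have q01 : 0 <= q < 1 by rewrite q0 q1.
have kq : k ^+ 2 = x * q by rewrite /k /q; field.
(* On this disc the quadratic remainder is at most [(k - x) * cmod w], so [g] contracts by the
   factor [k]. *)
pose s := Num.min r1 ((k - x) / (M + 1)).
have M1 : 0 < M + 1 by lra.
have s0 : 0 < s by rewrite lt_min r10 divr_gt0 // subr_gt0.
have sr1 : s <= r1 by rewrite ge_min lexx.
have sM : M * s <= k - x.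
  have : s <= (k - x) / (M + 1) by rewrite ge_min lexx orbT.
  by rewrite ler_pdivlMr //; nra.
have gk w : cmod w < s -> cmod (g w) <= k * cmod w.
  move=> ws; have cw := cmod_ge0 w.
  have H := gM w (le_trans (ltW ws) sr1).
  have -> : g w = (g w - l * w) + l * w by ring.
  apply: le_trans (cmodD _ _) _; rewrite cmodM -/x.
  have : M * cmod w ^+ 2 <= (k - x) * cmod w.
    rewrite expr2 mulrA; apply: ler_wpM2r => //.
    by apply: le_trans sM; apply: ler_wpM2l => //; exact: ltW.
  lra.
have it w n : cmod w < s -> cmod (iter n g w) <= k ^+ n * cmod w /\ cmod (iter n g w) < s.
  move=> ws; elim: n => [|n [IH1 IH2]]; first by rewrite expr0 mul1r.
  have H := gk _ IH2; have c0 := cmod_ge0 (iter n g w).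
  rewrite iterS; split.
    by apply: le_trans H _; rewrite exprS -mulrA; apply: ler_wpM2l IH1; exact: ltW.
  by apply: le_lt_trans H _; apply: le_lt_trans IH2; rewrite ler_piMl // ltW.
pose u n w := l^-1 ^+ n * iter n g w.
have uS n w : cmod w < s -> cmod (u n.+1 w - u n w) <= M / x * cmod w ^+ 2 * q ^+ n.
  move=> ws; have [H1 H2] := it w n ws.
  have -> : u n.+1 w - u n w = l^-1 ^+ n.+1 * (g (iter n g w) - l * iter n g w).
    by rewrite /u iterS !exprS; field.
  rewrite cmodM cmodX cmodV -/x.
  have H3 : cmod (g (iter n g w) - l * iter n g w) <= M * (k ^+ n * cmod w) ^+ 2.
    apply: le_trans (gM _ _) _; first exact: le_trans (ltW H2) sr1.
    by apply: ler_wpM2l => //; apply: lerXn2r; rewrite ?nnegrE ?mulr_ge0 ?cmod_ge0 ?exprn_ge0 // ltW.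
  apply: le_trans (ler_wpM2l _ H3) _; first by rewrite exprn_ge0 // invr_ge0 ltW.
  rewrite exprMn -exprM mulnC exprM kq exprMn exprS.
  rewrite le_eqVlt; apply/orP; left; apply/eqP.
  have xn : x ^+ n != 0 by rewrite expf_neq0 // gt_eqF.
  rewrite exprVn; move: (x ^+ n) (q ^+ n) xn => a b a0; field.
  by rewrite a0 gt_eqF.
have exh w : exists y, cmod w < s ->
    forall n, cmod (u n w - y) <= 2 * (M / x * cmod w ^+ 2) / (1 - q) * q ^+ n.
  have [ws|] := pselect (cmod w < s); last by exists 0.
  by have [y yP] := geometric_limit q01 (fun n => uS n w ws); exists y.
pose h w := sval (cid (exh w)).
have hP w n : cmod w < s -> cmod (u n w - h w) <= 2 * (M / x * cmod w ^+ 2) / (1 - q) * q ^+ n.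
  by move=> ws; have := svalP (cid (exh w)); apply.
have q10 : 0 < 1 - q by rewrite subr_gt0.
pose B := 2 * (M / x) / (1 - q).
have B0 : 0 <= B.
  by apply: divr_ge0; [apply: mulr_ge0 => //; apply: divr_ge0 => //; exact: ltW|exact: ltW].
have {}hP w n : cmod w < s -> cmod (u n w - h w) <= B * cmod w ^+ 2 * q ^+ n.
  move=> ws; have := hP w n ws.
  by have -> : 2 * (M / x * cmod w ^+ 2) / (1 - q) = B * cmod w ^+ 2 by rewrite /B; ring.
have h1 w : cmod w < s -> cmod (h w - w) <= B * cmod w ^+ 2.
  by move=> /(hP w 0%N); rewrite /u /= !expr0 mul1r mulr1 cmodBC.
have h0 : h 0 = 0.
  have := h1 0; rewrite cmod0 expr0n mulr0 subr0 => /(_ s0) H.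
  by apply/eqP; rewrite -cmod_eq0 eq_le H cmod_ge0.
have w2 w : cmod w < s -> cmod w ^+ 2 <= s ^+ 2.
  by move=> ws; apply: lerXn2r; rewrite ?nnegrE ?cmod_ge0 // ltW.
have hh : hol h 0 s.
  apply: (@hol_geometric_limit R u h s (B * s ^+ 2) q s0 q01).
  - by apply: mulr_ge0 => //; exact: sqr_ge0.
  - move=> n z; rewrite subr0 => zs.
    have [d zd] : exists d, cderiv (iter n g) z d.
      elim: n => [|n [d IH]]; first by exists 1; exact: cderiv_id.
      have [_ ins] := it z n zs.
      have [|e ed] := gh (iter n g z); first by rewrite subr0; lra.
      by exists (e * d); exact: (cderiv_comp IH ed).
    by exists (l^-1 ^+ n * d); exact: cderivZ.
  - move=> n w ws; apply: le_trans (hP w n ws) _.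
    by apply: ler_wpM2r; [exact: exprn_ge0|apply: ler_wpM2l; rewrite ?w2].
  - exists (s + B * s ^+ 2) => w ws.
    have -> : h w = w + (h w - w) by ring.
    apply: le_trans (cmodD _ _) _; apply: lerD; first exact: ltW.
    by apply: le_trans (h1 w ws) _; apply: ler_wpM2l; rewrite ?w2.
exists h; split.
  split; first exact: oner_neq0.
  exists s; split => // e e0.
  exists (Num.min s (e / (B + 1))); first by rewrite lt_min s0 divr_gt0 //; lra.
  move=> w; rewrite subr0 lt_min => /andP[ws]; rewrite ltr_pdivlMr; last by lra.
  move=> we; rewrite h0 subr0 mul1r; apply: le_trans (h1 w ws) _.
  rewrite expr2 mulrA; apply: ler_wpM2r; first exact: cmod_ge0.
  by have := cmod_ge0 w; nra.
apply/nbhs_cmod; exists s => // w; rewrite subr0 => ws /=.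
have [_ gs] := it w 1%N ws; rewrite /= in gs.
apply/eqP; rewrite -subr_eq0 -cmod_eq0 eq_le cmod_ge0 andbT.
apply: (@le_geometric _ _ _ (2 * (B * s ^+ 2)) q q01) => n; rewrite add0r.
(* The approximants satisfy [u n (g w) = l * u n.+1 w] exactly, so only their distances to [h]
   remain. *)
have -> : h (g w) - l * h w = l * (u n.+1 w - h w) - (u n (g w) - h (g w)).
  have -> : u n (g w) = l * u n.+1 w.
    by rewrite /u iterSr exprS; field.
  ring.
apply: le_trans (cmodB _ _) _; rewrite cmodM -/x.
have T w' n' : cmod w' < s -> cmod (u n' w' - h w') <= B * s ^+ 2 * q ^+ n'.
  move=> ws'; apply: le_trans (hP w' n' ws') _.
  by apply: ler_wpM2r; [exact: exprn_ge0|apply: ler_wpM2l; rewrite ?w2].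
have qs : q ^+ n.+1 <= q ^+ n by rewrite exprS ler_piMl ?exprn_ge0 // ltW.
have T1 : x * cmod (u n.+1 w - h w) <= 1 * (B * s ^+ 2 * q ^+ n).
  apply: ler_pM; rewrite ?cmod_ge0 ?(ltW x0) ?(ltW x1) //.
  apply: le_trans (T w n.+1 ws) _; apply: ler_wpM2l => //.
  by apply: mulr_ge0 => //; exact: sqr_ge0.
have T2 := T (g w) n gs.
lra.
Qed.

(** The quotient [F w / w] is unchanged when [w] is replaced by [l ^+ n * w], and along that
    sequence it tends to [mu]. *)
Lemma commute_contraction F l (mu : C) : is_germ F mu -> l != 0 -> cmod l < 1 ->
  germ_eq (fun w => F (l * w)) (fun w => l * F w) -> germ_eq F (fun w => mu * w).
Proof.
move=> [_ [r [r0 Fh F0 Fd]]] l0 l1 /nbhs_cmod[s s0 sP].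
have x0 : 0 < cmod l by rewrite cmod_gt0.
have small n w : cmod w < s -> cmod (l ^+ n * w) < s.
  move=> ws; rewrite cmodM cmodX; apply: le_lt_trans ws.
  by rewrite ler_piMl ?cmod_ge0 // exprn_ile1 ?cmod_ge0 // ltW.
have it n w : cmod w < s -> F (l ^+ n * w) = l ^+ n * F w.
  move=> ws; elim: n => [|n IH]; first by rewrite !expr0 !mul1r.
  by rewrite !exprS -!mulrA sP ?subr0 ?small // IH.
apply/nbhs_cmod; exists s => // w; rewrite subr0 => ws.
apply/eqP; rewrite -subr_eq0 -cmod_eq0 eq_le cmod_ge0 andbT.
have [->|w0] := eqVneq w 0; first by rewrite F0 mulr0 subrr cmod0.
have cw : 0 < cmod w by rewrite cmod_gt0.
apply/ler_addgt0Pl => e e0; rewrite addr0.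
have [t t0 tP] := Fd (e / cmod w) (divr_gt0 e0 cw).
have l01 : 0 <= cmod l < 1 by rewrite cmod_ge0.
have [n nP] := expr_small l01 t0 (ltW cw).
have Ht : cmod (l ^+ n * w - 0) < t by rewrite subr0 cmodM cmodX mulrC.
have := tP _ Ht; rewrite F0 !subr0 it //.
have -> : l ^+ n * F w - mu * (l ^+ n * w) = l ^+ n * (F w - mu * w) by ring.
rewrite !cmodM cmodX; have -> : e / cmod w * (cmod l ^+ n * cmod w) = cmod l ^+ n * e.
  by field; rewrite gt_eqF.
by rewrite ler_pM2l ?exprn_gt0.
Qed.

End Koenigs.

(** * The automorphism group *)

Section Automorphisms.
Variable R : realType.
Local Notation C := (Cplx R).
Implicit Types (f g h : C -> C) (l : C).
Variable KK : set (set C).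
Hypothesis KKhedge : hedgehog_germ KK.

Let KKsmall : small_family KK. Proof. by case: KKhedge. Qed.

Lemma Aut_germ g : Aut KK g -> is_germ g (derive1 g 0).
Proof. by case=> /in_Diff0P. Qed.

Lemma Aut_id : Aut KK id.
Proof.
apply: (preserves_Aut KKsmall (@is_germ_id R)).
by exists 1 => // K _ _ _; rewrite image_id.
Qed.

Lemma Aut_comp g1 g2 : Aut KK g1 -> Aut KK g2 -> Aut KK (g1 \o g2).
Proof.
move=> A1 A2; have gg1 := Aut_germ A1; have gg2 := Aut_germ A2.
have gp1 := Aut_preserves A1; have gp2 := Aut_preserves A2.
exact: (preserves_Aut KKsmall (is_germ_comp gg1 gg2) (preserves_comp gg1 gg2 gp1 gp2)).
Qed.

Lemma Aut_inv g l : Aut KK g -> is_germ g l -> exists h,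
  [/\ Aut KK h, is_germ h l^-1, germ_eq (h \o g) id & germ_eq (g \o h) id].
Proof.
move=> Ag gg; have [h [hg hgid ghid]] := is_germ_inv gg.
exists h; split => //.
exact: (preserves_Aut KKsmall hg (preserves_inv gg hg ghid (Aut_preserves Ag))).
Qed.

Lemma Aut_tangent_id g : Aut KK g -> is_germ g 1 -> germ_eq g id.
Proof.
move=> Ag gg; have [f [a [e [fg airr _ e0 inv]]]] := hedgehog_invariant KKhedge.
exact: (parabolic_trivial KKsmall fg airr e0 inv gg (Aut_preserves Ag)).
Qed.

(** The inverse germ of [g2] composed with [g1] is an automorphism tangent to the identity. *)
Lemma Aut_inj g1 g2 l : Aut KK g1 -> Aut KK g2 -> is_germ g1 l -> is_germ g2 l ->
  germ_eq g1 g2.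
Proof.
move=> A1 A2 gg1 gg2; have [h [Ah hh hg gh]] := Aut_inv A2 gg2.
have hg1 : is_germ (h \o g1) 1.
  by have := is_germ_comp hh gg1; rewrite mulVf //; case: gg1.
have H := Aut_tangent_id (Aut_comp Ah A1) hg1.
have step1 : germ_eq (id \o g1) ((g2 \o h) \o g1).
  exact: (germ_eq_comp gg1 (germ_eq_sym gh) (germ_eq_refl g1)).
have step2 : germ_eq (g2 \o (h \o g1)) (g2 \o id).
  exact: (germ_eq_comp hg1 (germ_eq_refl g2) H).
exact: germ_eq_trans step1 step2.
Qed.

(** Both composites have the same multiplier. No information on its modulus enters, so commutation
    is available for the proof that the modulus is 1. *)
Lemma Aut_commute g1 g2 : Aut KK g1 -> Aut KK g2 -> germ_eq (g1 \o g2) (g2 \o g1).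
Proof.
move=> A1 A2; have gg1 := Aut_germ A1; have gg2 := Aut_germ A2.
have H := is_germ_comp gg2 gg1; rewrite mulrC in H.
exact: Aut_inj (Aut_comp A1 A2) (Aut_comp A2 A1) (is_germ_comp gg1 gg2) H.
Qed.

(* If [|g'(0)| < 1], the Koenigs coordinate of [g] linearizes every germ that
   commutes with [g], in particular [f]. *)
Lemma Aut_not_contracting g l : Aut KK g -> is_germ g l -> 1 <= cmod l.
Proof.
move=> Ag gg; rewrite leNgt; apply/negP => g1.
have [f [a [e [fg airr nl e0 inv]]]] := hedgehog_invariant KKhedge.
have Af : Aut KK f.
  apply: (preserves_Aut KKsmall fg (preserves_self fg e0 _)).
  by move=> K HK Ke; have [] := inv K HK Ke.
have l0 : l != 0 by case: gg.
have [h [hh hg]] := koenigs gg g1.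
have [H [HH Hh hH]] := is_germ_inv hh; rewrite invr1 in HH.
have fgc := Aut_commute Af Ag.
have F_germ : is_germ (h \o (f \o H)) (expi a).
  by have := is_germ_comp hh (is_germ_comp fg HH); rewrite mul1r mulr1.
have ll_germ : is_germ (fun z => l * z) l.
  split => //; exists 1; split; rewrite ?mulr0 //.
    by move=> z _; exists (l * 1); exact: cderivZ (@cderiv_id R z).
  by rewrite -{2}(mulr1 l); exact: cderivZ (@cderiv_id R 0).
pose L := fun z : C => l * z.
have LhH : germ_eq (L \o (h \o H)) (L \o id).
  exact: (germ_eq_comp (is_germ_comp hh HH) (germ_eq_refl L) hH).
have hgH : germ_eq ((h \o g) \o H) (L \o (h \o H)).
  exact: (germ_eq_comp HH hg (germ_eq_refl H)).
have HL : germ_eq (H \o L) (H \o ((h \o g) \o H)).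
  apply: (germ_eq_comp ll_germ (germ_eq_refl H)); apply: germ_eq_sym.
  exact: germ_eq_trans hgH LhH.
have HgH : germ_eq ((H \o h) \o (g \o H)) (id \o (g \o H)).
  exact: (germ_eq_comp (is_germ_comp gg HH) Hh (germ_eq_refl (g \o H))).
have Hg_lin : germ_eq (H \o L) (g \o H) := germ_eq_trans HL HgH.
have c1 : germ_eq ((h \o f) \o (H \o L)) ((h \o f) \o (g \o H)).
  exact: (germ_eq_comp (is_germ_comp HH ll_germ) (germ_eq_refl (h \o f)) Hg_lin).
have c2 : germ_eq (h \o ((f \o g) \o H)) (h \o ((g \o f) \o H)).
  apply: (germ_eq_comp (is_germ_comp (is_germ_comp fg gg) HH) (germ_eq_refl h)).
  exact: (germ_eq_comp HH fgc (germ_eq_refl H)).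
have c3 : germ_eq ((h \o g) \o (f \o H)) ((L \o h) \o (f \o H)).
  exact: (germ_eq_comp (is_germ_comp fg HH) hg (germ_eq_refl (f \o H))).
(* As germs, [h f H L = h f g H = h g f H = L h f H]. *)
have comm : germ_eq (fun w => (h \o (f \o H)) (l * w)) (fun w => l * (h \o (f \o H)) w).
  exact: germ_eq_trans c1 (germ_eq_trans c2 c3).
have lin := commute_contraction F_germ l0 g1 comm.
apply: nl.
have [_ [r [r0 Hhol H0 Hd]]] := HH; have [_ [s [s0 hhol h0 hd]]] := hh.
(* The conjugacy in [linearizable] goes from the linear coordinate to the original one, so [H] takes
   its place and [h] is the inverse. *)
exists H, h, (ofR (Num.min r s)); split; first by rewrite ofR_gt0 lt_min r0.
split.
  move=> z /ball_cmod; rewrite lt_min => /andP[zr _].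
  by have [d /cderiv_differentiable] := Hhol z zr.
split.
  move=> z /ball_cmod; rewrite lt_min => /andP[_ zs].
  by have [d /cderiv_differentiable] := hhol z zs.
split; first exact: H0.
split; first exact: cderiv_derive1 Hd.
split; first exact: hH.
by split; [exact: Hh|exact: lin].
Qed.

Lemma Aut_unit_circle g l : Aut KK g -> is_germ g l -> cmod l = 1.
Proof.
move=> Ag gg; have [h [Ah hh _ _]] := Aut_inv Ag gg.
have l0 : 0 < cmod l by rewrite cmod_gt0; case: gg.
apply/eqP; rewrite eq_le (Aut_not_contracting Ag gg) andbT.
by have := Aut_not_contracting Ah hh; rewrite cmodV invf_ge1.
Qed.

End Automorphisms.

Theorem theorem3p9 (R : realType) (KK : set (set (Cplx R))) :
  hedgehog_germ KK ->
  ((* Aut([KK]) is a subgroup of Diff(C,0) (composition of germs) *)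
      Aut KK id) /\
      (forall g1 g2, Aut KK g1 -> Aut KK g2 -> Aut KK (g1 \o g2)) /\
      (forall g, Aut KK g -> exists h, [/\ Aut KK h, germ_eq (h \o g) id
                                         & germ_eq (g \o h) id]) /\
      (* lambda(g) = g'(0) is a group homomorphism into C^* ... *)
      (forall g1 g2, Aut KK g1 -> Aut KK g2 ->
         derive1 (g1 \o g2) 0 = derive1 g1 0 * derive1 g2 0) /\
      (* ... which is injective ... *)
      (forall g1 g2, Aut KK g1 -> Aut KK g2 ->
         derive1 g1 0 = derive1 g2 0 -> germ_eq g1 g2) /\
      (* ... with image in the unit circle S^1 *)
      (forall g, Aut KK g -> `|derive1 g 0| = 1) /\
      (* consequently Aut([KK]) is abelian ... *)
      (forall g1 g2, Aut KK g1 -> Aut KK g2 -> germ_eq (g1 \o g2) (g2 \o g1)) /\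
      (* ... and each element is uniquely determined by its rotation number *)
      (forall g1 g2 (t1 t2 : R), Aut KK g1 -> Aut KK g2 ->
         derive1 g1 0 = expi t1 -> derive1 g2 0 = expi t2 ->
         (exists k : int, t1 - t2 = k%:~R) -> germ_eq g1 g2).
Proof.
move=> KKh; split; first exact: Aut_id.
split; first exact: Aut_comp.
split.
  move=> g Ag; have [h [Ah _ hg gh]] := Aut_inv KKh Ag (Aut_germ Ag).
  by exists h.
split.
  move=> g1 g2 A1 A2; apply: is_germ_derive1.
  exact: is_germ_comp (Aut_germ A1) (Aut_germ A2).
split.
  move=> g1 g2 A1 A2 E; have gg1 := Aut_germ A1; rewrite E in gg1.
  exact: (Aut_inj KKh A1 A2 gg1 (Aut_germ A2)).
split.
  by move=> g Ag; rewrite norm_cmod (Aut_unit_circle KKh Ag (Aut_germ Ag)).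
split; first exact: Aut_commute.
move=> g1 g2 t1 t2 A1 A2 E1 E2 [k tk].
have gg1 := Aut_germ A1; rewrite E1 in gg1.
have gg2 := Aut_germ A2; rewrite E2 in gg2.
apply: (Aut_inj KKh A1 A2 gg1).
by rewrite -(subrK t2 t1) tk expiD expi_int mul1r.
Qed.
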